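(* Let $\Gamma$ be a (countable) discrete group which is torsionless or, more generally, which has no non-trivial finite subgroups of square order. Then any right Galois co-object for $(\mathcal L(\Gamma),\Delta_{\mathcal L(\Gamma)})$ is isomorphic to $(\mathcal L(\Gamma),\Delta_{\mathcal L(\Gamma)})$ as a right Galois co-object. In particular, any unitary 2-cocycle for $\mathcal L(\Gamma)$ is then a 2-coboundary.
   Context: Conventions: Hilbert spaces are separable, von Neumann algebras have separable predual; $\bar\otimes$ is the $\sigma$-weakly closed spatial tensor product (of von Neumann algebras or of $\sigma$-weakly closed operator spaces). For a discrete group $\Gamma$, $\mathcal L(\Gamma)$ is the group von Neumann algebra with unitary generators $\lambda_g$, acting on $\ell^2(\Gamma)$, with the comultiplication $\Delta_{\mathcal L(\Gamma)}(\lambda_g)=\lambda_g\otimes\lambda_g$; write $M=\mathcal L(\Gamma)$, $\Delta_M=\Delta_{\mathcal L(\Gamma)}$, $L^2(M)=\ell^2(\Gamma)$. A right Galois co-object for $(M,\Delta_M)$ consists of a Hilbert space $L^2(N)$, a $\sigma$-weakly closed linear space $N\subseteq B(L^2(M),L^2(N))$ and a normal linear map $\Delta_N:N\to N\bar\otimes N$ such that, with $N^{\mathrm{op}}=\{x^*\mid x\in N\}$: (1) $N\cdot L^2(M)$ is norm-dense in $L^2(N)$ and $N^{\mathrm{op}}\cdot L^2(N)$ is norm-dense in $L^2(M)$; (2) $NM\subseteq N$; (3) $x^*y\in M$ for $x,y\in N$; (4) $\Delta_N(xy)=\Delta_N(x)\Delta_M(y)$ for $x\in N,y\in M$; (5)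 $\Delta_N(x)^*\Delta_N(y)=\Delta_M(x^*y)$ for $x,y\in N$; (6) $(\Delta_N\otimes\iota)\Delta_N=(\iota\otimes\Delta_N)\Delta_N$; (7) the linear span of $\{\Delta_N(x)(y\otimes z)\mid x\in N,\ y,z\in M\}$ is $\sigma$-weakly dense in $N\bar\otimes N$. $(M,\Delta_M)$ is itself one, with $L^2(N)=L^2(M)$. Two right Galois co-objects $(N_1,\Delta_{N_1}),(N_2,\Delta_{N_2})$ are isomorphic if there is a unitary $u:L^2(N_1)\to L^2(N_2)$ with $uN_1=N_2$ and $\Delta_{N_2}(ux)=(u\otimes u)\Delta_{N_1}(x)$ for $x\in N_1$. A unitary 2-cocycle for $(M,\Delta_M)$ is a unitary $\Omega\in M\bar\otimes M$ with $(\Omega\otimes1)(\Delta_M\otimes\iota)(\Omega)=(1\otimes\Omega)(\iota\otimes\Delta_M)(\Omega)$. It is a 2-coboundary if there is a unitary $u\in M$ with $\Omega=(u^*\otimes u^* )\Delta_M(u)$. *)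

(* Defs.v *)
From HB Require Import structures.
From mathcomp Require Import all_boot all_order all_algebra finmap sesquilinear.
From mathcomp Require Import ring complex.
From mathcomp Require Import boolp classical_sets functions cardinality filter.
From mathcomp Require Import reals topology normedtype sequences summability.

Set Implicit Arguments.
Unset Strict Implicit.
Unset Printing Implicit Defensive.

Import Order.TTheory GRing.Theory Num.Theory Num.Def.
Import numFieldNormedType.Exports.

Local Open Scope classical_set_scope.
Local Open Scope ring_scope.

(* R[i] packaged as a numClosedFieldType, so that it inherits the norm and the
   topology that numFieldNormedType gives to abstract closed fields. *)
Definition Cplx (R : realType) : numClosedFieldType := R[i].

HB.mixin Record isHilbert (R : realType) H
    & CompleteNormedModule (Cplx R) H := {
  hdot : {dot H for @conjC (Cplx R)};
  sqr_norm_hdot : forall x : H, `|x| ^+ 2 = hdot x x }.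

(* Complex Hilbert spaces; hdot is linear in its first argument. *)
#[short(type="hilbertType")]
HB.structure Definition Hilbert (R : realType) :=
  {H of CompleteNormedModule (Cplx R) H & isHilbert R H}.

Section CplxComplete.
Variable R : realType.
Local Notation C := (Cplx R).

Lemma CRe_le (z : C) : `|complex.Re z|%:C%C <= `|z|.
Proof. exact: normc_ge_Re. Qed.

Lemma CIm_le (z : C) : `|complex.Im z|%:C%C <= `|z|.
Proof.
have := CRe_le (z * 'i%C); rewrite ReiNIm normrN => /le_trans; apply.
by rewrite normrM (_ : `|'i%C : C| = 1) ?mulr1// normc_def/= expr0n/= add0r expr1n sqrtr1.
Qed.

Lemma CRe_cauchy (f : C -> R) (F : set_system C) :
  (forall x y, f (x - y) = f x - f y) ->
  (forall z, (`|f z|%:C%C : C) <= `|z|) ->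
  ProperFilter F -> cauchy F -> cauchy (f @ F).
Proof.
move=> fB fle FF /cauchyP Fc; apply/cauchy_exP => e e0.
have e0' : (0 : C) < e%:C%C by rewrite (ltcR 0 e).
have [x xF] := Fc _ e0'.
exists (f x); suff: F [set y | ball (f x) e (f y)] by [].
apply: filterS xF => y; rewrite -!ball_normE /= -fB => xy.
by rewrite -(ltcR (`|_|) e); exact: le_lt_trans (fle _) xy.
Qed.

Lemma Cplx_cvg (F : set_system C) (FF : ProperFilter F) a b :
  (@complex.Re R) @ F --> a -> (@complex.Im R) @ F --> b -> F --> (Complex a b : C).
Proof.
move=> Fa Fb; apply/cvgrPdist_lt => e e0.
pose r := complex.Re e.
have er : e = r%:C%C.
  by move: e0; rewrite /r; case: (e) => u v; rewrite ltcE /= => /andP[/eqP-> _].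
have r0 : 0 < r by move: e0; rewrite er -(ltcR 0 r).
near=> z.
have za : `|a - complex.Re z| < r / 2.
  by near: z; move/cvgrPdist_lt: Fa; apply; rewrite divr_gt0.
have zb : `|b - complex.Im z| < r / 2.
  by near: z; move/cvgrPdist_lt: Fb; apply; rewrite divr_gt0.
have -> : (Complex a b : C) - z
    = (a - complex.Re z)%:C%C + (b - complex.Im z)%:C%C * 'i%C.
  by clear; case: z => u v /=; simpc.
apply: le_lt_trans (ler_normD _ _) _.
rewrite normrM (_ : `|'i%C : C| = 1) ?mulr1; last first.
  by rewrite normc_def/= expr0n/= add0r expr1n sqrtr1.
rewrite !normc_def /= expr0n /= !addr0 !sqrtr_sqr -raddfD /= er.
by rewrite (ltcR _ r) (splitr r) ltrD.
Unshelve. all: by end_near. Qed.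

Lemma Cplx_complete (F : set_system C) : ProperFilter F -> cauchy F -> cvg F.
Proof.
move=> FF Fc; apply/cvg_ex.
have ReB (x y : C) : complex.Re (x - y) = complex.Re x - complex.Re y.
  by case: x y => ? ? [].
have ImB (x y : C) : complex.Im (x - y) = complex.Im x - complex.Im y.
  by case: x y => ? ? [].
have /cauchy_cvg/cvg_ex[a Fa] := CRe_cauchy ReB CRe_le FF Fc.
have /cauchy_cvg/cvg_ex[b Fb] := CRe_cauchy ImB CIm_le FF Fc.
by exists (Complex a b); exact: Cplx_cvg.
Qed.
End CplxComplete.

Lemma conjC_continuous (K : numClosedFieldType) : continuous (fun z : K => z^*).
Proof.
move=> l A [e e0 eA]; exists e => // z lz; apply: eA.
by rewrite /= -rmorphB norm_conjC.
Qed.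

Section DotNorm.
Variables (K : numClosedFieldType) (U : lmodType K) (form : {dot U for @conjC K}).
Local Notation "''[' u , v ]" := (form u%R v%R) : ring_scope.
Local Notation "''[' u ]" := '[u, u]%R : ring_scope.

Lemma dot_CauchySchwarz (u v : U) : `|'[u, v]| ^+ 2 <= '[u] * '[v].
Proof.
have [-> | nz_v] := eqVneq v 0; first by rewrite !linear0r normr0 expr0n mulr0.
without loss ou: u / '[u, v] = 0.
  move=> IHo; pose a := '[u, v] / '[v]; pose u1 := u - a *: v.
  have ou: '[u1, v] = 0.
    by rewrite linearBl /= linearZl_LR divfK ?dnorm_eq0 ?subrr.
  rewrite (canRL (subrK _) (erefl u1)) linearDl /= ou add0r.
  rewrite linearZl_LR/= normrM (ger0_norm (dnorm_ge0 _ _)).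
  rewrite exprMn mulrA -dnormZ hnormDd/=; last by rewrite linearZr_LR/= ou mulr0.
  by rewrite mulrDl lerDr mulr_ge0 ?dnorm_ge0.
by rewrite ou normr0 expr0n mulr_ge0 ?dnorm_ge0.
Qed.

Lemma dot_triangle (u v : U) :
  sqrtC '[u + v] <= sqrtC '[u] + sqrtC '[v].
Proof.
rewrite -ler_sqr ?rpredD ?nnegrE ?sqrtC_ge0 ?dnorm_ge0 ?addr_ge0 ?sqrtC_ge0 ?dnorm_ge0//.
rewrite sqrrD !sqrtCK addrAC dnormD lerD2l.
have -> : '[u, v] + '[u, v]^* = 'Re '[u, v] *+ 2.
  by rewrite ReE -[RHS]mulr_natr divfK ?pnatr_eq0.
rewrite lerMn2r /=; apply: le_trans (leif_Re_Creal _) _.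
rewrite -ler_sqr ?nnegrE ?normr_ge0 ?mulr_ge0 ?sqrtC_ge0 ?dnorm_ge0//.
by rewrite exprMn !sqrtCK dot_CauchySchwarz.
Qed.

Lemma sqrtC_dotZ a (u : U) : sqrtC '[a *: u] = `|a| * sqrtC '[u].
Proof. by rewrite dnormZ sqrtCM ?nnegrE ?exprn_ge0 ?dnorm_ge0// sqrCK. Qed.

Lemma sqrtC_dot_eq0 (u : U) : sqrtC '[u] = 0 -> u = 0.
Proof. by move/eqP; rewrite sqrtC_eq0 dnorm_eq0 => /eqP. Qed.
End DotNorm.

Section Sums.
Variables (R : realType) (I : choiceType).
Local Notation C := (Cplx R).

Lemma partial_sumE (V : zmodType) (h : I -> V) A :
  partial_sum h A = \sum_(i <- A) h i.
Proof. by rewrite /partial_sum big_seq_fsetE. Qed.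

Lemma fset_sum_split (V : zmodType) (h : I -> V) (A B : {fset I}) :
  (A `<=` B)%fset ->
  \sum_(i <- B) h i = \sum_(i <- A) h i + \sum_(i <- B | i \notin A) h i.
Proof.
move=> AB; rewrite (bigID (mem A)) /=; congr (_ + _).
rewrite big_fset_condE; apply: congr_big => //.
suff -> : [fset i in B | i \in A]%fset = A by [].
by apply/fsetP => i; rewrite !inE /= andbC; case: (boolP (i \in A)) => // /(fsubsetP AB) ->.
Qed.

Lemma ge0_CRe (z : C) : 0 <= z -> z = (complex.Re z)%:C%C.
Proof. by case: z => a b; rewrite lecE /= => /andP[/eqP -> _]. Qed.

Lemma CRe_mono (x y : C) : x <= y -> complex.Re x <= complex.Re y.
Proof. by rewrite lecE => /andP[]. Qed.

Lemma CRe_monolt (x y : C) : x < y -> complex.Re x < complex.Re y.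
Proof. by rewrite ltcE => /andP[]. Qed.

Lemma abs_sum_adherent (h : I -> C) (M : C) :
  (forall A : {fset I}, \sum_(i <- A) `|h i| <= M) ->
  forall e : C, 0 < e -> exists A : {fset I}, forall B : {fset I},
    (A `<=` B)%fset -> \sum_(i <- B | i \notin A) `|h i| < e.
Proof.
move=> hM e e0; pose p (A : {fset I}) : R := complex.Re (\sum_(i <- A) `|h i| : C).
have pE (A : {fset I}) : \sum_(i <- A) `|h i| = (p A)%:C%C.
  by apply: ge0_CRe; apply: sumr_ge0.
have hsup : has_sup (range p).
  split; first by exists (p fset0), fset0.
  by exists (complex.Re M) => _ [A _ <-]; exact: CRe_mono.
have r0 : 0 < complex.Re e by exact: (CRe_monolt e0).
have [_ [A _ <-] pA] := sup_adherent r0 hsup.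
exists A => B AB; have := fset_sum_split (fun i => `|h i| : C) AB.
rewrite !pE => pBA.
have -> : \sum_(i <- B | i \notin A) `|h i| = - (p A)%:C%C + (p B)%:C%C.
  by rewrite pBA addKr.
rewrite (ge0_CRe (ltW e0)) -raddfN -raddfD /= (ltcR _ (complex.Re e)).
rewrite addrC ltrBlDr; apply: (@le_lt_trans _ _ (sup (range p))).
  by apply: sup_upper_bound => //; exists B.
by rewrite -ltrBlDl.
Qed.

Lemma sum_abs_cvg (h : I -> C) (M : C) :
  (forall A : {fset I}, \sum_(i <- A) `|h i| <= M) ->
  partial_sum h @ totally --> summability.sum h.
Proof.
move=> hM; have TF := @totally_filter I.
suff /Cplx_complete : cauchy (partial_sum h @ totally) by [].
apply/cauchy_exP => e e0; have [A hA] := abs_sum_adherent hM e0.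
exists (\sum_(i <- A) h i); exists A => // B AB /=.
rewrite -ball_normE /= partial_sumE (fset_sum_split _ AB) opprD addrA subrr sub0r normrN.
by apply: le_lt_trans (hA _ AB); exact: ler_norm_sum.
Qed.

Lemma cvgC_ge0 (F : set_system C) (FF : ProperFilter F) (l : C) :
  (\forall z \near F, 0 <= z) -> F --> l -> 0 <= l.
Proof.
move=> F0 Fl.
have Fn : (fun z : C => `|z|) @ F --> `|l|.
  exact: cvg_norm Fl.
have Fn' : (fun z : C => `|z|) @ F --> l.
  apply: cvg_trans Fl; apply: near_eq_cvg.
  by apply: filterS F0 => z z0; rewrite ger0_norm.
by rewrite (cvg_unique _ Fn' Fn).
Qed.

Lemma cvgC_le (F : set_system C) (FF : ProperFilter F) (l u : C) :
  (\forall z \near F, z <= u) -> F --> l -> l <= u.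
Proof.
move=> F0 Fl; rewrite -subr_ge0.
apply: (@cvgC_ge0 ((fun z => u - z) @ F)).
  by apply: filterS F0 => z; rewrite /= subr_ge0.
exact: (cvgB (cvg_cst u) Fl).
Qed.

Lemma cvgC_ge (F : set_system C) (FF : ProperFilter F) (l u : C) :
  (\forall z \near F, u <= z) -> F --> l -> u <= l.
Proof.
move=> F0 Fl; rewrite -subr_ge0.
apply: (@cvgC_ge0 ((fun z => z - u) @ F)).
  by apply: filterS F0 => z; rewrite /= subr_ge0.
exact: (cvgB Fl (cvg_cst u)).
Qed.

Lemma sum_ge0_ub (h : I -> C) (M : C) : (forall i, 0 <= h i) ->
  (forall A : {fset I}, \sum_(i <- A) h i <= M) ->
  (forall A : {fset I}, \sum_(i <- A) h i <= summability.sum h) /\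
  summability.sum h <= M.
Proof.
move=> h0 hM; have TF := @totally_filter I.
have cv : partial_sum h @ totally --> summability.sum h.
  apply: (@sum_abs_cvg _ M) => A; rewrite (eq_bigr h) // => i _.
  by rewrite ger0_norm.
split=> [A|].
  refine (@cvgC_ge _ _ _ _ _ cv); exists A => // B AB.
  suff : \sum_(i <- A) h i <= partial_sum h B by [].
  by rewrite partial_sumE (fset_sum_split _ AB) lerDl; apply: sumr_ge0 => *.
refine (@cvgC_le _ _ _ _ _ cv); exists fset0 => // B _.
suff : partial_sum h B <= M by [].
by rewrite partial_sumE.
Qed.
End Sums.

(* l2 R I is the Hilbert space of square-summable families (f i), i in I; the
   inner product is the unordered sum of the f i * (g i)^*. *)
Section L2.
Variables (R : realType) (I : choiceType).
Local Notation C := (Cplx R).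

Definition square_summable_family : {pred I -> C} :=
  mem [set f : I -> C | exists M : C,
    forall A : {fset I}, \sum_(i <- A) `|f i| ^+ 2 <= M].

Lemma sqrD_le2 (K : numDomainType) (x y : K) : 0 <= x -> 0 <= y ->
  (x + y) ^+ 2 <= (x ^+ 2 + y ^+ 2) *+ 2.
Proof.
move=> x0 y0; rewrite -subr_ge0 (_ : _ - _ = (x - y) ^+ 2).
  by rewrite -realEsqr rpredB ?ger0_real.
by rewrite sqrrD sqrrB !mulrnDl !mulr2n; ring.
Qed.

Lemma mul_le_sqrD (K : numDomainType) (x y : K) : 0 <= x -> 0 <= y ->
  x * y <= x ^+ 2 + y ^+ 2.
Proof.
move=> x0 y0; have : 0 <= (x - y) ^+ 2 by rewrite -realEsqr rpredB ?ger0_real.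
rewrite sqrrB addrAC subr_ge0 => /(le_trans _); apply.
by rewrite mulr2n lerDl mulr_ge0.
Qed.

Lemma square_summable_submod : submod_closed square_summable_family.
Proof.
split; first by rewrite inE; exists 0 => A; rewrite big1 // => i _; rewrite normr0 expr0n.
move=> a f g; rewrite !inE => -[Mf hf] [Mg hg].
exists ((`|a| ^+ 2 * Mf + Mg) *+ 2) => A.
apply: (@le_trans _ _ ((`|a| ^+ 2 * (\sum_(i <- A) `|f i| ^+ 2) + \sum_(i <- A) `|g i| ^+ 2) *+ 2)).
  rewrite mulr_sumr -big_split /= -sumrMnl ler_sum // => i _.
  have -> : (a *: f + g) i = a * f i + g i by [].
  rewrite -exprMn -normrM; apply: le_trans (sqrD_le2 _ _) => //.
  by rewrite ler_sqr ?nnegrE ?addr_ge0 // ler_normD.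
by rewrite lerMn2r /= lerD // ler_wpM2l ?exprn_ge0.
Qed.
HB.instance Definition _ := GRing.isSubmodClosed.Build C (I -> C)
  square_summable_family square_summable_submod.

Record l2 := L2 { l2_fun :> I -> C; l2P : l2_fun \in square_summable_family }.
HB.instance Definition _ := [isSub for l2_fun].
HB.instance Definition _ := [Choice of l2 by <:].
HB.instance Definition _ := [SubChoice_isSubLmodule of l2 by <:].

Definition l2_dot (f g : l2) : C := summability.sum (fun i => f i * (g i)^*).

Lemma l2_dot_cvg (f g : l2) :
  partial_sum (fun i => f i * (g i)^*) @ totally --> l2_dot f g.
Proof.
have := l2P f; have := l2P g; rewrite !inE => -[Mg hg] [Mf hf].
apply: (@sum_abs_cvg _ _ _ (Mf + Mg)) => A.
apply: le_trans (lerD (hf A) (hg A)); rewrite -big_split /= ler_sum // => i _.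
by rewrite normrM norm_conjC mul_le_sqrD.
Qed.

Lemma l2_dot_unique (f g : l2) l :
  partial_sum (fun i => f i * (g i)^*) @ totally --> l -> l2_dot f g = l.
Proof. by have TF := @totally_filter I; move/(cvg_unique _ (@l2_dot_cvg f g)) => ->. Qed.

Lemma l2_dot_linear g : linear_for *%R (l2_dot^~ g).
Proof.
have TF := @totally_filter I.
move=> a f f' /=; apply: l2_dot_unique.
rewrite (_ : partial_sum _ = fun A => a * partial_sum (fun i => f i * (g i)^*) A + partial_sum (fun i => f' i * (g i)^*) A).
  by apply: cvgD; [apply: cvgMr; exact: l2_dot_cvg|exact: l2_dot_cvg].
apply/funext => A; rewrite !partial_sumE mulr_sumr -big_split /=.
by apply: eq_bigr => i _; rewrite /= mulrDl mulrA.
Qed.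

Lemma l2_dotC f g : l2_dot f g = (l2_dot g f)^*.
Proof.
have TF := @totally_filter I.
apply: l2_dot_unique.
rewrite (_ : partial_sum _ = (fun z : C => z^*) \o partial_sum (fun i => g i * (f i)^*)).
  refine (@cvg_comp _ _ _ _ (fun z : C => z^*) _ _ _ (@l2_dot_cvg g f) _).
  exact: conjC_continuous.
apply/funext => A; rewrite /= !partial_sumE rmorph_sum /=.
by apply: eq_bigr => i _; rewrite rmorphM /= conjCK mulrC.
Qed.

Lemma l2_dot_linearr f : linear_for (@conjC C \; *%R) (l2_dot f).
Proof.
move=> a g g' /=.
by rewrite l2_dotC l2_dot_linear rmorphD rmorphM /= -!(l2_dotC f).
Qed.

Lemma l2_dot_bilinear : bilinear_for *%R (@conjC C \; *%R) l2_dot.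
Proof. by split; [exact: l2_dot_linear|exact: l2_dot_linearr]. Qed.

HB.instance Definition _ :=
  bilinear_isBilinear.Build C l2 l2 C *%R (@conjC C \; *%R) l2_dot l2_dot_bilinear.

Lemma l2_dot_sums (f : l2) (M : C) :
  (forall A : {fset I}, \sum_(i <- A) `|f i| ^+ 2 <= M) ->
  [/\ forall A : {fset I}, \sum_(i <- A) `|f i| ^+ 2 <= l2_dot f f
   & l2_dot f f <= M].
Proof.
move=> hM; have := @sum_ge0_ub _ _ (fun i => `|f i| ^+ 2) M _ hM.
rewrite (_ : summability.sum _ = l2_dot f f); first by apply=> i; rewrite exprn_ge0.
by congr summability.sum; apply/funext => i; rewrite normCK.
Qed.

Lemma l2_sum_le (f : l2) (A : {fset I}) : \sum_(i <- A) `|f i| ^+ 2 <= l2_dot f f.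
Proof. by have := l2P f; rewrite inE => -[M /l2_dot_sums[]]. Qed.

Lemma l2_coord_le (f : l2) i : `|f i| ^+ 2 <= l2_dot f f.
Proof. by have := l2_sum_le f [fset i]%fset; rewrite big_seq_fset1. Qed.

Lemma l2_dot_gt0 f : f != 0 -> 0 < l2_dot f f.
Proof.
move=> f0; have [i fi] : exists i, f i != 0.
  apply: contrapT => /forallNP fi; move/eqP: f0; apply.
  apply/val_inj/funext => i /=; apply/eqP; move: (fi i); by case: eqP.
by apply: lt_le_trans (l2_coord_le f i); rewrite exprn_gt0 // normr_gt0.
Qed.

HB.instance Definition _ := isHermitianSesquilinear.Build C l2 false (@conjC C) l2_dot
  (fun f g => etrans (l2_dotC f g) (esym (mul1r _))).
HB.instance Definition _ := isDotProduct.Build C l2 l2_dot l2_dot_gt0.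

HB.instance Definition _ := Lmodule_isNormed.Build C l2
  (dot_triangle l2_dot) (sqrtC_dotZ l2_dot) (@sqrtC_dot_eq0 _ _ l2_dot).

Lemma l2_sqr_norm (f : l2) : `|f| ^+ 2 = l2_dot f f.
Proof. by rewrite sqrtCK. Qed.

Lemma l2_coord_norm (f : l2) i : `|f i| <= `|f|.
Proof. by rewrite -ler_sqr ?nnegrE // l2_sqr_norm l2_coord_le. Qed.
End L2.

Section L2Hilbert.
Variables (R : realType) (I : choiceType).
Local Notation C := (Cplx R).
Local Notation l2 := (l2 R I).

Lemma l2_limit_sum (F : set_system l2) (FF : ProperFilter F) (f0 : l2)
    (g : I -> C) (e : C) : 0 < e ->
  (forall i, (fun f : l2 => f i) @ F --> g i) -> F (ball f0 e) ->
  forall A : {fset I}, \sum_(i <- A) `|f0 i - g i| ^+ 2 <= e ^+ 2.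
Proof.
move=> e0 Fg Fe A.
pose d (z : l2) : C := \sum_(i <- A) `|f0 i - z i| ^+ 2.
have dcv : d @ F --> (\sum_(i <- A) `|f0 i - g i| ^+ 2 : C).
  rewrite /d; elim: (enum_fset A) => [|i s IH].
    by rewrite big_nil; under eq_fun do rewrite big_nil; exact: cvg_cst.
  rewrite big_cons; under eq_fun do rewrite big_cons.
  have h1 : (fun z : l2 => `|f0 i - z i|) @ F --> `|f0 i - g i|.
    by apply: cvg_norm; exact: (cvgB (cvg_cst (f0 i)) (Fg i)).
  exact: (cvgD (cvgM h1 h1) IH).
refine (@cvgC_le _ _ _ _ _ _ dcv).
suff : F [set z | d z <= e ^+ 2] by [].
apply: filterS Fe => z; rewrite -ball_normE /= => fz.
apply: (@le_trans _ _ (l2_dot (f0 - z) (f0 - z))).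
  exact: (l2_sum_le (f0 - z) A).
by rewrite -l2_sqr_norm ler_sqr ?nnegrE //; exact: ltW.
Qed.

Lemma l2_complete (F : set_system l2) : ProperFilter F -> cauchy F -> cvg F.
Proof.
move=> FF /cauchyP Fc.
have Fi i : cvg ((fun f : l2 => f i : C) @ F).
  apply: Cplx_complete; apply/cauchy_exP => e e0.
  have [f0 Ff0] := Fc e e0; exists (f0 i).
  suff : F [set z : l2 | ball (f0 i : C) e (z i)] by [].
  apply: filterS Ff0 => z; rewrite -!ball_normE /=; apply: le_lt_trans.
  exact: (l2_coord_norm (f0 - z)).
pose g i : C := lim ((fun f : l2 => f i : C) @ F).
have gS : g \in @square_summable_family R I.
  have [f0 Ff0] := Fc 1 ltr01.
  have hS : (fun i => f0 i - g i) \in @square_summable_family R I.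
    by rewrite inE; exists (1 ^+ 2); exact: (l2_limit_sum FF ltr01 Fi Ff0).
  have -> : g = (f0 : I -> C) - (fun i => f0 i - g i).
    by apply/funext => i; rewrite /GRing.add /= /GRing.opp /= opprB addrC subrK.
  by rewrite rpredB // l2P.
apply/cvg_ex; exists (L2 gS); apply/cvgrPdist_lt => e e0.
have e2 : 0 < e / 2 by rewrite divr_gt0.
have [f0 Ff0] := Fc _ e2.
apply: filterS (Ff0) => z; rewrite -ball_normE /= => fz.
rewrite -(subrKA f0) (splitr e); apply: le_lt_trans (ler_normD _ _) _.
apply: ler_ltD => //; rewrite distrC -ler_sqr ?nnegrE ?normr_ge0 ?(ltW e2)//.
rewrite l2_sqr_norm.
by have [_] := @l2_dot_sums _ _ (f0 - L2 gS) _ (l2_limit_sum FF e2 Fi Ff0).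
Qed.

HB.instance Definition _ := Uniform_isComplete.Build l2 l2_complete.
HB.instance Definition _ := isHilbert.Build R l2 (@l2_sqr_norm R I).
End L2Hilbert.

Lemma nonexpansive_continuous (K : numFieldType) (V W : normedModType K)
  (f : V -> W) : (forall x y, `|f x - f y| <= `|x - y|) -> continuous f.
Proof.
move=> hf x; apply/cvgrPdist_lt => e e0; apply/nbhs_normP; exists e => // y /= xy.
exact: le_lt_trans (hf _ _) xy.
Qed.

Section BoundedOperators.
Variables (R : realType) (H L : hilbertType R).
Local Notation C := (Cplx R).

Definition bounded_operator : {pred H -> L} :=
  mem [set x : H -> L | linear x /\ continuous x].

Lemma bounded_operator_submod : submod_closed bounded_operator.
Proof.
split.
  rewrite inE; split; last exact: cst_continuous.
  by move=> a u v; rewrite /GRing.zero /= scaler0 addr0.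
move=> a x y; rewrite !inE => -[lx cx] [ly cy]; split.
  have E u : (a *: x + y) u = a *: x u + y u by [].
  by move=> b u v; rewrite !E lx ly !scalerDr !scalerA [a * b]mulrC addrACA.
move=> u; apply: (@cvgD _ _ _ _ _ (a *: x) y); last exact: cy.
by apply: (@cvgZl_tmp _ _ _ _ _ a); exact: cx.
Qed.
HB.instance Definition _ := GRing.isSubmodClosed.Build C (H -> L)
  bounded_operator bounded_operator_submod.

Record bop := Bop { bop_fun :> H -> L; bopP : bop_fun \in bounded_operator }.
HB.instance Definition _ := [isSub for bop_fun].
HB.instance Definition _ := [Choice of bop by <:].
HB.instance Definition _ := [SubChoice_isSubLmodule of bop by <:].
End BoundedOperators.

Section OperatorAlgebra.
Variable R : realType.
Local Notation C := (Cplx R).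
Implicit Types H L : hilbertType R.

Lemma bid_subproof H : (fun u : H => u) \in @bounded_operator R H H.
Proof. by rewrite inE; split=> //; move=> u; exact: cvg_id. Qed.
Definition bid H : bop H H := Bop (bid_subproof H).

Lemma bcomp_subproof H1 H2 H3 (y : bop H2 H3) (x : bop H1 H2) :
  (y \o x) \in @bounded_operator R H1 H3.
Proof.
have := bopP y; have := bopP x; rewrite !inE => -[lx cx] [ly cy]; split.
  by move=> a u v; rewrite /= lx ly.
by move=> u; apply: continuous_comp; [exact: cx|exact: cy].
Qed.
Definition bcomp H1 H2 H3 (y : bop H2 H3) (x : bop H1 H2) : bop H1 H3 :=
  Bop (bcomp_subproof y x).

(* The unique y picked here exists by the Riesz representation theorem. *)
Definition adj H L (x : bop H L) : bop L H :=
  xget 0 [set y : bop L H | forall u v, hdot (x u) v = hdot u (y v)].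
End OperatorAlgebra.

Notation "y \ob x" := (bcomp y x)
  (at level 40, left associativity, format "y  \ob  x").

(* The sigma-weak topology is the initial topology for the functionals
   x |-> \sum_n <x u_n, v_n>, where u and v are square-summable sequences of
   vectors. *)
Section SigmaWeak.
Variables (R : realType) (H L : hilbertType R).
Local Notation C := (Cplx R).

Definition square_summable (V : hilbertType R) (u : nat -> V) : Prop :=
  cvgn (series (fun n => `|u n| ^+ 2)).

Definition sw_index : Type :=
  {p : (nat -> H) * (nat -> L) | square_summable p.1 /\ square_summable p.2}.

Definition sw_eval (x : bop H L) : {ptws sw_index -> C} :=
  fun p => limn (series (fun n => hdot (x ((sval p).1 n)) ((sval p).2 n))).

Definition sigma_weak : topologicalType := initial_topology sw_eval.

Definition sw_closure (S : set (bop H L)) : set (bop H L) :=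
  closure (S : set sigma_weak).
End SigmaWeak.

Section SpanNormalTensor.
Variable R : realType.
Local Notation C := (Cplx R).
Implicit Types H L : hilbertType R.

Definition lspan (V : lmodType C) (S : set V) : set V :=
  [set v | exists n (a : 'I_n -> C) (s : 'I_n -> V),
     (forall i, S (s i)) /\ v = \sum_i a i *: s i].

Definition normal_linear_on H L H' L' (D : set (bop H L))
    (F : bop H L -> bop H' L') : Prop :=
  (forall a x y, D x -> D y -> F (a *: x + y) = a *: F x + F y) /\
  {within (D : set (sigma_weak H L)),
     continuous (F : sigma_weak H L -> sigma_weak H' L')}.

(* (T, t) is a Hilbert space tensor product of H and L. *)
Definition is_tensor H L (T : hilbertType R) (t : {bilinear H -> L -> T}) :
    Prop :=
  (forall u u' v v', hdot (t u v) (t u' v') = hdot u u' * hdot v v') /\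
  dense (lspan [set w | exists u v, w = t u v]).

(* A choice of H (x) H and of H (x) H (x) H, the latter seen both as
   (H (x) H) (x) H and as H (x) (H (x) H). Any two choices are related by
   unitaries that preserve the elementary tensors. *)
Record tensor_powers H := TensorPowers {
  tsq : hilbertType R;
  tcube : hilbertType R;
  t2 : {bilinear H -> H -> tsq};
  t21 : {bilinear tsq -> H -> tcube};
  t12 : {bilinear H -> tsq -> tcube};
  t2P : is_tensor t2;
  t21P : is_tensor t21;
  t12P : is_tensor t12;
  tassoc : forall u v w, t21 (t2 u v) w = t12 u (t2 v w) }.
End SpanNormalTensor.

Section OperatorTensor.
Variable R : realType.
Implicit Types H L : hilbertType R.

(* x (x) y, between the tensor products (T, t) and (T', t'): the bounded operator
   determined by its values on elementary tensors. *)
Definition btens H L (T : hilbertType R) H' L' (T' : hilbertType R)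
    (t : H -> L -> T) (t' : H' -> L' -> T')
    (x : bop H H') (y : bop L L') : bop T T' :=
  xget 0 [set z : bop T T' | forall u v, z (t u v) = t' (x u) (y v)].

Variables (H L : hilbertType R) (TH : tensor_powers H) (TL : tensor_powers L).

Definition tens2 (x y : bop H L) : bop (tsq TH) (tsq TL) :=
  btens (t2 TH) (t2 TL) x y.
Definition tens21 (X : bop (tsq TH) (tsq TL)) (y : bop H L) :
    bop (tcube TH) (tcube TL) := btens (t21 TH) (t21 TL) X y.
Definition tens12 (x : bop H L) (Y : bop (tsq TH) (tsq TL)) :
    bop (tcube TH) (tcube TL) := btens (t12 TH) (t12 TL) x Y.

(* The sigma-weakly closed tensor product of N with itself. *)
Definition wtens (N : set (bop H L)) : set (bop (tsq TH) (tsq TL)) :=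
  sw_closure (lspan [set z | exists x y, [/\ N x, N y & z = tens2 x y]]).

(* On wtens N, F is the normal extension of D (x) id, resp. of id (x) D. *)
Definition is_map_tensor_id (N : set (bop H L))
    (D : bop H L -> bop (tsq TH) (tsq TL))
    (F : bop (tsq TH) (tsq TL) -> bop (tcube TH) (tcube TL)) : Prop :=
  normal_linear_on (wtens N) F /\
  forall x y, N x -> N y -> F (tens2 x y) = tens21 (D x) y.

Definition is_id_tensor_map (N : set (bop H L))
    (D : bop H L -> bop (tsq TH) (tsq TL))
    (F : bop (tsq TH) (tsq TL) -> bop (tcube TH) (tcube TL)) : Prop :=
  normal_linear_on (wtens N) F /\
  forall x y, N x -> N y -> F (tens2 x y) = tens12 x (D y).
End OperatorTensor.

Arguments tens2 {R H L} TH TL x y.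
Arguments wtens {R H L} TH TL N.

Definition unitary (R : realType) (H L : hilbertType R) (u : bop H L) : Prop :=
  adj u \ob u = bid H /\ u \ob adj u = bid L.

Section GaloisCoobjects.
Variables (R : realType) (H : hilbertType R) (TH : tensor_powers H).
Variables (M : set (bop H H)) (DM : bop H H -> bop (tsq TH) (tsq TH)).

(* The data (L^2(N), N, Delta_N), where Delta_N is only meaningful on N. *)
Record coobject_data := CoobjectData {
  co_space : hilbertType R;
  co_tensor : tensor_powers co_space;
  co_set : set (bop H co_space);
  co_map : bop H co_space -> bop (tsq TH) (tsq co_tensor) }.

Arguments co_set : clear implicits.
Arguments co_map : clear implicits.

Definition self_coobject : coobject_data := CoobjectData M DM.

(* The products N L^2(M) and N^op L^2(N) in the density conditions are read as
   linear spans of products. *)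
Record is_right_galois_coobject (X : coobject_data) : Prop := {
  rgc_separable : exists2 S : set (co_space X), countable S & dense S;
  rgc_0 : co_set X 0;
  rgc_subspace : forall a x y, co_set X x -> co_set X y -> co_set X (a *: x + y);
  rgc_closed : sw_closure (co_set X) = co_set X;
  rgc_map : forall x, co_set X x -> wtens TH (co_tensor X) (co_set X) (co_map X x);
  rgc_normal : normal_linear_on (co_set X) (co_map X);
  rgc_nondeg : dense (lspan [set v | exists x u, co_set X x /\ v = x u]);
  rgc_nondeg_op : dense (lspan [set u | exists x v, co_set X x /\ u = adj x v]);
  rgc_module : forall x y, co_set X x -> M y -> co_set X (x \ob y);
  rgc_inner : forall x y, co_set X x -> co_set X y -> M (adj x \ob y);
  rgc_map_module : forall x y, co_set X x -> M y ->
    co_map X (x \ob y) = co_map X x \ob DM y;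
  rgc_map_inner : forall x y, co_set X x -> co_set X y ->
    adj (co_map X x) \ob co_map X y = DM (adj x \ob y);
  rgc_coassoc : exists F F',
    [/\ is_map_tensor_id (co_set X) (co_map X) F,
        is_id_tensor_map (co_set X) (co_map X) F'
      & forall x, co_set X x -> F (co_map X x) = F' (co_map X x)];
  rgc_dense : wtens TH (co_tensor X) (co_set X) `<=`
    sw_closure (lspan [set z | exists x y1 y2,
      [/\ co_set X x, M y1, M y2 & z = co_map X x \ob tens2 TH TH y1 y2]]) }.

Definition coobject_iso (X Y : coobject_data) : Prop :=
  exists u : bop (co_space X) (co_space Y),
    [/\ unitary u, [set u \ob x | x in co_set X] = co_set Y
      & forall x, co_set X x ->
          co_map Y (u \ob x) = tens2 (co_tensor X) (co_tensor Y) u u \ob co_map X x].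

Definition unitary_2cocycle (W : bop (tsq TH) (tsq TH)) : Prop :=
  [/\ wtens TH TH M W, unitary W
    & exists F F',
        [/\ is_map_tensor_id M DM F, is_id_tensor_map M DM F'
          & tens21 W (bid H) \ob F W = tens12 (bid H) W \ob F' W]].

Definition unitary_2coboundary (W : bop (tsq TH) (tsq TH)) : Prop :=
  exists u : bop H H, [/\ M u, unitary u
    & W = tens2 TH TH (adj u) (adj u) \ob DM u].
End GaloisCoobjects.

Section GroupVonNeumannAlgebra.
Variables (R : realType) (G : groupType).
Local Notation C := (Cplx R).

Lemma l2_translate_subproof (g : G) (f : l2 R G) :
  (fun h : G => f (g^-1 * h)%g) \in @square_summable_family R G.
Proof.
have := l2P f; rewrite !inE => -[M hM]; exists M => A.
have -> : \sum_(h <- A) `|f (g^-1 * h)%g| ^+ 2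
    = \sum_(h <- [fset (g^-1 * h)%g | h in A]%fset) `|f h| ^+ 2.
  by rewrite big_imfset //= => h1 h2 _ _; exact: mulgI.
exact: hM.
Qed.
Definition l2_translate g f : l2 R G := L2 (l2_translate_subproof g f).

Lemma lambda_subproof g : l2_translate g \in @bounded_operator R (l2 R G) (l2 R G).
Proof.
have lin : linear (l2_translate g).
  by move=> a f f'; apply/val_inj/funext => h.
rewrite inE; split=> //; apply: nonexpansive_continuous => f f'.
have -> : l2_translate g f - l2_translate g f' = l2_translate g (f - f').
  by apply/val_inj/funext => h.
rewrite -ler_sqr ?nnegrE // !l2_sqr_norm.
apply: (proj2 (@l2_dot_sums _ _ (l2_translate g (f - f')) _ _)) => A.
have -> : \sum_(h <- A) `|l2_translate g (f - f') h| ^+ 2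
    = \sum_(h <- [fset (g^-1 * h)%g | h in A]%fset) `|(f - f') h| ^+ 2.
  by rewrite big_imfset //= => h1 h2 _ _; exact: mulgI.
exact: l2_sum_le.
Qed.
Definition lambda g : bop (l2 R G) (l2 R G) := Bop (lambda_subproof g).

(* The von Neumann algebra generated by the unitaries lambda g. *)
Definition group_vN : set (bop (l2 R G) (l2 R G)) := sw_closure (lspan (range lambda)).

(* D restricts to the normal unital *-homomorphism with
   lambda g |-> lambda g (x) lambda g, and is only meaningful on group_vN. *)
Record is_group_comult (T : tensor_powers (l2 R G))
    (D : bop (l2 R G) (l2 R G) -> bop (tsq T) (tsq T)) : Prop := {
  gc_map : forall x, group_vN x -> wtens T T group_vN (D x);
  gc_normal : normal_linear_on group_vN D;
  gc_mul : forall x y, group_vN x -> group_vN y -> D (x \ob y) = D x \ob D y;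
  gc_adj : forall x, group_vN x -> D (adj x) = adj (D x);
  gc_lambda : forall g, D (lambda g) = tens2 T T (lambda g) (lambda g) }.
End GroupVonNeumannAlgebra.
Arguments group_vN : clear implicits.

Definition torsion_free (G : groupType) : Prop :=
  forall (g : G) (n : nat), (0 < n)%N -> (g ^+ n)%g = 1%g -> g = 1%g.

Definition no_square_order_subgroup (G : groupType) : Prop :=
  forall A : {fset G}, group_closed [in A] -> (exists n : nat, #|` A| = (n ^ 2)%N) ->
  A = [fset 1%g]%fset.

(* Main.v *)
(* Let K = L^2(N) and e = delta_1. The isometry D : x e |-> Delta_N(x) (e (x) e)
   gives an associative product a b = D^* (a (x) b) on K, on which G acts by the
   automorphic unitaries R_g : x e |-> x delta_g. Since K (x) K is the orthogonal
   sum of the subspaces (1 (x) R_g) D K, adjoints of left multiplications L_a are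
   again right module maps, and sum_g |a R_g b|^2 = |a|^2 |b|^2.
   The estimate |S^(n+1) v| <= |xi| |S^n xi| |v| for S = L_xi L_xi^* forces S to
   have an eigenvector, and every projection below its eigenprojection moves xi
   by a definite amount; hence the algebra of right module maps has a minimal
   projection r. The co-object induces a G-grading of r B(K) r whose degree 1 part
   is scalar. Its homogeneous elements are multiples of unitaries, so the state
   given by the degree 1 part is a trace, n = dim r K is finite, and the support
   of the grading is a subgroup of order n^2. The hypothesis on G gives n = 1,
   which yields a unit vector eta with D eta = eta (x) eta; a slice of Delta_N
   shows that eta = v e with v in N, and then v is unitary with
   Delta_N(v) = v (x) v, so that v^* is the desired isomorphism. A unitary
   2-cocycle W is treated through the co-object (L(G), W Delta). *)
Require Import Defs.
From HB Require Import structures.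
From mathcomp Require Import all_boot all_order all_algebra finmap.
From mathcomp Require Import ring lra complex.
From mathcomp Require Import boolp classical_sets cardinality.
From mathcomp Require Import reals topology normedtype sequences summability.

Set Implicit Arguments.
Unset Strict Implicit.
Unset Printing Implicit Defensive.

Import Order.TTheory GRing.Theory Num.Theory Num.Def.
Import numFieldNormedType.Exports.

Local Open Scope classical_set_scope.
Local Open Scope ring_scope.

(** * Hilbert spaces and bounded operators *)

(** Comultiplications live on N, which carries no product; on the vectors of K the adjoint of the
    comultiplication becomes a product, so the structure theory is done on K alone and N returns
    only when eta has to be written as v e. The obstacle is that K is infinite-dimensional for
    infinite G and nothing provides compact operators. What replaces compactness: |L_a| <= |a|,
    while a right module map S satisfies S L_a = L_(S a). Hence the operator norm of S^n L_xi is
    controlled by the vector norm of S^n xi, and iterating S on the single vector xi cannot lose the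
    norm of S. The corner of r turns out to be a matrix algebra of size n whose homogeneous
    components are lines, that is, a twisted group algebra of a finite group with scalar centre.
    Such groups are those of central type; counting the n^2 lines explains the squares in the
    hypothesis. For n = 1 the range of r is a line stable under right multiplication, so the product
    on K has a character, and eta is the vector representing it. *)

Section RealNorm.
Variable R : realType.
Local Notation C := (Cplx R).
Implicit Types (V : normedModType C).

(* The norm of a complex normed space takes complex values; nr is its real part. *)
Definition nr V (x : V) : R := complex.Re (`|x| : C).

Lemma nrE V (x : V) : `|x| = (nr x)%:C%C.
Proof. exact: (ge0_CRe (normr_ge0 x)). Qed.

Lemma nr_le V (x : V) (r : R) : (nr x <= r) = (`|x| <= (r%:C%C : C)).
Proof. by rewrite nrE (lecR (nr x)). Qed.

Lemma nr_lt V (x : V) (r : R) : (nr x < r) = (`|x| < (r%:C%C : C)).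
Proof. by rewrite nrE (ltcR (nr x)). Qed.

Lemma nr_ge0 V (x : V) : 0 <= nr x.
Proof. exact: (CRe_mono (normr_ge0 x)). Qed.

Lemma nr0 V : nr (0 : V) = 0.
Proof. by rewrite /nr normr0. Qed.

Lemma nr_eq0 V (x : V) : (nr x == 0) = (x == 0).
Proof. by rewrite -[RHS]normr_eq0 nrE (inj_eq (@complexI R) (nr x) 0). Qed.

Lemma nr_gt0 V (x : V) : (0 < nr x) = (x != 0).
Proof. by rewrite lt_neqAle nr_ge0 andbT eq_sym nr_eq0. Qed.

Lemma nrD V (x y : V) : nr (x + y) <= nr x + nr y.
Proof. by rewrite nr_le raddfD /= -!nrE ler_normD. Qed.

Lemma nrN V (x : V) : nr (- x) = nr x.
Proof. by rewrite /nr normrN. Qed.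

Lemma nrBC V (x y : V) : nr (x - y) = nr (y - x).
Proof. by rewrite /nr distrC. Qed.

Lemma nrZ V (a : C) (x : V) : nr (a *: x) = nr a * nr x.
Proof. by apply: (@complexI R); rewrite rmorphM /= -!nrE normrZ. Qed.

Lemma nr_sumD V (x y z : V) : nr (x - z) <= nr (x - y) + nr (y - z).
Proof. by rewrite -[x - z](subrKA y) nrD. Qed.

Lemma nrM (a b : C) : nr (a * b) = nr a * nr b.
Proof. exact: nrZ. Qed.

Lemma nr_conj (a : C) : nr (a^*) = nr a.
Proof. by rewrite /nr norm_conjC. Qed.

Lemma nrR (r : R) : nr (r%:C%C : C) = `|r|.
Proof. by rewrite /nr normc_def /= expr0n /= addr0 sqrtr_sqr. Qed.

Lemma nrX (a : C) n : nr (a ^+ n) = nr a ^+ n.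
Proof. by elim: n => [|n IH]; rewrite ?expr0 ?exprS ?nrM ?IH // -(rmorph1 (real_complex R)) nrR normr1. Qed.

Lemma nrV (a : C) : nr (a^-1) = (nr a)^-1.
Proof. by apply: (@complexI R); rewrite fmorphV /= -!nrE normfV. Qed.

Lemma conj_real (r : R) : (r%:C%C : C)^* = r%:C%C.
Proof. by apply/eqP; rewrite eq_complex /= oppr0 !eqxx. Qed.

Lemma mul_conjE (a : C) : a * a^* = (nr a ^+ 2)%:C%C.
Proof. by rewrite -normCK nrE rmorphXn. Qed.

Lemma cvg_nrP V (F : set_system V) {FF : Filter F} (l : V) :
  (forall e : R, 0 < e -> \forall x \near F, nr (l - x) < e) -> F --> l.
Proof.
move=> h; apply/cvgrPdist_lt => e e0.
have := h _ (CRe_monolt e0); apply: filterS => x.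
by rewrite nr_lt -(ge0_CRe (ltW e0)).
Qed.

Lemma near_nr V (l : V) (e : R) : 0 < e -> \forall x \near l, nr (l - x) < e.
Proof.
move=> e0; have e0' : (0 : C) < e%:C%C by rewrite (ltcR 0).
apply: filterS (nbhsx_ballx l _ e0') => x.
by rewrite -ball_normE /= nr_lt.
Qed.

Lemma continuous_nrP V (W : normedModType C) (f : V -> W) :
  (forall x (e : R), 0 < e -> exists2 d : R, 0 < d &
     forall y, nr (x - y) < d -> nr (f x - f y) < e) -> continuous f.
Proof.
move=> h x; apply: cvg_nrP => e e0; have [d d0 hd] := h x e e0.
exact: filterS (near_nr x d0).
Qed.

Lemma continuous_nr V (W : normedModType C) (f : V -> W) x :
  {for x, continuous f} -> forall e : R, 0 < e -> exists2 d : R, 0 < d &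
     forall y, nr (x - y) < d -> nr (f x - f y) < e.
Proof.
move=> cf e e0; have e0' : (0 : C) < e%:C%C by rewrite (ltcR 0).
have /nbhs_ballP[d /= d0 hd] : nbhs x [set y | `|f x - f y| < (e%:C%C : C)].
  by move/cvgrPdist_lt: cf; apply.
exists (complex.Re d); first exact: (CRe_monolt d0).
move=> y; rewrite nr_lt -(ge0_CRe (ltW d0)) => yd; rewrite nr_lt.
by apply: hd; rewrite -ball_normE.
Qed.

Lemma inv_succ_small (e : R) : 0 < e ->
  exists N, forall n, (N <= n)%N -> n.+1%:R^-1 < e.
Proof.
move=> e0; exists (Num.truncn e^-1) => n Nn.
rewrite invf_plt ?posrE // ; apply: lt_le_trans (Num.Theory.truncnS_gt _) _.
by rewrite ler_nat ltnS.
Qed.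

Lemma nr_small0 V (x : V) : (forall e : R, 0 < e -> nr x <= e) -> x = 0.
Proof.
move=> h; apply/eqP; rewrite -nr_eq0; apply/negPn/negP => x0.
have x1 : 0 < nr x by rewrite lt_neqAle eq_sym x0 nr_ge0.
by have := h (nr x / 2); lra.
Qed.

Lemma nrC_eq0 (a : C) : nr a = 0 -> a = 0.
Proof. by move/eqP; rewrite nr_eq0 => /eqP. Qed.

Lemma nrC_small0 (a : C) : (forall e : R, 0 < e -> nr a <= e) -> a = 0.
Proof. exact: nr_small0. Qed.

End RealNorm.

Section Complete.
Variable R : realType.
Local Notation C := (Cplx R).

(** Completeness is a hypothesis so that the statement also covers the scalars, through
    [Cplx_complete]. *)
Let nr_cauchy_cvg (V : normedModType C) (u : nat -> V) :
  (forall F : set_system V, ProperFilter F -> cauchy F -> cvg F) ->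
  (forall e : R, 0 < e -> exists N, forall m n, (N <= m)%N -> (N <= n)%N ->
    nr (u m - u n) < e) ->
  exists l : V, forall e : R, 0 < e -> exists N, forall n, (N <= n)%N ->
    nr (u n - l) < e.
Proof.
move=> Vc h.
have /Vc/cvg_ex[l ul] : cauchy (u @ \oo).
  apply/cauchy_exP => e e0; have [N hN] := h _ (CRe_monolt e0).
  exists (u N); exists N => // n /= Nn; rewrite -ball_normE /=.
  by have := hN N n (leqnn _) Nn; rewrite nr_lt -(ge0_CRe (ltW e0)).
exists l => e e0.
have : \forall x \near (u @ \oo), nr (l - x) < e.
  exact: (ul _ (near_nr l e0)).
by case=> N _ hN; exists N => n /hN; rewrite nrBC.
Qed.

Lemma nr_cauchy (V : completeNormedModType C) (u : nat -> V) :
  (forall e : R, 0 < e -> exists N, forall m n, (N <= m)%N -> (N <= n)%N ->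
    nr (u m - u n) < e) ->
  exists l : V, forall e : R, 0 < e -> exists N, forall n, (N <= n)%N ->
    nr (u n - l) < e.
Proof. by apply: nr_cauchy_cvg => F FF Fc; exact: cauchy_cvg. Qed.

Lemma nrC_cauchy (u : nat -> C) :
  (forall e : R, 0 < e -> exists N, forall m n, (N <= m)%N -> (N <= n)%N ->
    nr (u m - u n) < e) ->
  exists l : C, forall e : R, 0 < e -> exists N, forall n, (N <= n)%N ->
    nr (u n - l) < e.
Proof. by apply: nr_cauchy_cvg => F FF Fc; exact: Cplx_complete. Qed.
End Complete.

Section Dot.
Variables (R : realType).
Local Notation C := (Cplx R).
Implicit Types (H L : hilbertType R).

(* hdot as a plain function, which keeps terms small. *)
Definition dot H (u v : H) : C := hdot u v.

Section Basic.
Variable H : hilbertType R.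
Implicit Types u v w : H.
Lemma dotDl u v w : dot (u + v) w = dot u w + dot v w.
Proof. exact: linearDl. Qed.
Lemma dotDr u v w : dot w (u + v) = dot w u + dot w v.
Proof. exact: linearDr. Qed.
Lemma dotNl u v : dot (- u) v = - dot u v.
Proof. exact: linearNl. Qed.
Lemma dotNr u v : dot u (- v) = - dot u v.
Proof. exact: linearNr. Qed.
Lemma dotBl u v w : dot (u - v) w = dot u w - dot v w.
Proof. exact: linearBl. Qed.
Lemma dotBr u v w : dot w (u - v) = dot w u - dot w v.
Proof. exact: linearBr. Qed.
Lemma dotZl a u v : dot (a *: u) v = a * dot u v.
Proof. exact: linearZl_LR. Qed.
Lemma dotZr a u v : dot u (a *: v) = a^* * dot u v.
Proof. exact: linearZr_LR. Qed.
Lemma dot0l v : dot 0 v = 0.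
Proof. exact: linear0l. Qed.
Lemma dot0r v : dot v 0 = 0.
Proof. exact: linear0r. Qed.
Lemma dot_suml I r (P : pred I) (F : I -> H) v :
  dot (\sum_(i <- r | P i) F i) v = \sum_(i <- r | P i) dot (F i) v.
Proof. exact: linear_sumlz. Qed.
Lemma dot_sumr I r (P : pred I) (F : I -> H) v :
  dot v (\sum_(i <- r | P i) F i) = \sum_(i <- r | P i) dot v (F i).
Proof. exact: linear_sumr. Qed.
Lemma dotC u v : dot v u = (dot u v)^*.
Proof. by rewrite /dot hermC expr0 mul1r. Qed.
Lemma dotE u : dot u u = (nr u ^+ 2)%:C%C.
Proof. by rewrite /dot -sqr_norm_hdot nrE rmorphXn. Qed.
Lemma dot_eq0 u : dot u u = 0 -> u = 0.
Proof. by move/eqP; rewrite /dot dnorm_eq0 => /eqP. Qed.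

Lemma dot_CS u v : nr (dot u v : C) <= nr u * nr v.
Proof.
rewrite -ler_sqr ?nnegrE ?mulr_ge0 ?nr_ge0 // exprMn.
have := dot_CauchySchwarz (@hdot R H) u v.
rewrite -!/(dot _ _) !dotE (nrE (dot u v : C)).
by rewrite -rmorphXn -rmorphM (lecR (_ ^+ 2)).
Qed.

Lemma dot_inj u v : (forall w, dot u w = dot v w) -> u = v.
Proof. by move=> h; apply/subr0_eq/dot_eq0; rewrite dotBl h subrr. Qed.

Lemma nr_sqrD u v : nr (u + v) ^+ 2 = nr u ^+ 2 + nr v ^+ 2 + 2 * complex.Re (dot u v : C).
Proof.
apply: (@complexI R).
rewrite -dotE dotDl !dotDr !dotE (dotC u v).
case: (dot u v : C) => a b; apply/eqP; rewrite eq_complex /=.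
by apply/andP; split; apply/eqP; ring.
Qed.

Lemma nr_pyth u v : dot u v = 0 -> nr (u + v) ^+ 2 = nr u ^+ 2 + nr v ^+ 2.
Proof. by move=> h; rewrite nr_sqrD h /=; ring. Qed.

Lemma nr_parallelogram u v :
  nr (u + v) ^+ 2 + nr (u - v) ^+ 2 = 2 * nr u ^+ 2 + 2 * nr v ^+ 2.
Proof.
by rewrite !nr_sqrD dotNr nrN; case: (dot u v : C) => a b /=; ring.
Qed.

End Basic.
End Dot.

(** * Orthogonal projections and the Riesz representation theorem *)

Section Projection.
Variables (R : realType) (H : hilbertType R).
Local Notation C := (Cplx R).

Definition lin_subspace (V : lmodType C) (S : set V) : Prop :=
  S 0 /\ forall a u v, S u -> S v -> S (a *: u + v).

Definition adherent (S : set H) (u : H) : Prop :=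
  forall e : R, 0 < e -> exists2 v, S v & nr (u - v) < e.

(** A minimising sequence is Cauchy by the parallelogram law: the midpoint of two of its terms lies
    in S, so it is not closer to u than the infimum. *)
Lemma nearest_point (S : set H) (u : H) : lin_subspace S ->
  (forall v, adherent S v -> S v) ->
  exists2 p, S p & forall w, S w -> nr (u - p) <= nr (u - w).
Proof.
move=> [S0 SP] Scl; pose D := [set nr (u - w) ^+ 2 | w in S].
pose d := inf D.
have D0 x : D x -> 0 <= x by move=> [w _ <-]; rewrite exprn_ge0 ?nr_ge0.
have hinf : has_inf D.
  by split; [exists (nr (u - 0) ^+ 2), 0 | exists 0 => x /D0].
have dle w : S w -> d <= nr (u - w) ^+ 2 by move=> Sw; apply: ge_inf; [case: hinf | exists w].
have /choice[v hv] n : exists v, S v /\ nr (u - v) ^+ 2 < d + n.+1%:R^-1.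
  have e0 : 0 < n.+1%:R^-1 :> R by rewrite invr_gt0.
  by have [_ [w Sw <-] lt] := inf_adherent e0 hinf; exists w.
have cauchy m n : nr (v m - v n) ^+ 2 <= 2 * m.+1%:R^-1 + 2 * n.+1%:R^-1.
  have [Sm lm] := hv m; have [Sn ln] := hv n.
  have := nr_parallelogram (u - v m) (u - v n).
  have -> : u - v m - (u - v n) = - (v m - v n).
    by rewrite !opprB addrC subrKA.
  have -> : u - v m + (u - v n) = (2 : C) *: (u - (2^-1 : C) *: (v m + v n)).
    rewrite scalerBr scalerA divff ?pnatr_eq0 // scale1r scaler_nat mulr2n.
    by rewrite opprD addrACA.
  have Sw : S ((2^-1 : C) *: (v m + v n)).
    rewrite -[X in S X]addr0; apply: (SP) => //.
    by rewrite -[v m]scale1r; apply: (SP).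
  have := dle _ Sw; rewrite nrN nrZ.
  have -> : nr (2 : C) = 2 :> R.
    by rewrite -(rmorph_nat (real_complex R)) nrR ger0_norm.
  rewrite exprMn; move: lm ln.
  set x1 := nr (u - v m); set x2 := nr (u - v n); set x3 := nr (u - _); set x4 := nr _.
  move: (m.+1%:R^-1) (n.+1%:R^-1) => y1 y2 lm ln le eq1.
  have e4 : 2 ^+ 2 = 4 :> R by rewrite -natrX.
  move: eq1; rewrite e4; lra.
have [|p hp] := @nr_cauchy R H v.
  move=> e e0; have [N hN] := @inv_succ_small R (e ^+ 2 / 4) ltac:(by rewrite divr_gt0 ?exprn_gt0).
  exists N => m n /hN lm /hN ln; have := cauchy m n => le.
  rewrite -ltr_sqr ?nnegrE ?nr_ge0 ?(ltW e0) //.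
  by move: (m.+1%:R^-1) (n.+1%:R^-1) lm ln le => y1 y2; lra.
have Sp : S p.
  apply: Scl => e /hp[N /(_ N (leqnn _))]; rewrite nrBC => lt.
  by exists (v N) => //; case: (hv N).
exists p => // w Sw; apply/ler_addgt0Pr => e e0.
have [N hN] := hp (e / 2) ltac:(by rewrite divr_gt0).
have [N' hN'] := @inv_succ_small R ((e / 2) ^+ 2) ltac:(by rewrite exprn_gt0 ?divr_gt0).
pose n := maxn N N'; have [Sn ln] := hv n.
have := hN n (leq_maxl _ _); have := hN' n (leq_maxr _ _) => lt1 lt2.
have := dle _ Sw => le1.
have : nr (u - v n) <= nr (u - w) + e / 2.
  rewrite -ler_sqr ?nnegrE ?addr_ge0 ?nr_ge0 ?divr_ge0 ?(ltW e0) //.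
  rewrite sqrrD; move: (n.+1%:R^-1) ln lt1 => y ln lt1.
  have : 0 <= nr (u - w) * (e / 2) by rewrite mulr_ge0 ?nr_ge0 ?divr_ge0 ?(ltW e0).
  by rewrite -mulr_natr; lra.
by have := nr_sumD u (v n) p; lra.
Qed.

Lemma projection (S : set H) (u : H) : lin_subspace S ->
  (forall v, adherent S v -> S v) ->
  exists2 p, S p & forall w, S w -> dot (u - p) w = 0.
Proof.
move=> sS Scl; have [p Sp hp] := nearest_point u sS Scl.
have [S0 SP] := sS.
exists p => // w Sw; set z := dot (u - p) w.
have [w0|w0] := eqVneq w 0; first by rewrite /z w0 dot0r.
(* The best step along w: moving p by [t *: w] lowers the squared distance to u by |z|^2 / |w|^2, so
   minimality of p forces z = 0. *)
pose t : C := z / (nr w ^+ 2)%:C%C.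
have nw : 0 < nr w by rewrite nr_gt0.
have Sq : S (t *: w + p) by exact: (SP).
have := hp _ Sq; rewrite -ler_sqr ?nnegrE ?nr_ge0 //.
have -> : u - (t *: w + p) = (u - p) + (- (t *: w)) by rewrite opprD addrA addrAC.
rewrite [leRHS]nr_sqrD dotNr dotZr nrN nrZ -/z.
have -> : - (t^* * z) = (- (nr z ^+ 2 / nr w ^+ 2))%:C%C.
  rewrite /t rmorphM /= fmorphV /= mulrAC mulrC (mulrC _ z) mul_conjE.
  rewrite conj_real.
  by rewrite -fmorphV -rmorphM -rmorphN mulrC.
have -> : nr t = nr z / nr w ^+ 2.
  by rewrite /t nrM nrV nrR ger0_norm ?exprn_ge0 ?nr_ge0.
rewrite /= => le.
have e1 : (nr z / nr w ^+ 2 * nr w) ^+ 2 = nr z ^+ 2 / nr w ^+ 2 by field; lra.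
have : nr z ^+ 2 / nr w ^+ 2 <= 0 by move: le; rewrite e1; lra.
rewrite pmulr_lle0 ?invr_gt0 ?exprn_gt0 // => zz.
apply: nrC_eq0.
by apply/eqP; rewrite -sqrf_eq0 eq_le zz exprn_ge0 ?nr_ge0.
Qed.

(** Unless f = 0, its kernel is a proper closed subspace, and a vector orthogonal to the kernel
    represents f up to a scalar. *)
Lemma riesz (f : H -> C) (M : R) : (forall a u v, f (a *: u + v) = a * f u + f v) ->
  (forall u, nr (f u) <= M * nr u) ->
  exists v, forall u, f u = dot u v.
Proof.
move=> flin fM.
have f0 : f 0 = 0.
  by have := flin 1 0 0; rewrite scaler0 addr0 mul1r -[LHS]addr0 => /addrI.
have fZ a u : f (a *: u) = a * f u by rewrite -[a *: u]addr0 flin f0 addr0.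
have fB u v : f (u - v) = f u - f v by rewrite addrC -scaleN1r flin mulN1r addrC.
pose S := [set u : H | f u = 0].
have sS : lin_subspace S by split => // a u v; rewrite /S /= flin => -> ->; rewrite mulr0 addr0.
have Scl v : adherent S v -> S v.
  move=> hv; apply: nrC_small0 => e e0.
  have M0 : 0 < `|M| + 1 by rewrite ltr_wpDl.
  have [w Sw lt] := hv (e / (`|M| + 1)) ltac:(by rewrite divr_gt0).
  rewrite (_ : f v = f (v - w)); last by rewrite fB Sw subr0.
  apply: (le_trans (fM _)); apply: (@le_trans _ _ ((`|M| + 1) * nr (v - w))).
    by rewrite ler_wpM2r ?nr_ge0 // (le_trans (ler_norm _)) // lerDl.
  by rewrite mulrC -ler_pdivlMr // ltW.
have [hf|] := pselect (forall u, f u = 0).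
  by exists 0 => u; rewrite hf dot0r.
move=> /existsNP[u fu].
have [p Sp hp] := projection u sS Scl.
pose w := u - p; have fw : f w != 0.
  by apply/eqP; rewrite /w fB Sp subr0.
have w0 : dot w w != 0.
  by apply: contra fw => /eqP/dot_eq0 ->; rewrite f0.
exists ((f w / dot w w)^* *: w) => v.
rewrite dotZr conjCK.
have : dot (v - (f v / f w) *: w) w = 0.
  rewrite dotC hp ?conjC0 // /S /= fB fZ divfK // subrr //.
rewrite dotBl dotZl => /subr0_eq ->.
by rewrite mulrACA [f w * _]mulrC divfK // mulVf // mulr1.
Qed.
End Projection.

Section Total.
Variables (R : realType) (H : hilbertType R).
Local Notation C := (Cplx R).
Implicit Types (S : set H).

Definition total_set S : Prop := forall w, (forall s, S s -> dot s w = 0) -> w = 0.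

Lemma adherent_subspace S : lin_subspace S -> lin_subspace (adherent S).
Proof.
move=> [S0 SP]; split.
  by move=> e e0; exists 0; rewrite ?subrr ?nr0.
move=> a u v hu hv e e0.
have a1 : 0 < nr a + 1 by rewrite ltr_wpDl ?nr_ge0.
have [u' Su lu] := hu (e / 2 / (nr a + 1)) ltac:(by rewrite !divr_gt0).
have [v' Sv lv] := hv (e / 2) ltac:(by rewrite divr_gt0).
exists (a *: u' + v'); first exact: SP.
rewrite opprD addrACA -scalerBr; apply: le_lt_trans (nrD _ _) _.
rewrite nrZ [e]splitr ler_ltD //.
apply: (@le_trans _ _ ((nr a + 1) * nr (u - u'))).
  by rewrite ler_wpM2r ?nr_ge0 // lerDl.
by rewrite mulrC -ler_pdivlMr // ltW.
Qed.

Lemma adherent_closed S u : adherent (adherent S) u -> adherent S u.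
Proof.
move=> h e e0; have [v hv lv] := h (e / 2) ltac:(by rewrite divr_gt0).
have [w Sw lw] := hv (e / 2) ltac:(by rewrite divr_gt0).
by exists w => //; have := nr_sumD u v w; lra.
Qed.

Lemma sub_adherent S u : S u -> adherent S u.
Proof. by move=> Su e e0; exists u; rewrite // subrr nr0. Qed.

Lemma total_adherent S u : lin_subspace S -> total_set S -> adherent S u.
Proof.
move=> sS tS.
have [p Sp hp] := projection u (adherent_subspace sS) (@adherent_closed S).
suff -> : u = p by [].
apply: subr0_eq; apply: tS => s Ss.
by rewrite dotC hp ?conjC0 //; exact: sub_adherent.
Qed.

Lemma lspan_subspace (V : lmodType C) (S : set V) : lin_subspace (lspan S).
Proof.
split; first by exists 0%N, (fun=> 0), (fun=> 0); split; [case|rewrite big_ord0].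
move=> a _ _ [n [b [s [Ss ->]]]] [m [c [t [St ->]]]].
exists (n + m)%N, (fun i => match fintype.split i with inl j => a * b j | inr j => c j end),
  (fun i => match fintype.split i with inl j => s j | inr j => t j end); split.
  by move=> i; case: (fintype.split i).
rewrite big_split_ord /= scaler_sumr; congr (_ + _); apply: eq_bigr => i _.
  by rewrite (unsplitK (inl i)) scalerA.
by rewrite (unsplitK (inr i)).
Qed.

Lemma sub_lspan (V : lmodType C) (S : set V) v : S v -> lspan S v.
Proof. by move=> Sv; exists 1%N, (fun=> 1), (fun=> v); split=> //; rewrite big_ord1 scale1r. Qed.

Lemma lspan_min (V : lmodType C) (S P : set V) : lin_subspace P -> S `<=` P -> lspan S `<=` P.
Proof.
move=> [P0 PP] SP _ [n [a [s [Ss ->]]]].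
by elim/big_rec: _ => // i x _ Px; apply: PP => //; apply: SP.
Qed.

Lemma orth_subspace (w : H) : lin_subspace [set s | dot s w = 0].
Proof.
split; first exact: dot0l.
by move=> a u v /= hu hv; rewrite dotDl dotZl hu hv mulr0 addr0.
Qed.

Lemma dense_adherent S : dense S -> forall u, adherent S u.
Proof.
move=> dS u e e0.
have ou : open [set v | nr (u - v) < e].
  rewrite openE => v /= uv; rewrite /interior.
  have e1 : 0 < e - nr (u - v) by rewrite subr_gt0.
  apply: filterS (near_nr v e1) => w /= vw.
  by apply: le_lt_trans (nr_sumD u v w) _; lra.
have [|v [/= uv Sv]] := dS _ _ ou; first by exists u; rewrite /= subrr nr0.
by exists v.
Qed.

Lemma adherent_orth S w u : (forall s, S s -> dot s w = 0) -> adherent S u ->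
  dot u w = 0.
Proof.
move=> h hu; apply: nrC_small0 => e e0.
have w1 : 0 < nr w + 1 by rewrite ltr_wpDl ?nr_ge0.
have [v Sv lv] := hu (e / (nr w + 1)) ltac:(by rewrite divr_gt0).
have -> : dot u w = dot (u - v) w by rewrite dotBl (h v Sv) subr0.
apply: le_trans (dot_CS _ _) _; apply: (@le_trans _ _ (nr (u - v) * (nr w + 1))).
  by rewrite ler_wpM2l ?nr_ge0 // lerDl.
by rewrite -ler_pdivlMr // ltW.
Qed.

Lemma dense_total S : dense (lspan S) -> total_set S.
Proof.
move=> dS w h; apply: dot_eq0; apply: (@adherent_orth (lspan S)); last exact: dense_adherent.
by move=> s; apply: (lspan_min (orth_subspace w)).
Qed.

Lemma total_setT : total_set [set: H].
Proof. by move=> w h; apply: dot_eq0; exact: h. Qed.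

Lemma total_lspan S : total_set S -> total_set (lspan S).
Proof. by move=> tS w h; apply: tS => s Ss; apply: h; exact: sub_lspan. Qed.

Lemma lin_subspaceZ (V : lmodType C) (S : set V) a v : lin_subspace S -> S v -> S (a *: v).
Proof. by move=> [S0 SP] Sv; rewrite -[_ *: _]addr0; apply: (SP). Qed.

Lemma lin_subspaceB (V : lmodType C) (S : set V) u v : lin_subspace S -> S u -> S v -> S (u - v).
Proof. by move=> [S0 SP] Su Sv; rewrite addrC -scaleN1r; apply: (SP). Qed.
End Total.

(** * Bounded operators, adjoints and extension by continuity *)

Section Bop.
Variable R : realType.
Local Notation C := (Cplx R).
Implicit Types H L : hilbertType R.

Section One.
Variables H L : hilbertType R.
Implicit Types x y : bop H L.

Lemma bop_ext x y : (forall u, x u = y u) -> x = y.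
Proof. by move=> h; apply/val_inj/funext. Qed.

Lemma bop_linear x a u v : x (a *: u + v) = a *: x u + x v.
Proof. by have := bopP x; rewrite inE => -[lx _]; exact: lx. Qed.

Lemma bop0 x : x 0 = 0.
Proof. by have := bop_linear x 1 0 0; rewrite scaler0 addr0 scale1r -[LHS]addr0 => /addrI. Qed.

Lemma bopZ x a u : x (a *: u) = a *: x u.
Proof. by rewrite -[a *: u]addr0 bop_linear bop0 addr0. Qed.

Lemma bopD x u v : x (u + v) = x u + x v.
Proof. by rewrite -[u]scale1r bop_linear !scale1r. Qed.

Lemma bopB x u v : x (u - v) = x u - x v.
Proof. by rewrite addrC -scaleN1r bop_linear scaleN1r addrC. Qed.

Lemma bop_sum x I r (P : pred I) (F : I -> H) :
  x (\sum_(i <- r | P i) F i) = \sum_(i <- r | P i) x (F i).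
Proof. by apply: (big_morph x); [exact: bopD | exact: bop0]. Qed.

Lemma bop_bound x : exists2 M : R, 0 < M & forall u, nr (x u) <= M * nr u.
Proof.
have := bopP x; rewrite inE => -[_ cx].
have [d d0 hd] := continuous_nr (cx 0) ltr01.
exists (2 / d); first by rewrite divr_gt0.
move=> u; have [->|u0] := eqVneq u 0; first by rewrite bop0 !nr0 mulr0.
have nu : 0 < nr u by rewrite nr_gt0.
(* Scales u to norm d / 2, inside the ball on which x has norm below 1. *)
pose t : R := d / (2 * nr u).
have t0 : 0 < t by rewrite divr_gt0 ?mulr_gt0.
have := hd ((t%:C%C : C) *: u).
rewrite bop0 bopZ !sub0r !nrN !nrZ nrR gtr0_norm //.
have -> : t * nr u = d / 2 by rewrite /t; field; lra.
move=> /(_ ltac:(lra)).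
rewrite mulrC -ltr_pdivlMr // div1r => /ltW/le_trans; apply.
by rewrite /t invf_div mulrAC.
Qed.

Lemma bounded_operatorP (f : H -> L) (M : R) :
  (forall a u v, f (a *: u + v) = a *: f u + f v) ->
  (forall u, nr (f u) <= M * nr u) -> f \in @bounded_operator R H L.
Proof.
move=> flin fM; rewrite inE; split; first exact: flin.
have fB u v : f (u - v) = f u - f v by rewrite addrC -scaleN1r flin scaleN1r addrC.
apply: continuous_nrP => u e e0.
have M0 : 0 < `|M| + 1 by rewrite ltr_wpDl.
exists (e / (`|M| + 1)); first by rewrite divr_gt0.
move=> v uv; rewrite -fB; apply: le_lt_trans (fM _) _.
apply: (@le_lt_trans _ _ ((`|M| + 1) * nr (u - v))).
  by rewrite ler_wpM2r ?nr_ge0 // (le_trans (ler_norm _)) // lerDl.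
by rewrite mulrC -ltr_pdivlMr.
Qed.

Definition bop_of (f : H -> L) (M : R)
  (flin : forall a u v, f (a *: u + v) = a *: f u + f v)
  (fM : forall u, nr (f u) <= M * nr u) : bop H L := Bop (bounded_operatorP flin fM).
End One.

Lemma adj_ex H L (x : bop H L) : exists y : bop L H, forall u v, dot (x u) v = dot u (y v).
Proof.
have [M M0 hM] := bop_bound x.
have /choice[f hf] w : exists y, forall u, dot (x u) w = dot u y.
  apply: (@riesz R H _ (M * nr w)) => [a s t|s].
    by rewrite bop_linear dotDl dotZl.
  by apply: le_trans (dot_CS _ _) _; rewrite mulrAC ler_wpM2r ?nr_ge0.
have flin a u v : f (a *: u + v) = a *: f u + f v.
  apply: dot_inj => w; rewrite dotC -hf dotDr dotZr !hf rmorphD rmorphM /= conjCK.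
  by rewrite dotDl dotZl -!(dotC w).
have fM u : nr (f u) <= M * nr u.
  have [->|fu] := eqVneq (f u) 0; first by rewrite nr0 mulr_ge0 ?nr_ge0 ?ltW.
  rewrite -(ler_pM2l (x := nr (f u))) ?nr_gt0 // -expr2.
  have -> : nr (f u) ^+ 2 = nr (dot (x (f u)) u : C).
    by rewrite hf dotE nrR ger0_norm ?exprn_ge0 ?nr_ge0.
  apply: le_trans (dot_CS _ _) _.
  by rewrite mulrCA mulrA ler_wpM2r ?nr_ge0.
by exists (bop_of flin fM).
Qed.

Lemma adjE H L (x : bop H L) u v : dot (x u) v = dot u (adj x v).
Proof.
have [y hy] := adj_ex x.
by rewrite /adj; case: xgetP => [z _ hz|/(_ y)]; [exact: hz | case].
Qed.

Lemma adjE' H L (x : bop H L) u v : dot (adj x u) v = dot u (x v).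
Proof. by rewrite dotC -adjE -dotC. Qed.

Lemma adj_unique H L (x : bop H L) (y : bop L H) :
  (forall u v, dot (x u) v = dot u (y v)) -> adj x = y.
Proof.
move=> h; apply: bop_ext => v; apply: dot_inj => u.
by rewrite adjE' dotC h -dotC.
Qed.

Lemma adjK H L (x : bop H L) : adj (adj x) = x.
Proof. by apply: adj_unique => u v; rewrite adjE'. Qed.

Lemma adj_comp H1 H2 H3 (y : bop H2 H3) (x : bop H1 H2) :
  adj (y \ob x) = adj x \ob adj y.
Proof. by apply: adj_unique => u v; rewrite /= !adjE. Qed.

Lemma adj_bid H : adj (bid H) = bid H.
Proof. exact: adj_unique. Qed.

Lemma bop_total_ext H L (S : set H) (x y : bop H L) :
  total_set S -> (forall s, S s -> x s = y s) -> x = y.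
Proof.
move=> tS h; apply: bop_ext => u; apply: dot_inj => w; rewrite !adjE; congr (dot u _).
by apply: subr0_eq; apply: tS => s Ss; rewrite dotBr -!adjE h // subrr.
Qed.

Lemma bcompA H1 H2 H3 H4 (x : bop H3 H4) (y : bop H2 H3) (z : bop H1 H2) :
  x \ob (y \ob z) = x \ob y \ob z.
Proof. exact: bop_ext. Qed.

Lemma bcomp1 H1 H2 (x : bop H1 H2) : x \ob bid H1 = x.
Proof. exact: bop_ext. Qed.

Lemma bcomp1l H1 H2 (x : bop H1 H2) : bid H2 \ob x = x.
Proof. exact: bop_ext. Qed.

Lemma nr_adj_le H L (X : bop H L) (M : R) v : 0 <= M ->
  (forall u, nr (X u) <= M * nr u) -> nr (adj X v) <= M * nr v.
Proof.
move=> M0 h; have [->|w0] := eqVneq (adj X v) 0; first by rewrite nr0 mulr_ge0 ?nr_ge0.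
rewrite -(ler_pM2l (x := nr (adj X v))) ?nr_gt0 // -expr2.
have -> : nr (adj X v) ^+ 2 = nr (dot (X (adj X v)) v).
  by rewrite adjE dotE nrR ger0_norm ?exprn_ge0 ?nr_ge0.
apply: le_trans (dot_CS _ _) _.
by rewrite mulrCA mulrA ler_wpM2r ?nr_ge0.
Qed.

Lemma dot_adj_comp H L (X : bop H L) u :
  dot (adj X (X u)) u = (nr (X u) ^+ 2)%:C%C.
Proof. by rewrite adjE' dotE. Qed.

(** The densely defined operator is given by its graph G, so a value may be described through any
    representation of its argument; the bound applied to differences makes G single-valued and lets
    it extend by continuity. *)
Lemma bop_extension H L (G : H -> L -> Prop) (M : R) : 0 <= M ->
  G 0 0 ->
  (forall a u u' v v', G u v -> G u' v' -> G (a *: u + u') (a *: v + v')) ->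
  (forall u v, G u v -> nr v <= M * nr u) ->
  (forall u, adherent [set u | exists v, G u v] u) ->
  exists x : bop H L, forall u v, G u v -> x u = v.
Proof.
move=> M0 G0 GP GM Gd.
have GB u u' v v' : G u v -> G u' v' -> G (u - u') (v - v').
  move=> g g'; rewrite (addrC u) (addrC v) -(scaleN1r u') -(scaleN1r v').
  exact: GP.
have step u : exists w, forall u' v', G u' v' -> nr (w - v') <= M * nr (u - u').
  have /choice[s hs] n : exists p : H * L, G p.1 p.2 /\ nr (u - p.1) < n.+1%:R^-1.
    have [|u' [v' g] lt] := Gd u n.+1%:R^-1; first by rewrite invr_gt0.
    by exists (u', v').
  have M1 : 0 < M + 1 by rewrite ltr_wpDl.
  have small (e : R) : 0 < e -> exists N, forall n, (N <= n)%N -> (M + 1) * nr (u - (s n).1) < e.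
    move=> e0; have [|N hN] := @inv_succ_small R (e / (M + 1)); first by rewrite divr_gt0.
    exists N => n /hN lt; have [_ ln] := hs n.
    by rewrite mulrC -ltr_pdivlMr //; exact: lt_trans lt.
  have [|w hw] := @nr_cauchy R L (fun n => (s n).2).
    move=> e e0; have [N hN] := small (e / 2) ltac:(by rewrite divr_gt0).
    exists N => m n /hN lm /hN ln; have [gm _] := hs m; have [gn _] := hs n.
    apply: le_lt_trans (GM _ _ (GB _ _ _ _ gm gn)) _.
    have t := nr_sumD (s m).1 u (s n).1; rewrite (nrBC (s m).1 u) in t.
    have : M * nr ((s m).1 - (s n).1) <= M * (nr (u - (s m).1) + nr (u - (s n).1)).
      by rewrite ler_wpM2l.
    by have := nr_ge0 (u - (s m).1); have := nr_ge0 (u - (s n).1); lra.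
  exists w => u' v' g; apply/ler_addgt0Pr => e e0.
  have [N hN] := small (e / 2) ltac:(by rewrite divr_gt0).
  have [N' hN'] := hw (e / 2) ltac:(by rewrite divr_gt0).
  have := hN _ (leq_maxl N N'); have := hN' _ (leq_maxr N N').
  set n := maxn N N'; have [gn _] := hs n => l1 l2.
  have l3 := GM _ _ (GB _ _ _ _ gn g).
  have := nr_sumD w (s n).2 v'; rewrite (nrBC w (s n).2).
  have t := nr_sumD (s n).1 u u'; rewrite (nrBC _ u) in t.
  have : M * nr ((s n).1 - u') <= M * (nr (u - (s n).1) + nr (u - u')).
    by rewrite ler_wpM2l.
  by have := nr_ge0 (u - (s n).1); lra.
have /choice[f hf] := step.
have fG u v : G u v -> f u = v.
  by move=> g; apply/eqP; rewrite -subr_eq0 -nr_eq0 eq_le nr_ge0 (le_trans (hf _ _ _ g)) // subrr nr0 mulr0.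
have near u (e : R) : 0 < e -> exists u' v', [/\ G u' v', nr (u - u') <= e & nr (f u - v') <= M * e].
  move=> e0; have [u' [v' g] lt] := Gd u e e0; exists u', v'; split=> //; first exact: ltW.
  by apply: le_trans (hf _ _ _ g) _; rewrite ler_wpM2l // ltW.
have flin a u v : f (a *: u + v) = a *: f u + f v.
  apply: subr0_eq; apply: nr_small0 => e e0.
  pose K := 2 * M * (nr a + 1) + 1.
  have K0 : 0 < K by rewrite ltr_wpDl // !mulr_ge0 // addr_ge0 ?nr_ge0.
  have d0 : 0 < e / K by rewrite divr_gt0.
  have [u' [x' [gu lu lx]]] := near u _ d0; have [v' [y' [gv lv ly]]] := near v _ d0.
  have l1 := hf (a *: u + v) _ _ (GP a _ _ _ _ gu gv).
  have l2 : nr (a *: u + v - (a *: u' + v')) <= nr a * (e / K) + e / K.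
    rewrite opprD addrACA -scalerBr; apply: le_trans (nrD _ _) _.
    by rewrite nrZ lerD // ler_wpM2l ?nr_ge0.
  have l3 : nr (a *: x' + y' - (a *: f u + f v)) <= nr a * (M * (e / K)) + M * (e / K).
    rewrite opprD addrACA -scalerBr; apply: le_trans (nrD _ _) _.
    by rewrite nrZ (nrBC x') (nrBC y') lerD // ler_wpM2l ?nr_ge0.
  apply: le_trans (nr_sumD _ (a *: x' + y') _) _.
  have l4 : M * nr (a *: u + v - (a *: u' + v')) <= M * (nr a * (e / K) + e / K).
    by rewrite ler_wpM2l.
  have eK : e = (e / K) * K by rewrite divfK ?gt_eqF.
  by rewrite [leRHS]eK /K; move: l1 l3 l4; lra.
have fM u : nr (f u) <= M * nr u.
  apply/ler_addgt0Pr => e e0.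
  have d0 : 0 < e / (2 * M + 1) by rewrite divr_gt0 // ltr_wpDl // mulr_ge0.
  have [u' [v' [g lu lv]]] := near u _ d0.
  have l1 := GM _ _ g; have l2 := nr_sumD (f u) v' 0; have l3 := nr_sumD u' u 0.
  rewrite !subr0 (nrBC u') in l2 l3.
  have l4 : M * nr u' <= M * (e / (2 * M + 1) + nr u).
    by rewrite ler_wpM2l // (le_trans l3) // lerD2r.
  have eK : e = (e / (2 * M + 1)) * (2 * M + 1) by rewrite divfK // gt_eqF // ltr_wpDl // mulr_ge0.
  by rewrite [in leRHS]eK; lra.
by exists (bop_of flin fM).
Qed.

Lemma proj_ex H (S : set H) : lin_subspace S -> (forall u, adherent S u -> S u) ->
  exists p : bop H H, [/\ forall u, S (p u), forall u, S u -> p u = u & adj p = p].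
Proof.
move=> sS Scl.
have /choice[f hf] u : exists p, S p /\ forall w, S w -> dot (u - p) w = 0.
  by have [p ? ?] := projection u sS Scl; exists p.
have uniq u p : S p -> (forall w, S w -> dot (u - p) w = 0) -> f u = p.
  move=> Sp hp; have [Sf hfu] := hf u; apply: subr0_eq; apply: dot_eq0.
  set d := f u - p; have Sd : S d by exact: lin_subspaceB.
  have -> : d = (u - p) - (u - f u) by rewrite opprB addrC addrA subrK.
  by rewrite dotBl hp ?hfu ?subrr // opprB addrC addrA subrK.
have flin a u v : f (a *: u + v) = a *: f u + f v.
  have [Su hu] := hf u; have [Sv hv] := hf v; apply: uniq; first by case: sS => _; apply.
  by move=> w Sw; rewrite opprD addrACA -scalerBr dotDl dotZl hu // hv // mulr0 addr0.
have fM u : nr (f u) <= 1 * nr u.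
  have [Su hu] := hf u; rewrite mul1r -ler_sqr ?nnegrE ?nr_ge0 //.
  by have := nr_pyth (hu _ Su); rewrite subrK => ->; rewrite lerDr exprn_ge0 ?nr_ge0.
exists (bop_of flin fM); split => /=.
- by move=> u; case: (hf u).
- by move=> u Su; apply: uniq => // w _; rewrite subrr dot0l.
- apply: adj_unique => u v /=.
  have [Su hu] := hf u; have [Sv hv] := hf v.
  have := hu _ Sv; rewrite dotBl => /subr0_eq ->.
  by apply/eqP; rewrite -subr_eq0 -dotBr dotC hv // conjC0.
Qed.
End Bop.

(** * Tensor products of operators *)

Section Orthonormal.
Variables (R : realType) (H : hilbertType R).
Local Notation C := (Cplx R).

(** Families are total functions on [nat] of which only the first m terms count, so a family can be
    lengthened without changing its type. *)
Definition orthonormal_upto (m : nat) (f : nat -> H) : Prop :=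
  forall i j, (i < m)%N -> (j < m)%N -> dot (f i) (f j) = (i == j)%:R.

Definition expand (m : nat) (f : nat -> H) (v : H) : H :=
  \sum_(k < m) dot v (f k) *: f k.

Lemma dot_expand m f v k : orthonormal_upto m f -> (k < m)%N ->
  dot (expand m f v) (f k) = dot v (f k).
Proof.
move=> of_ km; rewrite /expand dot_suml (bigD1 (Ordinal km)) //= dotZl of_ // eqxx mulr1.
rewrite big1 ?addr0 // => i ik; rewrite dotZl of_ //.
by rewrite (_ : (i == k :> nat) = false) ?mulr0 //; apply/negbTE.
Qed.

Lemma orthonormal_extend m f (r : H) : orthonormal_upto m f -> r != 0 ->
  (forall k, (k < m)%N -> dot r (f k) = 0) ->
  orthonormal_upto m.+1 (fun k => if (k < m)%N then f k else ((nr r)^-1%:C%C : C) *: r).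
Proof.
move=> of_ r0 rf i j; rewrite !ltnS => im jm.
case: ifP => im'; case: ifP => jm'.
- exact: of_.
- have -> : (i == j) = false by apply/negbTE; move: im' jm'; case: (eqVneq i j) => // ->->.
  by rewrite dotZr dotC rf // conjC0 mulr0.
- have -> : (i == j) = false by apply/negbTE; move: im' jm'; case: (eqVneq i j) => // ->->.
  by rewrite dotZl rf // mulr0.
- have -> : i == j.
    rewrite eqn_leq; apply/andP; split; [apply: leq_trans im _|apply: leq_trans jm _].
      by rewrite leqNgt jm'.
    by rewrite leqNgt im'.
  have nr0 : nr r != 0 by rewrite nr_eq0.
  rewrite dotZl dotZr dotE conj_real.
  rewrite -!rmorphM /= (_ : _ * _ = 1) ?rmorph1 //.
  by rewrite expr2 mulrCA mulrA mulrACA mulVf // mulr1.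
Qed.

(** Gram-Schmidt; [expand m f v = v] says that v lies in the span of the first m vectors of f. *)
Lemma orthonormal_hull (s : seq H) : exists m f, orthonormal_upto m f /\
  forall v, v \in s -> expand m f v = v.
Proof.
elim: s => [|v s [m [f [of_ fs]]]]; first by exists 0%N, (fun=> 0); split.
pose r := v - expand m f v.
have rf k : (k < m)%N -> dot r (f k) = 0.
  by move=> km; rewrite dotBl dot_expand // subrr.
have [r0|r0] := eqVneq r 0.
  exists m, f; split=> // w; rewrite in_cons => /orP[/eqP->|/fs//].
  by move/subr0_eq: r0.
have of' := orthonormal_extend of_ r0 rf; set f' := fun k => _ in of'.
exists m.+1, f'; split=> //.
have E w : expand m.+1 f' w = expand m f w + dot w (f' m) *: f' m.
  rewrite /expand big_ord_recr /=; congr (_ + _); apply: eq_bigr => i _.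
  by rewrite /f' ltn_ord.
have f'm : f' m = ((nr r)^-1%:C%C : C) *: r by rewrite /f' ltnn.
have er : dot (expand m f v) r = 0.
  rewrite /expand dot_suml big1 // => i _.
  by rewrite dotZl [dot (f _) r]dotC rf // conjC0 mulr0.
have fr w : expand m f w = w -> dot w r = 0.
  move=> <-; rewrite /expand dot_suml big1 // => i _.
  by rewrite dotZl [dot (f _) r]dotC rf // conjC0 mulr0.
move=> w; rewrite in_cons => /orP[/eqP->|/fs ws]; rewrite E f'm.
  have -> : dot v (((nr r)^-1%:C%C : C) *: r) = (nr r)%:C%C.
    rewrite dotZr conj_real (_ : v = expand m f v + r); last by rewrite addrC subrK.
    rewrite dotDl er add0r dotE -rmorphM expr2 mulrA mulVf ?mul1r //.
    by rewrite nr_eq0.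
  rewrite scalerA -rmorphM mulfV ?nr_eq0 // rmorph1 scale1r.
  by rewrite addrC subrK.
by rewrite dotZr fr // mulr0 scale0r addr0.
Qed.
End Orthonormal.

Section Tensor.
Variables (R : realType) (H L T : hilbertType R) (t : {bilinear H -> L -> T}).
Local Notation C := (Cplx R).
Hypothesis tP : is_tensor t.

Lemma tensE u v u' v' : dot (t u v) (t u' v') = dot u u' * dot v v'.
Proof. exact: (proj1 tP). Qed.

Lemma nr_tens u v : nr (t u v) = nr u * nr v.
Proof.
apply/eqP; rewrite -(@eqrXn2 _ 2) ?mulr_ge0 ?nr_ge0 //; apply/eqP.
by have := tensE u v u v; rewrite !dotE -rmorphM => /complexI ->; rewrite exprMn.
Qed.

Lemma tens_total : total_set [set w | exists u v, w = t u v].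
Proof. exact: dense_total (proj2 tP). Qed.

Lemma tens_ext w w' : (forall u v, dot w (t u v) = dot w' (t u v)) -> w = w'.
Proof.
move=> h; apply: subr0_eq; apply: tens_total => _ [u [v ->]].
by rewrite dotC dotBl h subrr conjC0.
Qed.

Lemma tensl_linear u a v v' : t u (a *: v + v') = a *: t u v + t u v'.
Proof. exact: linearPr. Qed.
Lemma tensr_linear v a u u' : t (a *: u + u') v = a *: t u v + t u' v.
Proof. exact: linearPl. Qed.

Definition tensl u : bop L T :=
  bop_of (tensl_linear u) (fun v => eq_ind_r (fun x => x <= nr u * nr v) (lexx _) (nr_tens u v)).
Lemma tensr_bound v u : nr (t u v) <= nr v * nr u.
Proof. by rewrite nr_tens mulrC. Qed.
Definition tensr v : bop H T := bop_of (tensr_linear v) (tensr_bound v).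

Lemma tens_suml I r (P : pred I) (F : I -> H) v :
  t (\sum_(i <- r | P i) F i) v = \sum_(i <- r | P i) t (F i) v.
Proof. exact: (bop_sum (tensr v)). Qed.
Lemma tens_sumr I r (P : pred I) (F : I -> L) u :
  t u (\sum_(i <- r | P i) F i) = \sum_(i <- r | P i) t u (F i).
Proof. exact: (bop_sum (tensl u)). Qed.
Lemma tensZl a u v : t (a *: u) v = a *: t u v.
Proof. exact: (bopZ (tensr v)). Qed.
Lemma tensZr a u v : t u (a *: v) = a *: t u v.
Proof. exact: (bopZ (tensl u)). Qed.

Lemma tens_total_of (S : set H) (S' : set L) : total_set S -> total_set S' ->
  total_set [set w | exists u v, [/\ S u, S' v & w = t u v]].
Proof.
move=> tS tS' w hw; apply: tens_total => _ [u [v ->]].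
rewrite (adjE (tensl u)) (_ : adj (tensl u) w = 0) ?dot0r //.
apply: tS' => s' Ss'; rewrite -adjE /= (adjE (tensr s')) (_ : adj (tensr s') w = 0) ?dot0r //.
by apply: tS => s Ss; rewrite -adjE; apply: hw; exists s, s'.
Qed.

Lemma nr_sum_orthr m (U : nat -> H) f : orthonormal_upto m f ->
  nr (\sum_(k < m) t (U k) (f k)) ^+ 2 = \sum_(k < m) nr (U k) ^+ 2.
Proof.
move=> of_; apply: (@complexI R); rewrite -dotE dot_suml rmorph_sum.
apply: eq_bigr => i _; rewrite dot_sumr (bigD1 i) //= big1 => [|j ji].
  by rewrite tensE of_ // eqxx mulr1 addr0 dotE.
by rewrite tensE of_ // (_ : (i == j :> nat) = false) ?mulr0 //; apply/negbTE; rewrite eq_sym.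
Qed.

Lemma nr_sum_orthl m (U : nat -> L) f : orthonormal_upto m f ->
  nr (\sum_(k < m) t (f k) (U k)) ^+ 2 = \sum_(k < m) nr (U k) ^+ 2.
Proof.
move=> of_; apply: (@complexI R); rewrite -dotE dot_suml rmorph_sum.
apply: eq_bigr => i _; rewrite dot_sumr (bigD1 i) //= big1 => [|j ji].
  by rewrite tensE of_ // eqxx mul1r addr0 dotE.
by rewrite tensE of_ // (_ : (i == j :> nat) = false) ?mul0r //; apply/negbTE; rewrite eq_sym.
Qed.
End Tensor.

Lemma nr_sum_orth (R : realType) (H : hilbertType R) m (c : nat -> Cplx R) (f : nat -> H) :
  orthonormal_upto m f ->
  nr (\sum_(k < m) c k *: f k) ^+ 2 = \sum_(k < m) nr (c k) ^+ 2.
Proof.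
move=> of_; apply: (@complexI R); rewrite -dotE dot_suml rmorph_sum.
apply: eq_bigr => i _; rewrite dot_sumr (bigD1 i) //= big1 => [|j ji].
  by rewrite dotZl dotZr of_ // eqxx mulr1 addr0 mul_conjE.
by rewrite dotZl dotZr of_ // (_ : (i == j :> nat) = false) ?mulr0 //; apply/negbTE; rewrite eq_sym.
Qed.

Section TensorMap.
Variables (R : realType) (H L T H' L' T' : hilbertType R).
Local Notation C := (Cplx R).
Variables (t : {bilinear H -> L -> T}) (t' : {bilinear H' -> L' -> T'}).
Hypotheses (tP : is_tensor t) (t'P : is_tensor t').
Variables (x : bop H H') (y : bop L L').

(** The factors are applied one at a time. With an orthonormal family f on the right the tensor is
    the sum of [t (U k) (f k)], of squared norm sum |U k|^2, which bounds the effect of x. Expanding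
    the vectors x (U k) in an orthonormal family e on the left then does the same for y. *)
Lemma tensor_map_bound Mx My n (u : 'I_n -> H) (v : 'I_n -> L) :
  0 <= Mx -> 0 <= My ->
  (forall w, nr (x w) <= Mx * nr w) -> (forall w, nr (y w) <= My * nr w) ->
  nr (\sum_i t' (x (u i)) (y (v i))) <= My * Mx * nr (\sum_i t (u i) (v i)).
Proof.
move=> Mx0 My0 hx hy.
have [m [f [of_ fv]]] := orthonormal_hull [seq v i | i : 'I_n].
have vE i : v i = \sum_(k < m) dot (v i) (f k) *: f k.
  by apply/esym/fv; apply: map_f; rewrite mem_enum.
pose U k : H := \sum_i dot (v i) (f k) *: u i.
have wE : \sum_i t (u i) (v i) = \sum_(k < m) t (U k) (f k).
  under [RHS]eq_bigr => k _ do rewrite /U (tens_suml tP).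
  rewrite exchange_big /=; apply: eq_bigr => i _.
  rewrite {1}[v i]vE (tens_sumr tP); apply: eq_bigr => k _.
  by rewrite (tensZr tP) (tensZl tP).
have w'E : \sum_i t' (x (u i)) (y (v i)) = \sum_(k < m) t' (x (U k)) (y (f k)).
  under [RHS]eq_bigr => k _ do rewrite /U bop_sum (tens_suml t'P).
  rewrite exchange_big /=; apply: eq_bigr => i _.
  rewrite {1}[v i]vE bop_sum (tens_sumr t'P); apply: eq_bigr => k _.
  by rewrite !bopZ (tensZr t'P) (tensZl t'P).
have [p [e [oe eU]]] := orthonormal_hull [seq x (U (k : 'I_m)) | k : 'I_m].
have xUE (k : 'I_m) : x (U k) = \sum_(l < p) dot (x (U k)) (e l) *: e l.
  by apply/esym/eU; apply: (map_f (fun k : 'I_m => x (U k))); rewrite mem_enum.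
pose V l : L := \sum_(k < m) dot (x (U k)) (e l) *: f k.
have w'E2 : \sum_(k < m) t' (x (U k)) (y (f k)) = \sum_(l < p) t' (e l) (y (V l)).
  under [RHS]eq_bigr => l _ do rewrite /V bop_sum (tens_sumr t'P).
  rewrite exchange_big /=; apply: eq_bigr => k _.
  rewrite {1}[x (U k)]xUE (tens_suml t'P); apply: eq_bigr => l _.
  by rewrite bopZ (tensZr t'P) (tensZl t'P).
rewrite -ler_sqr ?nnegrE ?mulr_ge0 ?nr_ge0 //.
rewrite wE w'E w'E2 exprMn (nr_sum_orthr tP _ of_) (nr_sum_orthl t'P (fun l => y (V l)) oe).
have sq (M a b : R) : 0 <= M -> 0 <= a -> 0 <= b -> a <= M * b -> a ^+ 2 <= M ^+ 2 * b ^+ 2.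
  by move=> *; rewrite -exprMn ler_sqr ?nnegrE ?mulr_ge0.
apply: (@le_trans _ _ (My ^+ 2 * \sum_(l < p) nr (V l) ^+ 2)).
  by rewrite mulr_sumr ler_sum // => l _; apply: sq; rewrite ?nr_ge0.
rewrite exprMn -mulrA ler_wpM2l ?exprn_ge0 //.
have -> : \sum_(l < p) nr (V l) ^+ 2 = \sum_(k < m) nr (x (U k)) ^+ 2.
  under eq_bigr => l _ do rewrite (nr_sum_orth (fun k => dot (x (U k)) (e l)) of_).
  rewrite exchange_big /=; apply: eq_bigr => k _.
  by rewrite [in RHS]xUE (nr_sum_orth (fun l => dot (x (U k)) (e l)) oe).
by rewrite mulr_sumr ler_sum // => k _; apply: sq; rewrite ?nr_ge0.
Qed.

Lemma btens_ex : exists z : bop T T', forall u v, z (t u v) = t' (x u) (y v).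
Proof.
have [Mx Mx0 hx] := bop_bound x; have [My My0 hy] := bop_bound y.
pose G (w : T) (w' : T') := exists n (u : 'I_n -> H) (v : 'I_n -> L),
  w = \sum_i t (u i) (v i) /\ w' = \sum_i t' (x (u i)) (y (v i)).
have [] := @bop_extension R T T' G (My * Mx).
- by rewrite mulr_ge0 ?ltW.
- by exists 0%N, (fun=> 0), (fun=> 0); rewrite !big_ord0.
- move=> a _ _ _ _ [n [u [v [-> ->]]]] [m [u' [v' [-> ->]]]].
  exists (n + m)%N, (fun i => match fintype.split i with inl j => a *: u j | inr j => u' j end),
    (fun i => match fintype.split i with inl j => v j | inr j => v' j end).
  rewrite !big_split_ord /= !scaler_sumr; split; congr (_ + _); apply: eq_bigr => i _;
    rewrite ?(unsplitK (inl i)) ?(unsplitK (inr i)) //; rewrite ?bopZ ?(tensZl tP) ?(tensZl t'P) //.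
- move=> _ _ [n [u [v [-> ->]]]]; apply: tensor_map_bound => //; exact: ltW.
- move=> w; apply: total_adherent.
    split; first by exists 0, 0%N, (fun=> 0), (fun=> 0); rewrite !big_ord0.
    move=> a _ _ [_ [n [u [v [-> _]]]]] [_ [m [u' [v' [-> _]]]]].
    eexists; exists (n + m)%N, (fun i => match fintype.split i with inl j => a *: u j | inr j => u' j end),
      (fun i => match fintype.split i with inl j => v j | inr j => v' j end); split; last by [].
    rewrite !big_split_ord /= !scaler_sumr; congr (_ + _); apply: eq_bigr => i _;
      rewrite ?(unsplitK (inl i)) ?(unsplitK (inr i)) // ?(tensZl tP) //.
  move=> s hs; apply: (tens_total tP) => _ [u [v ->]]; apply: hs.
  by exists (t' (x u) (y v)), 1%N, (fun=> u), (fun=> v); rewrite !big_ord1.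
move=> z hz; exists z => u v; apply: hz.
by exists 1%N, (fun=> u), (fun=> v); rewrite !big_ord1.
Qed.

Lemma btensE u v : btens t t' x y (t u v) = t' (x u) (y v).
Proof.
have [z hz] := btens_ex.
by rewrite /btens; case: xgetP => [b _ hb|/(_ z)]; [exact: hb | case].
Qed.

Lemma btens_unique (z : bop T T') :
  (forall u v, z (t u v) = t' (x u) (y v)) -> btens t t' x y = z.
Proof.
by move=> hz; apply: (bop_total_ext (tens_total tP)) => _ [u [v ->]]; rewrite btensE hz.
Qed.
End TensorMap.

Lemma adj_btens (R : realType) (H L T H' L' T' : hilbertType R)
    (t : {bilinear H -> L -> T}) (t' : {bilinear H' -> L' -> T'})
    (x : bop H H') (y : bop L L') : is_tensor t -> is_tensor t' ->
  adj (btens t t' x y) = btens t' t (adj x) (adj y).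
Proof.
move=> tP t'P; apply/esym; apply: btens_unique => // u v.
apply: (tens_ext tP) => u' v'.
by rewrite adjE' btensE // !tensE // !adjE'.
Qed.

Lemma dot_btens (R : realType) (H L T H' L' T' : hilbertType R)
    (t : {bilinear H -> L -> T}) (t' : {bilinear H' -> L' -> T'})
    (x : bop H H') (y : bop L L') w u v : is_tensor t -> is_tensor t' ->
  dot (btens t t' x y w) (t' u v) = dot w (t (adj x u) (adj y v)).
Proof. by move=> tP t'P; rewrite adjE adj_btens // btensE. Qed.

Lemma btens_comp (R : realType) (H1 L1 T1 H2 L2 T2 H3 L3 T3 : hilbertType R)
    (t1 : {bilinear H1 -> L1 -> T1}) (t2 : {bilinear H2 -> L2 -> T2}) (t3 : {bilinear H3 -> L3 -> T3})
    (x : bop H1 H2) (y : bop L1 L2) (x' : bop H2 H3) (y' : bop L2 L3) :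
  is_tensor t1 -> is_tensor t2 -> is_tensor t3 ->
  btens t1 t3 (x' \ob x) (y' \ob y) = btens t2 t3 x' y' \ob btens t1 t2 x y.
Proof.
move=> tP1 tP2 tP3; apply: btens_unique => // u v.
by rewrite -[LHS]/(btens t2 t3 x' y' (btens t1 t2 x y (t1 u v))) !btensE.
Qed.

Lemma btens_bid (R : realType) (H L T : hilbertType R) (t : {bilinear H -> L -> T}) :
  is_tensor t -> btens t t (bid H) (bid L) = bid T.
Proof. by move=> tP; exact: btens_unique. Qed.

(** * The sigma-weak topology *)

Section Series.
Variable R : realType.
Local Notation C := (Cplx R).

Lemma cvg_series_nr (u : nat -> C) (b : nat -> R) :
  (forall n, nr (u n) <= b n) -> cvgn (series b) -> cvgn (series u).
Proof.
move=> ub /cvg_ex[l bl].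
have hl (e : R) : 0 < e -> exists N, forall n, (N <= n)%N -> `|l - series b n| < e.
  by move=> e0; move/cvgrPdist_lt: bl => /(_ e e0)[N _ hN]; exists N.
have mono m n : (m <= n)%N -> nr (series u n - series u m) <= series b n - series b m.
  move=> mn; rewrite !sub_series mn; elim/big_ind2: _ => //.
  - by rewrite nr0.
  - by move=> x1 x2 y1 y2 h1 h2; apply: le_trans (nrD _ _) (lerD h1 h2).
have [|w hw] := @nrC_cauchy R (series u).
  move=> e e0; have [N hN] := hl (e / 2) ltac:(by rewrite divr_gt0).
  exists N => m n mN nN; have := hN _ mN; have := hN _ nN.
  rewrite !ltr_norml => /andP[l1 l2] /andP[l3 l4].
  have [mn|/ltnW nm] := leqP m n; first by rewrite nrBC; have := mono _ _ mn; lra.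
  by have := mono _ _ nm; lra.
apply/cvg_ex; exists w; apply: cvg_nrP => e e0; have [N hN] := hw e e0.
by exists N => // n /hN; rewrite nrBC.
Qed.

Lemma square_summableE (V : hilbertType R) (u : nat -> V) :
  square_summable u <-> cvgn (series (fun n => nr (u n) ^+ 2 : R)).
Proof.
have nrE' n : nr (`|u n| ^+ 2 : C) = nr (u n) ^+ 2.
  by rewrite nrX nrE nrR ger0_norm ?nr_ge0.
split; last by apply: cvg_series_nr => n; rewrite nrE'.
move=> /cvg_ex[l ul]; apply/cvg_ex; exists (complex.Re l).
apply/cvgrPdist_lt => e e0.
have := ul _ (near_nr l e0) => -[N _ hN]; exists N => // n /hN /= lt.
apply: le_lt_trans lt.
have -> : series (fun n => nr (u n) ^+ 2) n = complex.Re (series (fun n => `|u n| ^+ 2 : C) n).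
  rewrite /series /= raddf_sum; apply: eq_bigr => i _ /=.
  by rewrite nrE -rmorphXn.
by rewrite -raddfB -(lecR `|_|) -nrE; exact: CRe_le.
Qed.

Lemma square_summable_le (V W : hilbertType R) (u : nat -> V) (v : nat -> W) (M : R) :
  (forall n, nr (v n) <= M * nr (u n)) -> square_summable u -> square_summable v.
Proof.
move=> vu /square_summableE su; apply/square_summableE.
apply: (@series_le_cvg _ _ (fun n => M ^+ 2 * nr (u n) ^+ 2)) => [n|n|n|].
- by rewrite exprn_ge0 ?nr_ge0.
- by rewrite mulr_ge0 ?sqr_ge0.
- by rewrite -exprMn ler_sqr ?nnegrE ?nr_ge0 // (le_trans _ (vu n)) ?nr_ge0.
rewrite (_ : series _ = (fun n => M ^+ 2 * series (fun n => nr (u n) ^+ 2) n)).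
  exact: is_cvgMr.
by apply/funext => n; rewrite /series /= mulr_sumr.
Qed.
End Series.

Section SigmaWeakTheory.
Variables (R : realType).
Local Notation C := (Cplx R).
Implicit Types H L : hilbertType R.

Lemma sw_evalE H L (x : bop H L) (p : sw_index H L) :
  sw_eval x p = limn (series (fun n => dot (x ((sval p).1 n)) ((sval p).2 n))).
Proof. by []. Qed.

Lemma sw_cvg H L (x : bop H L) (p : sw_index H L) :
  cvgn (series (fun n => dot (x ((sval p).1 n)) ((sval p).2 n))).
Proof.
case: p => -[u v] /= [/square_summableE su /square_summableE sv].
have [M M0 hM] := bop_bound x.
apply: (@cvg_series_nr _ _ (fun n => M * (nr (u n) ^+ 2 + nr (v n) ^+ 2))).
  move=> n; apply: le_trans (dot_CS _ _) _.
  apply: (@le_trans _ _ (M * nr (u n) * nr (v n))).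
    by rewrite ler_wpM2r ?nr_ge0.
  rewrite -mulrA; apply: ler_wpM2l; first exact: ltW.
  by apply: mul_le_sqrD; rewrite ?nr_ge0.
rewrite (_ : series _ = (fun n =>
    M * (series (fun n => nr (u n) ^+ 2) n + series (fun n => nr (v n) ^+ 2) n))).
  by apply: is_cvgMr; exact: is_cvgD.
by apply/funext => n; rewrite /series /= -big_split mulr_sumr.
Qed.

Lemma sw_eval_unique H L (x : bop H L) (p : sw_index H L) (l : C) :
  series (fun n => dot (x ((sval p).1 n)) ((sval p).2 n)) @ \oo --> l -> sw_eval x p = l.
Proof. by move=> h; rewrite sw_evalE; apply/cvg_lim. Qed.

Lemma sw_eval_linear H L (p : sw_index H L) a (x y : bop H L) :
  sw_eval (a *: x + y) p = a * sw_eval x p + sw_eval y p.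
Proof.
apply: sw_eval_unique.
rewrite (_ : series _ = (fun n => a * series (fun n => dot (x ((sval p).1 n)) ((sval p).2 n)) n
    + series (fun n => dot (y ((sval p).1 n)) ((sval p).2 n)) n)).
  by apply: cvgD; [apply: cvgMr|]; exact: sw_cvg.
apply/funext => n; rewrite /series /= mulr_sumr -big_split /=.
by apply: eq_bigr => i _; rewrite -dotZl -dotDl.
Qed.

Lemma sum_single (V : zmodType) (f : nat -> V) n :
  (forall k, (0 < k)%N -> f k = 0) -> series f n.+1 = f 0%N.
Proof.
move=> h; rewrite /series /= big_nat_recl // big1_seq ?addr0 // => i _.
exact: h.
Qed.

Lemma cvg_single (T : topologicalType) (s : nat -> T) (l : T) :
  (forall n, s n.+1 = l) -> s @ \oo --> l.
Proof.
move=> h; apply: (@cvg_trans _ ((fun=> l) @ \oo)); last exact: cvg_cst.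
by apply: near_eq_cvg; exists 1%N => // -[|n].
Qed.

Definition single (V : hilbertType R) (u : V) (n : nat) : V := if n == 0%N then u else 0.

Lemma single_square_summable (V : hilbertType R) (u : V) : square_summable (single u).
Proof.
apply/square_summableE/cvg_ex; exists (nr u ^+ 2); apply: cvg_single => n.
by rewrite sum_single // => -[|k] // _; rewrite /single /= nr0 expr0n.
Qed.

(** One-term sequences put the functional x |-> <x u, v> among those defining the sigma-weak
    topology. *)
Definition dot_index H L (u : H) (v : L) : sw_index H L :=
  exist _ (single u, single v) (conj (@single_square_summable H u) (@single_square_summable L v)).

Lemma sw_eval_dot H L (x : bop H L) u v : sw_eval x (dot_index u v) = dot (x u) v.
Proof.
apply: sw_eval_unique; apply: cvg_single => n /=.
by rewrite sum_single // => -[|k] // _; rewrite /single /= bop0 dot0l.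
Qed.

Lemma sw_cvgP H L (F : set_system (bop H L)) (x : bop H L) : Filter F ->
  F --> (x : sigma_weak H L) <-> forall p, (fun y => sw_eval y p) @ F --> sw_eval x p.
Proof.
move=> FF; split=> [Fx p|h].
  have c1 : (@sw_eval R H L) @ F --> (sw_eval x : {ptws _ -> _}).
    exact: cvg_trans (cvg_app _ Fx) (@initial_continuous _ _ (@sw_eval R H L) x).
  have /cvg_sup/(_ p) c2 := c1.
  exact: cvg_trans (cvg_app _ c2) (@initial_continuous _ _ (fun f : {ptws _ -> C} => f p) _).
have c1 : (@sw_eval R H L) @ F --> (sw_eval x : {ptws _ -> _}).
  apply/cvg_sup => p A /= [_ [[W oW <-] Wx WA]]; apply: (filterS WA); apply: (h p).
  exact: open_nbhs_nbhs.
move=> A /= [_ [[W oW <-] Wx WA]]; apply: (filterS WA); apply: c1.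
exact: open_nbhs_nbhs.
Qed.

Lemma sw_eval_continuous H L p : continuous (fun x : sigma_weak H L => sw_eval x p : C).
Proof.
move=> x.
exact: (proj1 (@sw_cvgP H L (nbhs (x : sigma_weak H L)) x _) (fun A h => h) p).
Qed.

(** The function g allows F to pull a defining functional back to another one only up to a
    conjugation or an affine map, as adjoints and translations do. *)
Lemma sw_map_continuous H L H' L' (F : bop H L -> bop H' L') :
  (forall p, exists2 g : C -> C, continuous g & exists p', forall x,
     sw_eval (F x) p = g (sw_eval x p')) ->
  continuous (F : sigma_weak H L -> sigma_weak H' L').
Proof.
move=> h x.
apply: (proj2 (@sw_cvgP H' L' (F @ nbhs (x : sigma_weak H L)) _ (fmap_filter _ _))) => p.
have [g cg [p' hp]] := h p.
suff : (fun y => sw_eval (F y) p) @ nbhs (x : sigma_weak H L) --> (sw_eval (F x) p : C) by [].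
rewrite hp (_ : (fun y => sw_eval (F y) p) = (fun y => g (sw_eval y p'))); last exact/funext.
exact: cvg_trans (cvg_app g (@sw_eval_continuous H L p' x)) (cg _).
Qed.

Lemma sub_sw_closure H L (S : set (bop H L)) : S `<=` sw_closure S.
Proof. exact: (@subset_closure (sigma_weak H L)). Qed.

Lemma sw_closure_idem H L (S : set (bop H L)) : sw_closure (sw_closure S) = sw_closure S.
Proof. exact/esym/(proj1 (closure_id _) (@closed_closure (sigma_weak H L) S)). Qed.

Lemma sw_closure_map H L H' L' (F : bop H L -> bop H' L') S S' :
  continuous (F : sigma_weak H L -> sigma_weak H' L') ->
  (forall x, S x -> sw_closure S' (F x)) -> forall x, sw_closure S x -> sw_closure S' (F x).
Proof.
move=> cF FS x Sx; rewrite -(sw_closure_idem S') => B /(cF x) nB.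
by have [y [Sy By]] := Sx _ nB; exists (F y); split => //; exact: FS.
Qed.

Lemma sw_continuous_comp H L H' L' (a : bop H' H) (b : bop L L') :
  continuous ((fun x => b \ob x \ob a) : sigma_weak H L -> sigma_weak H' L').
Proof.
apply: sw_map_continuous => -[[u v] [/= su sv]].
exists id; first by move=> ?; exact: cvg_id.
have [Ma _ ha] := bop_bound a; have [Mb _ hb] := bop_bound (adj b).
exists (exist _ (a \o u, adj b \o v) (conj (square_summable_le (fun n => ha (u n)) su)
  (square_summable_le (fun n => hb (v n)) sv))) => x.
rewrite !sw_evalE /=.
rewrite (_ : (fun n => dot (b (x (a (u n)))) (v n)) = (fun n => dot (x (a (u n))) (adj b (v n)))) //.
by apply/funext => n; exact: adjE.
Qed.

Lemma sw_continuous_affine H L a (y : bop H L) :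
  continuous ((fun x => a *: x + y) : sigma_weak H L -> sigma_weak H L).
Proof.
apply: sw_map_continuous => p.
exists (fun z => a * z + sw_eval y p); last by exists p => x; exact: sw_eval_linear.
have ca : continuous (fun z : C => a * z) by exact: mulrl_continuous.
move=> z; exact: (cvgD (ca z) (cvg_cst (sw_eval y p : C))).
Qed.

Lemma sw_continuous_adj H L :
  continuous (@adj R H L : sigma_weak H L -> sigma_weak L H).
Proof.
apply: sw_map_continuous => -[[u v] [/= su sv]].
exists (fun z => z^*); first exact: conjC_continuous.
exists (exist _ (v, u) (conj sv su)) => x; apply: sw_eval_unique => /=.
rewrite (_ : series _ = (fun z : C => z^*) \o
   (series (fun n => dot (x (v n)) (u n)))).
  apply: cvg_comp; last exact: conjC_continuous.
  exact: (@sw_cvg _ _ x (exist _ (v, u) (conj sv su))).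
apply/funext => n; rewrite /series /= rmorph_sum; apply: eq_bigr => i _.
by rewrite /= adjE' dotC.
Qed.

Lemma sw_closure_subspace H L (S : set (bop H L)) : lin_subspace S -> lin_subspace (sw_closure S).
Proof.
move=> [S0 SP]; split; first exact: sub_sw_closure.
move=> a x y Sx Sy.
apply: (sw_closure_map (@sw_continuous_affine H L a y) _ Sx) => x' Sx'.
have := sw_closure_map (@sw_continuous_affine H L 1 (a *: x')) (S := S) (S' := S).
move=> /(_ _ _ Sy); rewrite scale1r addrC; apply => y' Sy'.
by apply: sub_sw_closure; rewrite scale1r addrC; apply: (SP).
Qed.

Lemma normal_linear0 H L H' L' (D : set (bop H L)) (F : bop H L -> bop H' L') :
  D 0 -> normal_linear_on D F -> F 0 = 0.
Proof.
by move=> D0 [FL _]; have := FL 1 0 0 D0 D0; rewrite scaler0 addr0 scale1r -[LHS]addr0 => /addrI.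
Qed.

Lemma normal_near H L H' L' (D : set (bop H L)) (F : bop H L -> bop H' L') x u v (e : R) :
  normal_linear_on D F -> D x -> 0 < e ->
  nbhs (x : sigma_weak H L) [set y | D y -> nr (dot (F x u) v - dot (F y u) v : C) < e].
Proof.
move=> [_ Fc] Dx e0.
have Fx : F @ within D (nbhs (x : sigma_weak H L)) --> (F x : sigma_weak H' L').
  by move/subspace_continuousP : Fc; apply.
have /sw_cvgP/(_ (dot_index u v)) := Fx; rewrite sw_eval_dot => Fx'.
have n1 : nbhs (x : sigma_weak H L) [set y | D y ->
    nr (dot (F x u) v - sw_eval (F y) (dot_index u v) : C) < e] :=
  Fx' _ (near_nr (dot (F x u) v : C) e0).
by apply: filterS n1 => y /= h Dy; have := h Dy; rewrite sw_eval_dot.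
Qed.

(** Both coefficients are sigma-weakly continuous on the closed span of S and agree on the span. The
    vectors may differ on the two sides: identities between coefficients of generators, such as
    traciality, pass to the whole algebra in this form. *)
Lemma normal_dot2 H L H1 L1 H2 L2 (S : set (bop H L))
    (F : bop H L -> bop H1 L1) (F' : bop H L -> bop H2 L2) u v u' v' :
  normal_linear_on (sw_closure (lspan S)) F -> normal_linear_on (sw_closure (lspan S)) F' ->
  (forall s, S s -> dot (F s u) v = dot (F' s u') v') ->
  forall x, sw_closure (lspan S) x -> dot (F x u) v = dot (F' x u') v'.
Proof.
set D := sw_closure (lspan S) => Fn Fn' FS.
have sD : lin_subspace D by apply: sw_closure_subspace; exact: lspan_subspace.
have [D0 DP] := sD.
have spanE x : lspan S x -> D x /\ dot (F x u) v = dot (F' x u') v'.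
  apply: (@lspan_min _ _ S [set x | D x /\ dot (F x u) v = dot (F' x u') v'] _ _ x); last first.
    by move=> s Ss; split; [exact/sub_sw_closure/sub_lspan | exact: FS].
  split.
    by split => //; rewrite !(normal_linear0 (D := D)) // !dot0l.
  move=> a y z [Dy hy] [Dz hz]; split; first exact: DP.
  by rewrite (proj1 Fn) // (proj1 Fn') // !dotDl !dotZl hy hz.
move=> x Dx; apply: subr0_eq; apply: nrC_small0 => e e0.
have e2 : 0 < e / 2 by rewrite divr_gt0.
have [y [Sy [h1 h2]]] := Dx _ (filterI (normal_near u v Fn Dx e2) (normal_near u' v' Fn' Dx e2)).
have [Dy hy] := spanE y Sy; have := h1 Dy; have := h2 Dy => l2 l1.
have := nr_sumD (dot (F x u) v) (dot (F y u) v) (dot (F' x u') v').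
by rewrite {2}hy (nrBC (dot (F' y u') v')) => l3; apply: le_trans l3 _; lra.
Qed.

Lemma normal_unique H L H' L' (S : set (bop H L)) (F F' : bop H L -> bop H' L') :
  normal_linear_on (sw_closure (lspan S)) F -> normal_linear_on (sw_closure (lspan S)) F' ->
  (forall s, S s -> F s = F' s) -> forall x, sw_closure (lspan S) x -> F x = F' x.
Proof.
move=> Fn Fn' h x Dx; apply: bop_ext => u; apply: dot_inj => v.
by apply: (normal_dot2 Fn Fn') => // s /h ->.
Qed.

Lemma normal_comp H L H1 L1 H2 L2 (D : set (bop H L)) (D' : set (bop H1 L1))
    (F : bop H L -> bop H1 L1) (F' : bop H1 L1 -> bop H2 L2) :
  normal_linear_on D F -> normal_linear_on D' F' -> (forall x, D x -> D' (F x)) ->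
  normal_linear_on D (F' \o F).
Proof.
move=> [FL Fc] [FL' Fc'] DD; split=> [a x y Dx Dy|]; first by rewrite /= FL // FL' //; exact: DD.
apply/subspace_continuousP => x Dx A nA.
have /subspace_continuousP/(_ (F x) (DD _ Dx)) c' := Fc'.
have /subspace_continuousP/(_ x Dx) c := Fc.
have n1 : nbhs (F x : sigma_weak H1 L1) [set z | D' z -> A (F' z)] := c' A nA.
have n2 : nbhs (x : sigma_weak H L) [set y | D y -> D' (F y) -> A (F' (F y))] := c _ n1.
suff : nbhs (x : sigma_weak H L) [set y | D y -> A (F' (F y))] by [].
by apply: filterS n2 => y /= h Dy; apply: h => //; exact: DD.
Qed.

Lemma normal_mult H L H' L' (D : set (bop H L)) (a : bop H' H) (b : bop L L') :
  normal_linear_on D (fun x => b \ob x \ob a).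
Proof.
split=> [c x y _ _|]; last first.
  apply/subspace_continuousP => x _; apply: cvg_trans (@sw_continuous_comp H L H' L' a b x).
  by apply: cvg_app; exact: cvg_within.
by apply: bop_ext => u; exact: (bop_linear b).
Qed.

Lemma normal_mull H1 H2 H3 (D : set (bop H1 H2)) (b : bop H2 H3) :
  normal_linear_on D (bcomp b : bop H1 H2 -> bop H1 H3).
Proof.
rewrite (_ : bcomp b = fun x => b \ob x \ob bid H1); first exact: normal_mult.
by apply/funext => x; rewrite bcomp1.
Qed.

Lemma normal_mulr H1 H2 H3 (D : set (bop H2 H3)) (a : bop H1 H2) :
  normal_linear_on D ((fun x => x \ob a) : bop H2 H3 -> bop H1 H3).
Proof.
rewrite (_ : (fun x => _) = fun x => bid H3 \ob x \ob a); first exact: normal_mult.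
by apply/funext => x; rewrite bcomp1l.
Qed.

Lemma normal_id H L (D : set (bop H L)) : normal_linear_on D id.
Proof.
by split=> //; apply/subspace_continuousP => x _; exact: cvg_within.
Qed.

Lemma normal_dot H L H' L' (S : set (bop H L)) (F : bop H L -> bop H' L') u v u' v' :
  normal_linear_on (sw_closure (lspan S)) F ->
  (forall s, S s -> dot (F s u) v = dot (s u') v') ->
  forall x, sw_closure (lspan S) x -> dot (F x u) v = dot (x u') v'.
Proof. by move=> Fn; apply: (normal_dot2 Fn (@normal_id _ _ _)). Qed.

(** Only the separate continuity of the product is available, so the closure is taken in y with a
    generator on the left, and then in x. *)
Lemma sw_span_mul H1 H2 H3 (S : set (bop H2 H3)) (S' : set (bop H1 H2)) (P : set (bop H1 H3)) :
  lin_subspace P -> sw_closure P = P -> (forall s s', S s -> S' s' -> P (s \ob s')) ->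
  forall x y, sw_closure (lspan S) x -> sw_closure (lspan S') y -> P (x \ob y).
Proof.
move=> [P0 PP] Pc h.
have h1 s y : S s -> sw_closure (lspan S') y -> P (s \ob y).
  move=> Ss Sy; rewrite -Pc.
  have -> : s \ob y = s \ob y \ob bid H1 by exact: bop_ext.
  apply: (sw_closure_map (@sw_continuous_comp _ _ _ _ (bid H1) s) _ Sy) => z Sz.
  apply: sub_sw_closure; apply: (@lspan_min _ _ _ [set z | P (s \ob z \ob bid H1)] _ _ z Sz).
    split=> [|a p q /= Pp Pq]; first by rewrite /= (_ : _ \ob _ = 0) //; apply: bop_ext => u; exact: (bop0 s).
    rewrite /= (_ : _ \ob _ = a *: (s \ob p \ob bid H1) + (s \ob q \ob bid H1)); first exact: PP.
    by apply: bop_ext => u; exact: (bop_linear s).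
  by move=> s' Ss'; rewrite /= (_ : _ \ob _ = s \ob s'); [exact: h | exact: bop_ext].
move=> x y Sx Sy; rewrite -Pc.
have -> : x \ob y = bid H3 \ob x \ob y by exact: bop_ext.
apply: (sw_closure_map (@sw_continuous_comp _ _ _ _ y (bid H3)) _ Sx) => z Sz.
apply: sub_sw_closure; apply: (@lspan_min _ _ _ [set z | P (bid H3 \ob z \ob y)] _ _ z Sz).
  split=> [|a p q /= Pp Pq]; first by rewrite /= (_ : _ \ob _ = 0) //; exact: bop_ext.
  rewrite /= (_ : _ \ob _ = a *: (bid H3 \ob p \ob y) + (bid H3 \ob q \ob y)); first exact: PP.
  exact: bop_ext.
by move=> s Ss; rewrite /= (_ : _ \ob _ = s \ob y); [exact: h1 | exact: bop_ext].
Qed.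

Lemma adj_subspace H1 H2 (P : set (bop H1 H2)) : lin_subspace P ->
  lin_subspace [set z : bop H2 H1 | P (adj z)].
Proof.
move=> [P0 PP]; split => [|a x y /= Px Py].
  rewrite /= (_ : adj _ = 0) //; apply: adj_unique => u v.
  by rewrite -[LHS]/(dot (0 : H1) v) -[RHS]/(dot u (0 : H2)) dot0l dot0r.
rewrite (_ : adj _ = a^* *: adj x + adj y); first exact: PP.
apply: adj_unique => u v.
by rewrite -[LHS]/(dot (a *: x u + y u) v) dotDl dotZl dotDr dotZr conjCK !adjE.
Qed.

Lemma sw_span_adj H1 H2 (S : set (bop H2 H1)) (P : set (bop H1 H2)) :
  lin_subspace P -> sw_closure P = P -> (forall s, S s -> P (adj s)) ->
  forall x, sw_closure (lspan S) x -> P (adj x).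
Proof.
move=> sP Pc h x Sx; rewrite -Pc.
apply: (sw_closure_map (@sw_continuous_adj _ _) _ Sx) => z Sz; apply: sub_sw_closure.
exact: (lspan_min (adj_subspace sP) h Sz).
Qed.

Lemma sw_closure_dot H L (S : set (bop H L)) u v u' v' :
  (forall s, S s -> dot (s u) v = dot (s u') v') ->
  forall x, sw_closure (lspan S) x -> dot (x u) v = dot (x u') v'.
Proof. by move=> h; apply: (normal_dot (@normal_id _ _ _)). Qed.

End SigmaWeakTheory.

(** * The algebra of a Galois co-object *)

Section HasSum.
Variables (R : realType) (I : choiceType).
Implicit Types f g : I -> R.

(** The supremum of the finite partial sums, which is the unordered sum when f >= 0. *)
Definition has_sum f (l : R) : Prop :=
  (forall A : {fset I}, \sum_(i <- A) f i <= l) /\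
  (forall e : R, 0 < e -> exists A : {fset I}, l - e < \sum_(i <- A) f i).

Lemma has_sum_unique f l l' : has_sum f l -> has_sum f l' -> l = l'.
Proof.
wlog suff : l l' / has_sum f l -> has_sum f l' -> l <= l'.
  by move=> h hl hl'; apply/eqP; rewrite eq_le; apply/andP; split; apply: h.
move=> [_ h] [h' _]; apply/ler_addgt0Pr => e /h[A lt].
by have := h' A; lra.
Qed.

Lemma eq_has_sum f g l : f =1 g -> has_sum f l -> has_sum g l.
Proof. by move=> /funext ->. Qed.

Lemma has_sum_reindex f l (s : I -> I) : involutive s -> has_sum f l -> has_sum (f \o s) l.
Proof.
move=> sK.
have E (h : I -> R) (A : {fset I}) : \sum_(i <- A) (h \o s) i = \sum_(i <- [fset s i | i in A]%fset) h i.
  by rewrite big_imfset //= => x y _ _; exact: (can_inj sK).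
have E' (A : {fset I}) : \sum_(i <- A) f i = \sum_(i <- [fset s i | i in A]%fset) (f \o s) i.
  by rewrite -E; apply: eq_bigr => i _; rewrite /= sK.
move=> [h1 h2]; split=> [A|e /h2[A lt]]; first by rewrite E.
by exists [fset s i | i in A]%fset; rewrite -E'.
Qed.

Lemma fset_sub_le f (A B : {fset I}) : (forall i, 0 <= f i) -> (A `<=` B)%fset ->
  \sum_(i <- A) f i <= \sum_(i <- B) f i.
Proof. by move=> f0 AB; rewrite (fset_sum_split f AB) lerDl sumr_ge0. Qed.

Lemma has_sumD f g l m : (forall i, 0 <= f i) -> (forall i, 0 <= g i) ->
  has_sum f l -> has_sum g m -> has_sum (fun i => f i + g i) (l + m).
Proof.
move=> f0 g0 [f1 f2] [g1 g2]; split=> [A|e e0]; first by rewrite big_split lerD.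
have [A lA] := f2 (e / 2) ltac:(by rewrite divr_gt0).
have [B lB] := g2 (e / 2) ltac:(by rewrite divr_gt0).
exists (A `|` B)%fset; rewrite big_split /=.
have := fset_sub_le f0 (fsubsetUl A B); have := fset_sub_le g0 (fsubsetUr A B); lra.
Qed.

Lemma has_sum0 : has_sum (fun=> 0) 0.
Proof.
by split=> [A|e e0]; [|exists fset0]; rewrite big1 // sub0r oppr_lt0.
Qed.

Lemma has_sum_sum n (f : nat -> I -> R) l : (forall k i, 0 <= f k i) ->
  (forall k, (k < n)%N -> has_sum (f k) (l k)) ->
  has_sum (fun i => \sum_(k < n) f k i) (\sum_(k < n) l k).
Proof.
move=> f0; elim: n => [|n IH] h.
  rewrite big_ord0; apply: eq_has_sum has_sum0 => i; by rewrite big_ord0.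
rewrite big_ord_recr /=; apply: (@eq_has_sum (fun i => \sum_(k < n) f k i + f n i)).
  by move=> i; rewrite big_ord_recr.
apply: has_sumD => //; last exact: h.
  by move=> i; rewrite sumr_ge0.
by apply: IH => k kn; apply: h; rewrite ltnS ltnW.
Qed.
End HasSum.

Section Parseval.
Variables (R : realType) (I : choiceType) (K K2 : hilbertType R) (V : I -> bop K K2).
Local Notation C := (Cplx R).
Hypothesis Vorth : forall g h u v, dot (V g u) (V h v) = (g == h)%:R * dot u v.
Hypothesis Vtotal : total_set [set w | exists g u, w = V g u].

(** The [V g] are isometries with pairwise orthogonal ranges that together are total in K2, and
    [adj (V g) w] is the coordinate of w in the range of [V g]. *)
Lemma parseval w : has_sum (fun g => nr (adj (V g) w) ^+ 2) (nr w ^+ 2).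
Proof.
pose p (A : {fset I}) : K2 := \sum_(g <- A) V g (adj (V g) w).
have porth (A : {fset I}) g u : g \in A -> dot (w - p A) (V g u) = 0.
  move=> gA; rewrite dotBl /p dot_suml (big_fsetD1 g) //= Vorth eqxx mul1r -adjE'.
  rewrite big_seq big1 ?addr0 ?adjK ?subrr // => h; rewrite !inE => /andP[hg _].
  by rewrite Vorth (negbTE hg) mul0r.
have pE A : nr (p A) ^+ 2 = \sum_(g <- A) nr (adj (V g) w) ^+ 2.
  apply: (@complexI R); rewrite -dotE rmorph_sum /= {1}/p dot_suml.
  rewrite big_seq [RHS]big_seq; apply: eq_bigr => g gA.
  have : dot (V g (adj (V g) w)) (w - p A) = 0 by rewrite dotC porth // conjC0.
  by rewrite dotBr => /subr0_eq <-; rewrite -dotE -adjE.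
have wE A : nr w ^+ 2 = nr (w - p A) ^+ 2 + \sum_(g <- A) nr (adj (V g) w) ^+ 2.
  rewrite -pE -nr_pyth ?subrK //.
  by rewrite {2}/p dot_sumr big_seq big1 // => g gA; rewrite porth.
split=> [A|e e0]; first by rewrite (wE A) lerDr exprn_ge0 ?nr_ge0.
have e1 : 0 < Num.sqrt e by rewrite sqrtr_gt0.
have [s [n [a [s' [hs' sE]]]] lt] := total_adherent w (lspan_subspace _) (total_lspan Vtotal) e1.
have /choice[gu hgu] i : exists q : I * K, s' i = V q.1 q.2.
  by have [g [u ->]] := hs' i; exists (g, u).
(* The indices occurring in the finite combination s close to w; p A is the projection of w onto the
   ranges indexed by A, hence at least as close as s. *)
pose A := [fset (gu i).1 | i : 'I_n]%fset.
have gA i : (gu i).1 \in A by apply/imfsetP; exists i.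
exists A; rewrite (wE A) ltrBlDr addrC ltrD2l.
have : nr (w - s) ^+ 2 < e.
  by rewrite -[ltRHS](sqr_sqrtr (ltW e0)) ltr_sqr ?nnegrE ?nr_ge0 ?ltW.
apply: le_lt_trans.
have -> : w - s = (w - p A) + (p A - s) by rewrite addrA subrK.
rewrite [leRHS]nr_pyth ?lerDl ?exprn_ge0 ?nr_ge0 //.
have h1 : dot (w - p A) s = 0.
  by rewrite sE dot_sumr big1 // => i _; rewrite dotZr hgu porth // mulr0.
have h2 : dot (w - p A) (p A) = 0.
  by rewrite {2}/p dot_sumr big_seq big1 // => g; exact: porth.
by rewrite dotBr h1 h2 subrr.
Qed.
End Parseval.

Section GaloisAlgebra.
Variables (R : realType) (K K2 : hilbertType R) (t : {bilinear K -> K -> K2}) (G : groupType).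
Local Notation C := (Cplx R).
Hypothesis tP : is_tensor t.
Variables (D : bop K K2) (rg : G -> bop K K).

(* In the application K = L^2(N), D (x e) = Delta_N(x) (e (x) e) and
   rg g (x e) = x delta_g, where e = delta_1; D^* is then the twisted analogue of
   the pointwise product on l^2(G). *)
Definition mulD (a b : K) : K := adj D (t a b).
Definition lmulD (a : K) : bop K K := adj D \ob tensl tP a.
Definition rmulD (b : K) : bop K K := adj D \ob tensr tP b.

(** The order of the product is reversed in [ga_rgM] because [rg g] comes from right translation, x
    delta_h |-> x delta_(hg). *)
Record galois_algebra : Prop := GaloisAlgebra {
  ga_iso : forall u v, dot (D u) (D v) = dot u v;
  ga_assoc : forall a b c, mulD (mulD a b) c = mulD a (mulD b c);
  ga_rg1 : forall u, rg 1%g u = u;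
  ga_rgM : forall g h u, rg g (rg h u) = rg (h * g)%g u;
  ga_rg_adj : forall g, adj (rg g) = rg (g^-1)%g;
  ga_rg_mul : forall g a b, rg g (mulD a b) = mulD (rg g a) (rg g b);
  ga_orth : forall g u v, g != 1%g -> dot (btens t t (bid K) (rg g) (D u)) (D v) = 0;
  ga_total : total_set [set w | exists g u, w = btens t t (bid K) (rg g) (D u)] }.

Hypothesis ga : galois_algebra.
Local Notation L := lmulD.
Local Notation "a ** b" := (mulD a b) (at level 40, left associativity).

Lemma lmulE a b : L a b = a ** b. Proof. by []. Qed.

Definition galois_iso (g : G) : bop K K2 := btens t t (bid K) (rg g) \ob D.

Lemma dot_galois_iso g w a b : dot (galois_iso g w) (t a b) = dot w (a ** rg (g^-1)%g b).
Proof. by rewrite /= dot_btens // adj_bid (ga_rg_adj ga) -adjE' adjK adjE. Qed.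

Lemma adj_galois_iso g a b : adj (galois_iso g) (t a b) = a ** rg (g^-1)%g b.
Proof.
by apply: dot_inj => w; rewrite adjE' dotC dot_galois_iso -dotC.
Qed.

Lemma galois_iso_orth g h u v : dot (galois_iso g u) (galois_iso h v) = (g == h)%:R * dot u v.
Proof.
(* Moving 1 (x) R_h to the other side leaves an expression in g h^-1 alone, to which [ga_iso] or
   [ga_orth] applies. *)
have -> : dot (galois_iso g u) (galois_iso h v) = dot (galois_iso (g * h^-1)%g u) (D v).
  rewrite -(adjE' (btens t t (bid K) (rg h))) adj_btens // adj_bid (ga_rg_adj ga).
  congr (dot _ _); apply: (tens_ext tP) => a b.
  rewrite !dot_btens // !adj_bid !(ga_rg_adj ga) /= invgK.
  by rewrite (ga_rgM ga) invgM invgK.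
have [->|gh] := eqVneq g h.
  rewrite mulgV mul1r -(ga_iso ga); congr (dot _ _).
  apply: (tens_ext tP) => a b; rewrite dot_btens // adj_bid (ga_rg_adj ga) invg1.
  by rewrite (ga_rg1 ga).
rewrite mul0r (ga_orth ga) //; apply: contra gh => /eqP e.
by apply/eqP; rewrite -[g]mulg1 -(mulVg h) mulgA e mul1g.
Qed.

Lemma galois_iso_total : total_set [set w | exists g u, w = galois_iso g u].
Proof. exact: (ga_total ga). Qed.

Lemma lmul_assoc a b c : L a (b ** c) = L a b ** c.
Proof. by rewrite !lmulE (ga_assoc ga). Qed.

Lemma nr_mulD a b : nr (a ** b) <= nr a * nr b.
Proof.
rewrite -(nr_tens tP) -[leRHS]mul1r; apply: nr_adj_le => // u.
rewrite mul1r -ler_sqr ?nnegrE ?nr_ge0 // -(lecR (nr (D u) ^+ 2)).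
by rewrite -!dotE (ga_iso ga).
Qed.

Lemma dot_mulDr v a b : dot v (a ** b) = dot (D v) (t a b).
Proof. by rewrite adjE. Qed.

Lemma galois_iso1 u : galois_iso 1%g u = D u.
Proof.
by apply: (tens_ext tP) => a b; rewrite dot_galois_iso invg1 (ga_rg1 ga) dot_mulDr.
Qed.

Lemma adj_D_galois_iso g u : adj D (galois_iso g u) = (g == 1%g)%:R *: u.
Proof.
by apply: dot_inj => v; rewrite adjE' dotZl -galois_iso_orth galois_iso1.
Qed.

(* The Frobenius law: L_a^* D^* = D^* (L_a^* (x) 1), which may be tested on the
   vectors (1 (x) R_g) D u. *)
Lemma adj_lmul_mulD a c d : adj (L a) (c ** d) = adj (L a) c ** d.
Proof.
pose T := btens t t (adj (L a)) (bid K).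
have TV g u : T (galois_iso g u) = galois_iso g (adj (L a) u).
  apply: (tens_ext tP) => b e; rewrite dot_btens // adjK adj_bid.
  by rewrite !dot_galois_iso lmulE (ga_assoc ga) adjE'.
apply: dot_inj => e.
suff E w : dot (adj (L a) (adj D w)) e = dot (adj D (T w)) e.
  by rewrite E /T btensE.
rewrite !adjE' [RHS]adjE; apply/eqP; rewrite -subr_eq0 -dotBr; apply/eqP.
suff -> : D (L a e) - adj T (D e) = 0 by rewrite dot0r.
apply: galois_iso_total => _ [g [u ->]].
rewrite dotBr -(adjE' D) adj_D_galois_iso -(adjE T) TV -(adjE' D) adj_D_galois_iso.
by rewrite -(adjE' (L a)) bopZ subrr.
Qed.

(** Parseval for a (x) b, whose coordinate at g is a ** R_(g^-1) b; hence the reindexing by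
    inversion. *)
Lemma sum_nr_mulD a b : has_sum (fun g => nr (a ** rg g b) ^+ 2) (nr a ^+ 2 * nr b ^+ 2).
Proof.
have := has_sum_reindex (@invgK G) (parseval galois_iso_orth galois_iso_total (t a b)).
rewrite (nr_tens tP) exprMn; apply: eq_has_sum => g /=.
by rewrite adj_galois_iso invgK.
Qed.

(** For b = a the previous sum is |a|^4, and all its terms vanish. *)
Lemma mulD_eq0 a : (forall b, a ** b = 0) -> a = 0.
Proof.
move=> h; have hs := sum_nr_mulD a a.
have h0 : has_sum (fun g => nr (a ** rg g a) ^+ 2) 0.
  by apply: eq_has_sum (has_sum0 R G) => g; rewrite h nr0 expr0n.
have := has_sum_unique hs h0; rewrite -exprD => /eqP; rewrite expf_eq0 /=.
by rewrite nr_eq0 => /eqP.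
Qed.
End GaloisAlgebra.

(** * Eigenvectors of positive operators from a norm estimate *)

Section Eigenvector.
Variables (R : realType) (K : hilbertType R).
Local Notation C := (Cplx R).

Lemma bernoulli (x : R) n : 0 <= x <= 1 -> 1 - n%:R * x <= (1 - x) ^+ n.
Proof.
move=> /andP[x0 x1]; elim: n => [|n IH]; first by rewrite mul0r subr0 expr0.
rewrite exprS -natr1.
have : (1 - x) * (1 - n%:R * x) <= (1 - x) * (1 - x) ^+ n by rewrite ler_wpM2l ?subr_ge0.
have : 0 <= n%:R * (x * x) by rewrite !mulr_ge0.
by lra.
Qed.

Lemma dot_iter (P : bop K K) m n u v : adj P = P ->
  dot (iter m P u) (iter n P v) = dot u (iter (m + n) P v).
Proof.
move=> Pa; elim: m n => [|m IH] n //=.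
by rewrite adjE Pa -iterS IH addnS.
Qed.

(** P is self-adjoint of norm 1, so its powers have norm 1 as well, and the estimate keeps |P^n xi|
    away from 0. The vectors P^(2n) xi converge, and their limit is a nonzero fixed vector of
    P^2. *)
Lemma eigenvector_contraction (P : bop K K) (xi : K) (c : R) :
  adj P = P -> (forall v, nr (P v) <= nr v) ->
  (forall x : R, 0 <= x < 1 -> exists v, x * nr v < nr (P v)) ->
  (forall n v, nr (iter n.+1 P v) <= c * nr (iter n P xi) * nr v) ->
  exists2 eta, eta != 0 & P (P eta) = eta.
Proof.
move=> Pa Pc Pn h.
have lb n : 2^-1 <= c * nr (iter n P xi).
  rewrite leNgt; apply/negP => lt.
  (* Chosen so that a vector v with |P v| > (1 - x) |v| has |P^(n+1) v| >= 3/4 |v| by Bernoulli,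
     against the bound |v| / 2 that [lt] would give. *)
  pose x : R := (4 * n.+1%:R)^-1.
  have x0 : 0 < x by rewrite invr_gt0 mulr_gt0.
  have x1 : x <= 1 by rewrite invf_le1 ?mulr_gt0 // -natr1; have := ler0n R n; lra.
  have [v hv] := Pn (1 - x) ltac:(lra).
  have v0 : 0 < nr v.
    by rewrite nr_gt0; apply: contraTneq hv => ->; rewrite bop0 nr0 mulr0 ltxx.
  (* The norms |P^k v| are log-convex: |P^(k+1) v|^2 = <P^k v, P^(k+2) v> by self-adjointness. So
     the first ratio bounds all later ones from below. *)
  have step k : (1 - x) * nr (iter k P v) <= nr (iter k.+1 P v).
    elim: k => [|k IH]; first exact: ltW.
    have [z|z] := eqVneq (iter k P v) 0; first by rewrite !iterS z !bop0 nr0 mulr0.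
    have z0 : 0 < nr (iter k P v) by rewrite nr_gt0.
    rewrite -(ler_pM2l z0); apply: (@le_trans _ _ (nr (iter k.+1 P v) ^+ 2)).
      by rewrite mulrA [_ * (1 - x)]mulrC expr2 ler_wpM2r ?nr_ge0.
    have -> : nr (iter k.+1 P v) ^+ 2 = nr (dot (iter k P v) (iter k.+2 P v)).
      have -> : dot (iter k P v) (iter k.+2 P v) = dot (iter k.+1 P v) (iter k.+1 P v).
        by rewrite /= adjE Pa.
      by rewrite dotE nrR ger0_norm ?exprn_ge0 ?nr_ge0.
    exact: dot_CS.
  have pw k : (1 - x) ^+ k * nr v <= nr (iter k P v).
    elim: k => [|k IH]; first by rewrite expr0 mul1r.
    apply: le_trans (step k); rewrite exprS -mulrA ler_wpM2l // subr_ge0 //.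
  have h1 := pw n.+1; have h2 := h n v.
  have h3 : 1 - n.+1%:R * x <= (1 - x) ^+ n.+1 by apply: bernoulli; rewrite ltW.
  have e1 : n.+1%:R * x = 4^-1 by rewrite /x invfM mulrCA mulfV ?mulr1 ?pnatr_eq0.
  have h4 : 3 / 4 * nr v <= (1 - x) ^+ n.+1 * nr v by rewrite ler_wpM2r ?nr_ge0 //; lra.
  have h5 : c * nr (iter n P xi) * nr v <= 2^-1 * nr v by rewrite ler_wpM2r ?nr_ge0 // ltW.
  by move: (le_trans h1 h2) => h12; move: (le_trans h4 (le_trans h12 h5)); clear -v0; lra.
pose b k := nr (iter k P xi) ^+ 2.
have bS k : b k.+1 <= b k by rewrite /b iterS ler_sqr ?nnegrE ?nr_ge0.
have bmono m n : (m <= n)%N -> b n <= b m.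
  elim: n => [|n IH]; first by rewrite leqn0 => /eqP->.
  by rewrite leq_eqVlt => /predU1P[-> //|/IH]; exact: le_trans (bS n).
(* Even powers only: then <x m, x n> is the value b (m + n) of the decreasing sequence b, which
   makes x Cauchy, whereas an eigenvalue -1 would make the full sequence oscillate. *)
pose x n := iter (n + n) P xi.
have xE m n : nr (x m - x n) ^+ 2 = b (m + m)%N + b (n + n)%N - 2 * b (m + n)%N.
  rewrite nr_sqrD nrN dotNr /x dot_iter // addnA -(addnA m) (addnC m n) addnA -addnA.
  by rewrite -dot_iter // dotE /b addnC /=; ring.
have hinf : has_inf (range b).
  by split; [exists (b 0%N), 0%N | exists 0 => _ [k _ <-]; exact: exprn_ge0 (nr_ge0 _)].
have lbi k : inf (range b) <= b k by apply: ge_inf; [case: hinf | exists k].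
have [|eta heta] := @nr_cauchy R K x.
  move=> e e0; have e1 : 0 < e ^+ 2 / 2 by rewrite divr_gt0 ?exprn_gt0.
  have [_ [N _ <-] lt] := inf_adherent e1 hinf; exists N => m n Nm Nn.
  rewrite -ltr_sqr ?nnegrE ?nr_ge0 ?(ltW e0) // xE.
  have := bmono N _ (leq_trans Nm (leq_addr m m)); have := bmono N _ (leq_trans Nn (leq_addr n n)).
  by have := lbi (m + n)%N; lra.
exists eta.
  apply/eqP => e0; have cn : 0 <= nr (0 : K) by exact: nr_ge0.
  have c0 : 0 < c.
    rewrite ltNge; apply/negP => c0.
    have : c * nr (iter 0 P xi) <= 0 by exact: mulr_le0_ge0 (nr_ge0 _).
    by have := lb 0%N; lra.
  have [|N hN] := heta (2^-1 / c)%R; first by rewrite divr_gt0 ?invr_gt0.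
  have := hN N (leqnn N); rewrite e0 subr0 ltr_pdivlMr // mulrC.
  by rewrite ltNge lb.
apply: subr0_eq; apply: nr_small0 => e e0.
have [N hN] := heta (e / 2) ltac:(by rewrite divr_gt0).
have l1 := hN N (leqnn N); have l2 := hN N.+1 (leqnSn N).
have xS : x N.+1 = P (P (x N)) by rewrite /x addSn addnS.
have l3 : nr (P (P eta) - x N.+1) <= nr (x N - eta).
  by rewrite xS -!bopB nrBC; apply: le_trans (Pc _) (Pc _).
by apply: le_trans (nr_sumD _ (x N.+1) _) _; lra.
Qed.

(** After division by its norm q, [eigenvector_contraction] gives P^2 eta = eta. Positivity excludes
    the eigenvalue -1: w = P eta - eta satisfies P w = - w, so w = 0. *)
Lemma eigenvector (Q : bop K K) (xi : K) (c : R) :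
  adj Q = Q -> (forall v, 0 <= dot (Q v) v) -> Q != 0 ->
  (forall n v, nr (iter n.+1 Q v) <= c * nr (iter n Q xi) * nr v) ->
  exists2 l : R, 0 < l & exists2 eta, eta != 0 & Q eta = (l%:C%C : C) *: eta.
Proof.
move=> Qa Q0 Qn h.
have [M M0 hM] := bop_bound Q.
pose S := [set nr (Q v) | v in [set v : K | nr v <= 1]].
have hsup : has_sup S.
  split; first by exists (nr (Q 0)), 0 => //=; rewrite nr0.
  exists M => _ [v /= v1 <-]; apply: le_trans (hM v) _.
  by rewrite -[leRHS]mulr1 ler_wpM2l // ltW.
pose q := sup S.
have normalize v : v != 0 -> nr (((nr v)^-1%:C%C : C) *: v) = 1.
  by move=> v0; rewrite nrZ nrR ger0_norm ?invr_ge0 ?nr_ge0 // mulVf // nr_eq0.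
have hq v : nr (Q v) <= q * nr v.
  have [->|v0] := eqVneq v 0; first by rewrite bop0 !nr0 mulr0.
  have vp : 0 < nr v by rewrite nr_gt0.
  rewrite mulrC -ler_pdivrMl //.
  have -> : (nr v)^-1 * nr (Q v) = nr (Q (((nr v)^-1%:C%C : C) *: v)).
    by rewrite bopZ nrZ nrR ger0_norm ?invr_ge0 ?nr_ge0.
  by apply: ub_le_sup; [case: hsup | exists (((nr v)^-1%:C%C : C) *: v) => //=; rewrite normalize].
have q0 : 0 < q.
  have [v Qv] : exists v, Q v != 0.
    apply: contrapT => /forallNP hv; move/eqP: Qn; apply; apply: bop_ext => v.
    by apply/eqP/negPn/negP/hv.
  have : 0 < q * nr v by apply: lt_le_trans (hq v); rewrite nr_gt0.
  by rewrite pmulr_lgt0 // nr_gt0; apply: contraNneq Qv => ->; rewrite bop0.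
pose P : bop K K := (q^-1%:C%C : C) *: Q.
have PE v : P v = (q^-1%:C%C : C) *: Q v by [].
have qn : nr (q^-1%:C%C : C) = q^-1 by rewrite nrR ger0_norm ?invr_ge0 ?ltW.
have Pa : adj P = P.
  by apply: adj_unique => u v; rewrite !PE dotZl dotZr conj_real adjE Qa.
have iterP n v : iter n P v = ((q^-1 ^+ n)%:C%C : C) *: iter n Q v.
  elim: n => [|n IH]; first by rewrite expr0 rmorph1 scale1r.
  by rewrite !iterS IH PE bopZ scalerA -rmorphM -exprS.
have [|||eta eta0 etaE] := @eigenvector_contraction P xi (c / q) Pa.
- by move=> v; rewrite PE nrZ qn ler_pdivrMl.
- move=> x /andP[x0 x1].
  have e0 : 0 < q - x * q by rewrite subr_gt0 gtr_pMl.
  have [_ [v v1 <-] lt] := sup_adherent e0 hsup.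
  exists v; rewrite PE nrZ qn ltr_pdivlMl //.
  have lt' : x * q < nr (Q v) by move: lt; rewrite -/q; lra.
  apply: le_lt_trans lt'.
  by rewrite [leRHS]mulrC ler_wpM2l ?(ltW q0) // -[leRHS]mulr1 ler_wpM2l.
- move=> n v; rewrite !iterP !nrZ !nrR !ger0_norm ?exprn_ge0 ?invr_ge0 ?(ltW q0) // exprS.
  have := h n v; rewrite -(@ler_pM2l _ (q^-1 * q^-1 ^+ n)) ?mulr_gt0 ?exprn_gt0 ?invr_gt0 //.
  by move/le_trans; apply; rewrite le_eqVlt; apply/predU1P; left; ring.
exists q => //; exists eta => //.
suff : P eta = eta.
  move=> e; rewrite -[in RHS]e PE scalerA -rmorphM mulfV ?gt_eqF //.
  by rewrite rmorph1 scale1r.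
apply: subr0_eq; set w := P eta - eta.
have Pw : P w = - w by rewrite /w bopB etaE opprB.
have : 0 <= dot (P w) w.
  by rewrite PE dotZl mulr_ge0 // (lecR 0 q^-1) invr_ge0 ltW.
rewrite Pw dotNl dotE oppr_ge0 (lecR _ 0) => le.
by apply/eqP; rewrite -nr_eq0 -sqrf_eq0 eq_le le exprn_ge0 ?nr_ge0.
Qed.
End Eigenvector.

(** Polarisation with the scalars 1 and i. *)
Lemma sesquilinear_eq0 (R : realType) (K : hilbertType R) (W : set K) (f : K -> K -> Cplx R) :
  lin_subspace W ->
  (forall a u v w, f (a *: u + v) w = a * f u w + f v w) ->
  (forall a u v w, f w (a *: u + v) = a^* * f w u + f w v) ->
  (forall u, W u -> f u u = 0) ->
  forall u v, W u -> W v -> f u v = 0.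
Proof.
move=> [W0 WP] fl fr f0.
have E a u v : W u -> W v -> a * f u v + a^* * f v u = 0.
  move=> Wu Wv; have := f0 _ (WP a u v Wu Wv).
  by rewrite fl !fr !f0 // mulr0 add0r addr0.
move=> u v Wu Wv.
have := E 1 u v Wu Wv; rewrite conjC1 !mul1r => /eqP; rewrite addr_eq0 => /eqP e1.
have := E 'i u v Wu Wv; rewrite conjCi e1 mulrN mulNr -opprD -mulr2n => /eqP.
rewrite oppr_eq0 mulrn_eq0 /= mulf_eq0 (negbTE (neq0Ci _)) /= => /eqP ->.
by rewrite oppr0.
Qed.

(** * Homogeneous operators and right module maps *)

Section Structure.
Variables (R : realType) (K K2 : hilbertType R) (t : {bilinear K -> K -> K2}) (G : groupType).
Local Notation C := (Cplx R).
Variables (tP : is_tensor t) (D : bop K K2) (rg : G -> bop K K).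
Hypothesis ga : galois_algebra t D rg.
Local Notation L := (lmulD tP D).
Local Notation rho := (rmulD tP D).
Local Notation "a ** b" := (mulD t D a b) (at level 40, left associativity).

Lemma lmul_linear a u v w : L (a *: u + v) w = a *: L u w + L v w.
Proof. exact: (bop_linear (rho w)). Qed.

Lemma adj_lmul_linear a u v w : adj (L (a *: u + v)) w = a^* *: adj (L u) w + adj (L v) w.
Proof.
apply: dot_inj => z; rewrite dotDl dotZl !adjE' lmul_linear dotDr dotZr.
by rewrite dotC.
Qed.

Lemma adj_lmul_sum m (c : nat -> C) (f : nat -> K) w :
  adj (L (\sum_(i < m) c i *: f i)) w = \sum_(i < m) (c i)^* *: adj (L (f i)) w.
Proof.
elim: m => [|m IH].
  by rewrite !big_ord0; apply: dot_inj => z; rewrite adjE' dot0l -[L 0 z]/(rho z 0) bop0 dot0r.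
by rewrite !big_ord_recr /= addrC adj_lmul_linear IH addrC.
Qed.

Lemma nr_lmul a b : nr (L a b) <= nr a * nr b.
Proof. exact: (nr_mulD tP ga). Qed.

Lemma nr_adj_lmul a b : nr (adj (L a) b) <= nr a * nr b.
Proof. by apply: nr_adj_le; [exact: nr_ge0 | exact: nr_lmul]. Qed.

(* Homogeneity of degree g for the coaction of L(G) on B(K) implemented by D; the
   second condition makes the degrees compatible with adjoints. *)
Definition graded (g : G) (X : bop K K) : Prop :=
  (forall a b, X (a ** b) = X a ** rg g b) /\
  (forall a b, X (adj (rho b) a) = adj (rho (rg g b)) (X a)).

Lemma graded_comp g h X Y : graded g X -> graded h Y -> graded (h * g)%g (X \ob Y).
Proof.
move=> [X1 X2] [Y1 Y2]; split=> a b /=; first by rewrite Y1 X1 (ga_rgM ga).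
by rewrite Y2 X2 (ga_rgM ga).
Qed.

Lemma graded_adj g X : graded g X -> graded g^-1%g (adj X).
Proof.
move=> [X1 X2].
have gK b : rg g (rg g^-1%g b) = b by rewrite (ga_rgM ga) mulVg (ga_rg1 ga).
split=> a b; apply: dot_inj => c.
  rewrite adjE' -[a ** b]/(rho b a) adjE -{1}[b]gK -X2 -adjE'.
  by rewrite -[_ ** _]/(rho (rg g^-1%g b) (adj X a)) [RHS]adjE.
by rewrite !adjE' -[rho b (X c)]/(X c ** b) -{1}[b]gK -X1.
Qed.

Lemma graded_rg g : graded g (rg g).
Proof.
split=> a b; first exact: (ga_rg_mul ga).
apply: dot_inj => c; rewrite adjE (ga_rg_adj ga) !adjE'.
rewrite -[rho b _]/(_ ** b) -[rho _ c]/(c ** _).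
have -> : rg g^-1%g c ** b = rg g^-1%g (c ** rg g b).
  by rewrite (ga_rg_mul ga) (ga_rgM ga) mulgV (ga_rg1 ga).
by rewrite -(ga_rg_adj ga) -adjE.
Qed.

(** The first condition is associativity, the second is the adjoint form of the Frobenius law. *)
Lemma graded_lmul a : graded 1%g (L a).
Proof.
split=> b c; rewrite (ga_rg1 ga); first exact: (lmul_assoc tP ga).
apply: dot_inj => d; rewrite adjE !(adjE' (rho c)).
rewrite -[rho c (adj _ _)]/(_ ** c) -[rho c d]/(d ** c).
by rewrite -(adj_lmul_mulD tP ga) -adjE.
Qed.

Lemma graded_bid : graded 1%g (bid K).
Proof. by split=> a b; rewrite (ga_rg1 ga). Qed.

Lemma gradedP g a X Y : graded g X -> graded g Y -> graded g (a *: X + Y).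
Proof.
move=> [X1 X2] [Y1 Y2].
have E u : (a *: X + Y) u = a *: X u + Y u by [].
split=> b c; rewrite !E ?X1 ?Y1 ?X2 ?Y2; last by rewrite bop_linear.
exact/esym/(bop_linear (rho (rg g c))).
Qed.

Lemma gradedZ g a X : graded g X -> graded g (a *: X).
Proof.
move=> [X1 X2]; have E u : (a *: X) u = a *: X u by [].
split=> b c; rewrite !E ?X1 ?X2 ?bopZ //.
exact/esym/(bopZ (rho (rg g c))).
Qed.

Lemma graded_lmulE g X a b : graded g X -> X (L a b) = L (X a) (rg g b).
Proof. by move=> [X1 _]; exact: X1. Qed.

Lemma graded1_lmulE X a b : graded 1%g X -> X (L a b) = L (X a) b.
Proof. by move=> hX; rewrite (graded_lmulE _ _ hX) (ga_rg1 ga). Qed.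

(** The adjoint of L (X a) = X L a, which holds because X commutes with right multiplications. *)
Lemma adj_lmul_graded1 X a b : graded 1%g X -> adj X = X -> adj (L (X a)) b = adj (L a) (X b).
Proof.
move=> hX Xa; apply: dot_inj => c.
by rewrite !(adjE' (L _)) -(graded1_lmulE _ _ hX) [RHS](adjE X) Xa.
Qed.

(** Degree 1 means that the range of r reduces every right multiplication: it is stable under it and
    under its adjoint. *)
Definition redproj (r : bop K K) : Prop :=
  [/\ adj r = r, forall u, r (r u) = r u & graded 1%g r].

(** Right multiplications and their adjoints commute with X, so they preserve its eigenspaces and
    commute with the projections onto them. *)
Lemma eigenprojection X (l : C) : graded 1%g X -> adj X = X -> l^* = l -> exists r, [/\ redproj r,
  forall u, X (r u) = l *: r u & forall u, X u = l *: u -> r u = u].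
Proof.
move=> [X1 X2] Xa lr; pose S := [set u | X u = l *: u].
have sS : lin_subspace S.
  split; first by rewrite /S /= bop0 scaler0.
  move=> a u v; rewrite /S /= => hu hv.
  by rewrite bop_linear hu hv scalerDr !scalerA mulrC.
have [M M0 hM] := bop_bound (X - l *: bid K).
have XE u : (X - l *: bid K) u = X u - l *: u by [].
have cS u : adherent S u -> S u.
  move=> hu; apply: subr0_eq; rewrite -XE; apply: nr_small0 => e e0.
  have [v Sv lt] := hu (e / M) ltac:(by rewrite divr_gt0).
  have -> : (X - l *: bid K) u = (X - l *: bid K) (u - v).
    by rewrite bopB (XE v) (Sv : X v = _) subrr subr0.
  by apply: le_trans (hM _) _; rewrite mulrC -ler_pdivlMr // ltW.
have [r [rS rid ra]] := proj_ex sS cS.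
have rr u : r (r u) = r u by apply: rid; exact: rS.
have comm (Y : bop K K) : (forall u, S u -> S (Y u)) -> (forall u, S u -> S (adj Y u)) ->
    forall u, r (Y u) = Y (r u).
  move=> Y1 Y2 u; rewrite -{1}[u](subrK (r u)) bopD bopD [r (Y (r u))]rid; last exact/Y1/rS.
  rewrite [r (Y _)](_ : _ = 0) ?add0r //; apply: dot_inj => c.
  rewrite dot0l adjE ra adjE -(rid (adj Y (r c))); last exact/Y2/rS.
  by rewrite -(adjE' r) ra bopB rr subrr dot0l.
have S1 b u : S u -> S (rho b u).
  rewrite /S /= => hu; rewrite -[adj D _]/(u ** b) X1 (ga_rg1 ga) hu.
  exact: (bopZ (rho b)).
have S2 b u : S u -> S (adj (rho b) u).
  by rewrite /S /= => hu; rewrite X2 (ga_rg1 ga) hu bopZ.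
exists r; split=> //.
split=> //; split=> a b; rewrite (ga_rg1 ga).
  by apply: (comm (rho b)) => u; [exact: S1 | exact: S2].
by apply: (comm (adj (rho b))) => u; [exact: S2 | rewrite adjK; exact: S1].
Qed.
End Structure.

(** * Minimal projections in the algebra of right module maps *)

Section Minimal.
Variables (R : realType) (K K2 : hilbertType R) (t : {bilinear K -> K -> K2}) (G : groupType).
Local Notation C := (Cplx R).
Variables (tP : is_tensor t) (D : bop K K2) (rg : G -> bop K K).
Hypothesis ga : galois_algebra t D rg.
Local Notation L := (lmulD tP D).
Local Notation "a ** b" := (mulD t D a b) (at level 40, left associativity).
Local Notation graded := (graded tP D rg).
Local Notation redproj := (redproj tP D rg).

Definition lmul_gram (a : K) : bop K K := L a \ob adj (L a).

Lemma graded_gram a : graded 1%g (lmul_gram a).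
Proof.
have e : (1 : G)%g = (1^-1 * 1)%g by rewrite invg1 mulg1.
by rewrite e; apply: (graded_comp ga); [|apply: (graded_adj ga)]; exact: graded_lmul.
Qed.

Lemma adj_gram a : adj (lmul_gram a) = lmul_gram a.
Proof. by rewrite /lmul_gram adj_comp adjK. Qed.

Lemma dot_gram a u : dot (lmul_gram a u) u = (nr (adj (L a) u) ^+ 2)%:C%C.
Proof. by rewrite -[lmul_gram a u]/(L a (adj (L a) u)) adjE dotE. Qed.

Lemma gram_ge0 a u : 0 <= dot (lmul_gram a u) u.
Proof. by rewrite dot_gram (lecR 0) exprn_ge0 ?nr_ge0. Qed.

Lemma gram_eq0 a : lmul_gram a = 0 -> a = 0.
Proof.
move=> h; apply: (mulD_eq0 tP ga) => b.
have La u : adj (L a) u = 0.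
  have := dot_gram a u; rewrite h dot0l => /esym/eqP.
  rewrite -(rmorph0 (real_complex R)) (inj_eq (@complexI R)) sqrf_eq0 nr_eq0.
  by move/eqP.
by apply: dot_inj => c; rewrite -[a ** b]/(L a b) adjE La dot0r dot0l.
Qed.

Lemma graded1_iter X n : graded 1%g X -> graded 1%g (iter n (bcomp X) (bid K)).
Proof.
move=> hX; elim: n => [|n IH] /=; first exact: graded_bid.
by rewrite -(mulg1 1%g); exact: graded_comp.
Qed.

Lemma iter_bcomp (X : bop K K) n u : iter n (bcomp X) (bid K) u = iter n X u.
Proof. by elim: n => //= n ->. Qed.

Lemma iter_graded1_lmul X n a b : graded 1%g X -> iter n X (L a b) = L (iter n X a) b.
Proof. by move=> hX; rewrite -!iter_bcomp (graded1_lmulE ga) //; exact: graded1_iter. Qed.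

Lemma redproj_sub r r' : redproj r -> redproj r' -> (forall u, r (r' u) = r' u) ->
  redproj (r - r') /\ (forall u, r' (r u) = r' u).
Proof.
move=> [ra rr rh] [ra' rr' rh'] le.
have le' u : r' (r u) = r' u.
  by apply: dot_inj => c; rewrite adjE ra' adjE ra le -{1}ra' -adjE.
split=> //; have E u : (r - r') u = r u - r' u by [].
split.
- by apply: adj_unique => u v; rewrite !E dotBl dotBr !adjE ra ra'.
- by move=> u; rewrite !E !bopB rr le le' rr' subrr subr0.
- by rewrite addrC -scaleN1r; apply: gradedP.
Qed.

Definition minimal_projection r : Prop :=
  [/\ redproj r, r != 0
    & forall r', redproj r' -> (forall u, r (r' u) = r' u) -> r' = 0 \/ r' = r].

Lemma bop_neq0 (X : bop K K) : X != 0 -> exists u, X u != 0.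
Proof.
move=> X0; apply: contrapT => /forallNP h; move/eqP: X0; apply; apply: bop_ext => u.
by apply/eqP/negPn/negP/h.
Qed.

Lemma minimal_projection_ex (xi0 : K) : xi0 != 0 ->
  exists r (l : R) xi, [/\ minimal_projection r, 0 < l, r xi = xi
    & forall u, lmul_gram xi u = (l%:C%C : C) *: r u].
Proof.
move=> xi00.
have [l l0 [eta eta0 Seta]] : exists2 l : R, 0 < l & exists2 eta, eta != 0 &
    lmul_gram xi0 eta = (l%:C%C : C) *: eta.
  apply: (@eigenvector _ _ _ xi0 (nr xi0)).
  - exact: adj_gram.
  - exact: gram_ge0.
  - by apply: contra xi00 => /eqP/gram_eq0 ->.
  (* With S = [lmul_gram xi0], S^(n+1) v = S^n L_xi0 (L_xi0^* v) = L_(S^n xi0) (L_xi0^* v), and both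
     L and its adjoint are bounded by the norm of their index. *)
  move=> n v; rewrite iterSr -[lmul_gram xi0 v]/(L xi0 (adj (L xi0) v)).
  rewrite (iter_graded1_lmul _ _ _ (graded_gram xi0)). apply: le_trans (nr_lmul tP ga _ _) _.
  by rewrite [nr xi0 * _]mulrC -mulrA ler_wpM2l ?nr_ge0 // (nr_adj_lmul tP ga).
have [r0 [rp0 r0S Sr0]] := eigenprojection ga (graded_gram xi0) (adj_gram xi0) (conj_real l).
(* For r below r0, L_(r xi0) L_(r xi0)^* = r S r = l r, since S is l on the range of r0. *)
have below r : redproj r -> (forall u, r0 (r u) = r u) ->
    forall u, lmul_gram (r xi0) u = (l%:C%C : C) *: r u.
  move=> rp le u; have [ra rr rh] := rp.
  have [_ le'] := redproj_sub rp0 rp le.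
  rewrite -[lmul_gram (r xi0) u]/(L (r xi0) (adj (L (r xi0)) u)).
  rewrite -(graded1_lmulE ga) // (adj_lmul_graded1 ga) //.
  by rewrite -[L xi0 _]/(lmul_gram xi0 (r u)) -(le u) r0S bopZ le rr.
(* Norms in [below]: the operator on the left is bounded by |r xi0|^2, and l r has norm l. *)
have lb r : redproj r -> (forall u, r0 (r u) = r u) -> r != 0 -> l <= nr (r xi0) ^+ 2.
  move=> rp le /bop_neq0[u ru]; have [ra rr rh] := rp.
  have := below r rp le (r u); rewrite rr => e.
  have : nr (lmul_gram (r xi0) (r u)) <= nr (r xi0) * (nr (r xi0) * nr (r u)).
    apply: le_trans (nr_lmul tP ga _ _) _.
    by rewrite ler_wpM2l ?nr_ge0 // (nr_adj_lmul tP ga).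
  rewrite e nrZ nrR gtr0_norm // mulrA ler_pM2r ?nr_gt0 // -expr2 //.
(* Descent: if r is not minimal, split off some r1 below it. By Pythagoras |r xi0|^2 is shared
   between r1 and r - r1, and r1 takes at least l of it, so the bound for r - r1 has one l less. *)
have main n r : redproj r -> (forall u, r0 (r u) = r u) -> r != 0 ->
    nr (r xi0) ^+ 2 < n.+1%:R * l ->
    exists2 r' : bop K K, (forall u, r0 (r' u) = r' u) & minimal_projection r'.
  elim: n r => [|n IH] r rp le rn lt.
    by have := lb r rp le rn; move: lt; rewrite mul1r; lra.
  have [mr|] := pselect (minimal_projection r); first by exists r.
  move=> nm; have /existsNP[r1] : ~ forall r' : bop K K,
      redproj r' -> (forall u, r (r' u) = r' u) -> r' = 0 \/ r' = r.
    by move=> h; apply: nm; split.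
  move=> /not_implyP[rp1 /not_implyP[le1 /not_orP[n1 n2]]].
  have [rp2 le1'] := redproj_sub rp rp1 le1.
  have le1'' u : r0 (r1 u) = r1 u by rewrite -le1 le.
  pose r2 : bop K K := r - r1; have r2E u : r2 u = r u - r1 u by [].
  apply: (IH r2) => //.
  - by move=> u; rewrite r2E bopB le le1''.
  - by rewrite subr_eq0 eq_sym; apply/eqP.
  have := lb r1 rp1 le1'' (introN eqP n1).
  have o : dot (r2 xi0) (r1 xi0) = 0.
    have [ra1 rr1 _] := rp1.
    by rewrite -ra1 -adjE r2E bopB le1' rr1 subrr dot0l.
  have := nr_pyth o; rewrite r2E subrK => e.
  by move: lt; rewrite e -(natr1 n.+1); lra.
have r00 : r0 != 0.
  by apply: contra eta0 => /eqP z; rewrite -(Sr0 _ Seta) z.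
have [n lt] : exists n, nr (r0 xi0) ^+ 2 < n.+1%:R * l.
  exists (Num.truncn (nr (r0 xi0) ^+ 2 / l)); rewrite -ltr_pdivrMr //.
  exact: Num.Theory.truncnS_gt.
have [|r le [rp rn rm]] := main n r0 rp0 _ r00 lt; first by case: rp0.
exists r, l, (r xi0); split => //; first by case: rp.
exact: below.
Qed.

Section Scalars.
Variables (r : bop K K) (l : R) (xi : K).
Hypotheses (rm : minimal_projection r) (l0 : 0 < l).
Hypothesis gramE : forall u, lmul_gram xi u = (l%:C%C : C) *: r u.

(** As B = B r and r = l^-1 L_xi L_xi^*, the powers of B obey the norm estimate with starting vector
    B xi, so B has an eigenvector with positive eigenvalue. Its eigenprojection lies below r, hence
    equals r. *)
Lemma scalar_of_graded1 B : graded 1%g B -> adj B = B -> (forall v, 0 <= dot (B v) v) ->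
  (forall u, r (B u) = B u) -> (forall u, B (r u) = B u) ->
  exists s : R, forall u, B u = (s%:C%C : C) *: r u.
Proof.
move=> hB Ba B0 rB Br; have [rp rn rmin] := rm.
have [->|Bn] := eqVneq B 0; first by exists 0 => u; rewrite rmorph0 scale0r.
have [|s s0 [eta eta0 etaE]] := @eigenvector _ _ B (B xi) (l^-1 * nr xi) Ba B0 Bn.
  move=> n v; rewrite iterSr -Br.
  have -> : r v = (l^-1%:C%C : C) *: L xi (adj (L xi) v).
    rewrite -[L xi _]/(lmul_gram xi v) gramE scalerA -rmorphM mulVf ?gt_eqF //.
    by rewrite rmorph1 scale1r.
  rewrite -iterSr -iter_bcomp bopZ iter_bcomp nrZ nrR ger0_norm ?invr_ge0 ?(ltW l0) //.
  rewrite (iter_graded1_lmul _ _ _ hB) iterSr -!mulrA ler_wpM2l ?invr_ge0 ?(ltW l0) //.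
  apply: le_trans (nr_lmul tP ga _ _) _.
  by rewrite mulrCA ler_wpM2l ?nr_ge0 // (nr_adj_lmul tP ga).
have [e [ep eB Be]] := eigenprojection ga hB Ba (conj_real s).
have sn : (s%:C%C : C) != 0 by rewrite -(rmorph0 (real_complex R)) (inj_eq (@complexI R)) gt_eqF.
have re u : r (e u) = e u.
  have eE : e u = (s%:C%C : C)^-1 *: B (e u) by rewrite eB scalerA mulVf // scale1r.
  by rewrite [in LHS]eE bopZ rB -eE.
have [e0|er] := rmin e ep re.
  by move: eta0; rewrite -(Be _ etaE) e0 eqxx.
by exists s => u; rewrite -Br -er eB.
Qed.
End Scalars.
End Minimal.

(** * The graded corner of a minimal projection is a finite matrix algebra *)

Section Corner.
Variables (R : realType) (K K2 : hilbertType R) (t : {bilinear K -> K -> K2}) (G : groupType).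
Local Notation C := (Cplx R).
Variables (tP : is_tensor t) (D : bop K K2) (rg : G -> bop K K).
Hypothesis ga : galois_algebra t D rg.
Local Notation L := (lmulD tP D).
Local Notation "a ** b" := (mulD t D a b) (at level 40, left associativity).
Local Notation graded := (graded tP D rg).
Variables (r : bop K K) (l : R) (xi : K).
Hypotheses (rm : minimal_projection tP D rg r) (l0 : 0 < l) (rxi : r xi = xi).
Hypothesis gramE : forall u, lmul_gram tP D xi u = (l%:C%C : C) *: r u.

Let rp : redproj tP D rg r. Proof. by case: rm. Qed.
Let ra : adj r = r. Proof. by case: rp. Qed.
Let rr u : r (r u) = r u. Proof. by case: rp => _ ->. Qed.
Let rh : graded 1%g r. Proof. by case: rp. Qed.

Definition corner (X : bop K K) : Prop :=
  (forall u, r (X u) = X u) /\ (forall u, X (r u) = X u).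

Lemma corner_adj X : corner X -> corner (adj X).
Proof.
move=> [X1 X2]; split=> u; apply: dot_inj => c.
  by rewrite adjE ra !adjE' X2.
by rewrite !adjE' adjE ra X1.
Qed.

Lemma corner_comp X Y : corner X -> corner Y -> corner (X \ob Y).
Proof. by move=> [X1 _] [_ Y2]; split=> u /=; rewrite ?X1 ?Y2. Qed.

Lemma unit_vector : exists v, r v = v /\ nr v = 1.
Proof.
case: rm => _ /bop_neq0[u ru] _.
exists (((nr (r u))^-1%:C%C : C) *: r u); split; first by rewrite bopZ rr.
by rewrite nrZ nrR ger0_norm ?invr_ge0 ?nr_ge0 // mulVf // nr_eq0.
Qed.

Lemma scalar_eq (s s' : R) (v : K) : v != 0 ->
  (s%:C%C : C) *: v = (s'%:C%C : C) *: v -> s = s'.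
Proof.
move=> v0 /eqP; rewrite -subr_eq0 -scalerBl scaler_eq0 (negbTE v0) orbF subr_eq0.
by move=> /eqP/complexI.
Qed.

Lemma corner_scalar X : graded 1%g X -> adj X = X -> corner X ->
  (forall v, 0 <= dot (X v) v) -> exists s : R, forall u, X u = (s%:C%C : C) *: r u.
Proof. by move=> hX Xa [X1 X2] X0; exact: (scalar_of_graded1 ga rm l0 gramE). Qed.

Lemma corner_adj_comp g X : graded g X -> corner X ->
  exists s : R, forall u, adj X (X u) = (s%:C%C : C) *: r u.
Proof.
move=> gX cX.
have gXX : graded 1%g (adj X \ob X).
  have -> : (1 : G)%g = (g * g^-1)%g by rewrite mulgV.
  by apply: (graded_comp ga) => //; exact: (graded_adj ga).
have cXX : corner (adj X \ob X) by apply: corner_comp => //; exact: corner_adj.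
apply: (corner_scalar gXX _ cXX); first by rewrite adj_comp adjK.
by move=> v; rewrite dot_adj_comp (lecR 0) exprn_ge0 ?nr_ge0.
Qed.

(** X^* X and X X^* are positive of degree 1 in the corner, hence multiples s r and s' r. If s <> 0,
    the two ways of computing X X^* X v give s = s'; if s = 0, then X = 0. *)
Lemma corner_homogeneous g X : graded g X -> corner X ->
  exists s : R, (forall u, adj X (X u) = (s%:C%C : C) *: r u) /\
                (forall u, X (adj X u) = (s%:C%C : C) *: r u).
Proof.
move=> gX cX; have [s sE] := corner_adj_comp gX cX.
have [s'] := corner_adj_comp (graded_adj ga gX) (corner_adj cX); rewrite adjK => s'E.
exists s; split=> // u; rewrite s'E; congr (_ *: _); congr (_%:C%C).
have [v [rv nv]] := unit_vector.
have v0 : v != 0 by rewrite -nr_gt0 nv.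
have [s0|s0] := eqVneq s 0.
  have X0 w : X w = 0.
    have := dot_adj_comp X w; rewrite sE s0 rmorph0 scale0r dot0l => /esym/eqP.
    rewrite -(rmorph0 (real_complex R)) (inj_eq (@complexI R)) sqrf_eq0 nr_eq0.
    by move/eqP.
  by apply: (@scalar_eq _ _ v v0); rewrite -{1}rv -s'E X0 s0 rmorph0 scale0r.
have Xv : X v != 0.
  apply: contra v0 => /eqP Xv; have := sE v; rewrite Xv bop0 rv => /esym/eqP.
  rewrite scaler_eq0 -(rmorph0 (real_complex R)) (inj_eq (@complexI R)) (negbTE s0) //.
apply: (scalar_eq Xv).
case: cX => c1 c2; have <- : X (adj X (X v)) = (s%:C%C : C) *: X v by rewrite sE bopZ c2.
by rewrite s'E c1.
Qed.

Lemma corner_lmul a : r a = a -> (forall u, r (L a u) = L a u) /\ (forall u, adj (L a) (r u) = adj (L a) u).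
Proof.
move=> rea; split=> u; first by rewrite (graded1_lmulE ga) // rea.
by rewrite -(adj_lmul_graded1 ga) // rea.
Qed.

(** For a and b in the range of r, the component of degree g of the rank-one operator u |-> <u, b>
    a, as [matrix_op_support] and [dim_weight] show. *)
Definition matrix_op (g : G) (a b : K) : bop K K := L a \ob rg g \ob adj (L b).

Lemma graded_matrix_op g a b : graded g (matrix_op g a b).
Proof.
have e : g = ((1^-1 * (g * 1)))%g by rewrite invg1 mul1g mulg1.
rewrite {1}e; apply: (graded_comp ga); last by apply: (graded_adj ga); exact: graded_lmul.
by apply: (graded_comp ga); [exact: graded_lmul | exact: (graded_rg tP ga)].
Qed.

Lemma corner_matrix_op g a b : r a = a -> r b = b -> corner (matrix_op g a b).
Proof.
move=> /corner_lmul[h1 _] /corner_lmul[_ h2]; split=> u; rewrite /matrix_op /= ?h2 //.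
by rewrite -[adj D _]/(L a _) h1.
Qed.

Lemma adj_matrix_op g a b : adj (matrix_op g a b) = matrix_op g^-1%g b a.
Proof.
apply: adj_unique => u v.
rewrite -[matrix_op g a b u]/(L a (rg g (adj (L b) u))) adjE adjE (ga_rg_adj ga).
by rewrite adjE'.
Qed.

Section Trace.
Variables (v0 : K).
Hypotheses (rv0 : r v0 = v0) (nv0 : nr v0 = 1).

(** The value on the rank-one operator of a, for a in the range of r, of the state given by the
    degree 1 part: the scalar s in L_a L_a^* = s r. *)
Definition weight (a : K) : R := nr (adj (L a) v0) ^+ 2.

Lemma gram_weight a : r a = a -> forall u, lmul_gram tP D a u = ((weight a)%:C%C : C) *: r u.
Proof.
move=> rea.
have [s sE] : exists s : R, forall u, lmul_gram tP D a u = (s%:C%C : C) *: r u.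
  apply: corner_scalar; [exact: graded_gram ga _|exact: adj_gram| |exact: gram_ge0].
  have [h1 h2] := corner_lmul rea.
  by split=> u; [exact: h1 | rewrite -[LHS]/(L a (adj (L a) (r u))) h2].
move=> u; rewrite sE; congr (_%:C%C *: _); apply: (@complexI R).
by rewrite /weight -(dot_gram tP D a v0) sE rv0 dotZl dotE nv0 expr1n mulr1.
Qed.

Lemma nr_matrix_op_adj g a b : r a = a -> r b = b ->
  nr (matrix_op g a b v0) = nr (matrix_op g^-1%g b a v0).
Proof.
move=> rea reb.
have [s [s1 s2]] := corner_homogeneous (graded_matrix_op g a b) (corner_matrix_op g rea reb).
have e1 := dot_adj_comp (matrix_op g a b) v0.
have e2 := dot_adj_comp (adj (matrix_op g a b)) v0.
rewrite s1 rv0 in e1; rewrite adjK s2 rv0 e1 adj_matrix_op in e2.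
apply/eqP; rewrite -(@eqrXn2 _ 2) ?nr_ge0 //; apply/eqP.
exact: (@complexI R).
Qed.

Lemma sum_nr_matrix_op a b :
  has_sum (fun g => nr (matrix_op g a b v0) ^+ 2) (nr a ^+ 2 * weight b).
Proof. exact: (sum_nr_mulD tP ga a (adj (L b) v0)). Qed.

(* The grading makes the state a |-> weight a of the matrix algebra tracial:
   X^* X = X X^* for homogeneous X. *)
Lemma weight_sym a b : r a = a -> r b = b -> nr a ^+ 2 * weight b = nr b ^+ 2 * weight a.
Proof.
move=> rea reb; apply: (has_sum_unique (sum_nr_matrix_op a b)).
have := has_sum_reindex (@invgK G) (sum_nr_matrix_op b a).
by apply: eq_has_sum => g /=; rewrite -nr_matrix_op_adj.
Qed.

Let k : R := weight v0.

(** Symmetry against the unit vector v0: a tracial functional is a multiple of the usual trace, and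
    k is the factor. *)
Lemma weightE a : r a = a -> weight a = k * nr a ^+ 2.
Proof. by move=> rea; have := weight_sym rv0 rea; rewrite nv0 expr1n mul1r mulrC. Qed.

Lemma weight_unit_gt0 : 0 < k.
Proof.
have wxi : weight xi = l.
  apply: (@scalar_eq _ _ v0); first by rewrite -nr_gt0 nv0.
  by rewrite -{1}rv0 -(gram_weight rxi) gramE rv0.
rewrite lt_neqAle exprn_ge0 ?nr_ge0 // andbT; apply/eqP => k0.
by have := weightE rxi; rewrite wxi -k0 mul0r => e; move: l0; rewrite e ltxx.
Qed.

Lemma corner_subspace : lin_subspace [set a | r a = a].
Proof. by split=> [|a u v /= hu hv]; rewrite /= ?bop0 // bop_linear hu hv. Qed.

(** Polarisation of [gram_weight], with [weightE] for the diagonal values. *)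
Lemma lmul_adj_lmul a b u : r a = a -> r b = b ->
  L a (adj (L b) u) = ((k%:C%C : C) * dot a b) *: r u.
Proof.
move=> rea reb; apply: subr0_eq; apply: dot_inj => w; rewrite dot0l.
pose f a b := dot (L a (adj (L b) u) - ((k%:C%C : C) * dot a b) *: r u) w.
apply: (@sesquilinear_eq0 _ _ [set a | r a = a] f) => //; first exact: corner_subspace.
- move=> c a1 a2 b1; rewrite /f lmul_linear !dotBl !dotDl !dotZl; ring.
- move=> c a1 a2 b1; rewrite /f adj_lmul_linear bop_linear !dotBl !dotDl !dotZl dotDr dotZr; ring.
move=> a1 ra1; rewrite /f -[L a1 _]/(lmul_gram tP D a1 u) gram_weight // weightE //.
by rewrite dotE rmorphM subrr dot0l.
Qed.

(* Cauchy-Schwarz for <D v0, sum_i f_i (x) L_{f_i}^* v0> = sum_i |L_{f_i}^* v0|^2 = m k *)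
Lemma orthonormal_weight m f : orthonormal_upto m f -> (forall i, (i < m)%N -> r (f i) = f i) ->
  m%:R * k <= 1.
Proof.
move=> of_ rf; pose U i := adj (L (f i)) v0.
have S : \sum_(i < m) nr (U i) ^+ 2 = m%:R * k.
  rewrite (eq_bigr (fun=> k)) ?sumr_const ?card_ord ?mulr_natl // => i _.
  rewrite -[LHS]/(weight (f i)) weightE ?rf //.
  have -> : nr (f i) ^+ 2 = 1 by apply: (@complexI R); rewrite -dotE of_ // eqxx.
  by rewrite mulr1.
set w := \sum_(i < m) t (f i) (U i).
have nw : nr w ^+ 2 = m%:R * k by rewrite (nr_sum_orthl tP U of_) S.
have e : dot (D v0) w = (m%:R * k)%:C%C.
  rewrite /w dot_sumr -S rmorph_sum; apply: eq_bigr => i _ /=.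
  rewrite -(dot_mulDr _ _ v0) -[f i ** _]/(L (f i) (U i)) -(adjE' (L (f i))) //.
  exact: dotE.
have nD : nr (D v0) = 1.
  apply/eqP; rewrite -(@eqrXn2 _ 2) ?nr_ge0 // expr1n; apply/eqP/(@complexI R).
  by rewrite -dotE (ga_iso ga) dotE nv0 expr1n.
have := dot_CS (D v0) w; rewrite e nrR nD mul1r -nw ger0_norm ?exprn_ge0 ?nr_ge0 //.
have := nr_ge0 w; rewrite expr2 => w0; have [->|wn] := eqVneq (nr w) 0; first by rewrite mulr0.
have wp : 0 < nr w by rewrite lt_neqAle eq_sym wn.
by rewrite ger_pMr // => w1; rewrite mulr_ile1.
Qed.

(** By [orthonormal_weight] an orthonormal family in the range of r has at most 1 / k terms. One
    that cannot be lengthened spans. *)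
Lemma corner_basis : exists n f, [/\ orthonormal_upto n f, forall i, (i < n)%N -> r (f i) = f i
  & forall v, r v = v -> expand n f v = v].
Proof.
pose P m := exists2 f, orthonormal_upto m f & forall i, (i < m)%N -> r (f i) = f i.
have [m Pm mm] : exists2 m, P m & ~ P m.+1.
  apply: contrapT => h.
  have Pn n : P n.
    elim: n => [|n IH]; first by exists (fun=> 0).
    by apply: contrapT => h'; apply: h; exists n.
  have [f of_ rf] := Pn (Num.truncn k^-1).+1.
  have := orthonormal_weight of_ rf; rewrite leNgt => /negP; apply.
  rewrite -ltr_pdivrMr ?weight_unit_gt0 // div1r.
  exact: Num.Theory.truncnS_gt.
case: Pm => f of_ rf; exists m, f; split=> // v rv.
apply/esym/subr0_eq; set d := v - _.
have [//|d0] := eqVneq d 0; exfalso; apply: mm.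
have df i : (i < m)%N -> dot d (f i) = 0 by move=> im; rewrite dotBl dot_expand // subrr.
exists (fun i => if (i < m)%N then f i else ((nr d)^-1%:C%C : C) *: d).
  exact: orthonormal_extend.
have re : r (expand m f v) = expand m f v.
  by rewrite /expand bop_sum; apply: eq_bigr => i _; rewrite bopZ rf.
by move=> i _; case: ifP => [/rf//|_]; rewrite bopZ /d bopB rv re.
Qed.

Section Basis.
Variables (n : nat) (f : nat -> K).
Hypotheses (of_ : orthonormal_upto n f) (rf : forall i, (i < n)%N -> r (f i) = f i).
Hypothesis fE : forall v, r v = v -> expand n f v = v.

Let nrf i : (i < n)%N -> nr (f i) ^+ 2 = 1.
Proof. by move=> lt; apply: (@complexI R); rewrite -dotE of_ // eqxx. Qed.

(** Tested on a (x) b this is <L_a^* v, b>; as r v = v, a may be replaced by r a and expanded in the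
    basis. *)
Lemma D_expand v : r v = v -> D v = \sum_(i < n) t (f i) (adj (L (f i)) v).
Proof.
move=> rv; apply: (tens_ext tP) => a b; rewrite -(dot_mulDr _ _ v).
rewrite -[a ** b]/(L a b) -(adjE' (L a)) -[X in adj (L a) X]rv -(adj_lmul_graded1 ga) //.
rewrite -(fE (rr a)) /expand (adj_lmul_sum tP D n (fun i => dot (r a) (f i))) !dot_suml.
apply: eq_bigr => i _; rewrite dotZl (tensE tP) -dotC; congr (_ * _).
by rewrite -{1}ra -adjE rf.
Qed.

(** The squared norm of the unit vector D v0, computed from [D_expand]: each of the n terms
    contributes k. *)
Lemma dim_weight : n%:R * k = 1.
Proof.
have nD : nr (D v0) ^+ 2 = 1.
  by apply: (@complexI R); rewrite -dotE (ga_iso ga) dotE nv0 expr1n.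
rewrite -[RHS]nD (D_expand rv0) (nr_sum_orthl tP (fun i => adj (L (f i)) v0) of_).
rewrite (eq_bigr (fun=> k)) => [|i _]; first by rewrite sumr_const card_ord mulr_natl.
by rewrite -[LHS]/(weight (f i)) weightE ?rf // nrf // mulr1.
Qed.

Lemma dim_gt0 : (0 < n)%N.
Proof. by rewrite lt0n; apply: contra_eqN dim_weight => /eqP->; rewrite mul0r eq_sym oner_eq0. Qed.

Definition support (g : G) : Prop := exists X, [/\ graded g X, corner X & X != 0].

Lemma supportP g : support g -> exists U, [/\ graded g U, corner U,
  forall u, adj U (U u) = r u & forall u, U (adj U u) = r u].
Proof.
move=> [X [gX cX X0]]; have [s [s1 s2]] := corner_homogeneous gX cX.
have s0 : 0 < s.
  have [u Xu] := bop_neq0 X0.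
  have := dot_adj_comp X u; rewrite s1 dotZl -{2}[u](subrK (r u)) dotDr.
  have -> : dot (r u) (u - r u) = 0 by rewrite adjE ra bopB rr subrr dot0r.
  rewrite add0r dotE -rmorphM => /complexI e.
  have : 0 < s * nr (r u) ^+ 2 by rewrite e exprn_gt0 // nr_gt0.
  rewrite pmulr_lgt0 // exprn_gt0 // nr_gt0.
  by apply: contra Xu => /eqP ru; case: cX => _ <-; rewrite ru bop0.
pose c : R := (Num.sqrt s)^-1.
have cc : c * c * s = 1.
  by rewrite /c -expr2 exprVn sqr_sqrtr ?ltW // mulVf // gt_eqF.
pose U : bop K K := (c%:C%C : C) *: X.
have UE u : U u = (c%:C%C : C) *: X u by [].
have aU : adj U = (c%:C%C : C) *: adj X.
  apply: adj_unique => u v; rewrite UE -[(_ *: adj X) v]/(_ *: adj X v).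
  by rewrite dotZl dotZr conj_real adjE.
have aUE u : adj U u = (c%:C%C : C) *: adj X u by rewrite aU.
have [c1 c2] := cX.
exists U; split.
- exact: gradedZ.
- by split=> u; rewrite !UE ?bopZ ?c1 ?c2.
- by move=> u; rewrite aUE UE bopZ scalerA s1 scalerA -!rmorphM cc rmorph1 scale1r.
- by move=> u; rewrite aUE UE bopZ scalerA s2 scalerA -!rmorphM cc rmorph1 scale1r.
Qed.

(** Homogeneity of U gives R_g L_b^* U^* = L_(U b)^*. Inserting r = U^* U on the right turns the
    operator into L_a L_(U b)^* U, where the first two factors give a multiple of r. *)
Lemma matrix_op_support g U a b : graded g U -> corner U ->
  (forall u, adj U (U u) = r u) -> r a = a -> r b = b ->
  forall u, matrix_op g a b u = ((k%:C%C : C) * dot a (U b)) *: U u.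
Proof.
move=> gU [U1 U2] UU rea reb u.
have E w : rg g (adj (L b) (adj U w)) = adj (L (U b)) w.
  apply: dot_inj => c.
  rewrite (adjE (rg g)) (ga_rg_adj ga) (adjE' (L b)) (adjE' U) (graded_lmulE _ _ gU).
  by rewrite (ga_rgM ga) mulVg (ga_rg1 ga) -(adjE' (L _)).
rewrite -[LHS]/(L a (rg g (adj (L b) u))) -(proj2 (corner_lmul reb)) -UU E.
by rewrite lmul_adj_lmul ?U1.
Qed.

Let Q (g : G) : R := \sum_(j < n) \sum_(i < n) nr (matrix_op g (f i) (f j) v0) ^+ 2.

Lemma isometry_on (U : bop K K) w : (forall u, adj U (U u) = r u) -> r w = w -> nr (U w) ^+ 2 = nr w ^+ 2.
Proof. by move=> UU rw; apply: (@complexI R); rewrite -dot_adj_comp UU rw dotE. Qed.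

Lemma sum_matrix_op_support g : support g -> Q g = k.
Proof.
move=> /supportP[U [gU cU UU _]]; have [U1 U2] := cU.
have k0 := weight_unit_gt0.
have E (i j : 'I_n) : nr (matrix_op g (f i) (f j) v0) ^+ 2 = k ^+ 2 * nr (dot (U (f j)) (f i)) ^+ 2.
  rewrite (matrix_op_support gU cU UU) ?rf // nrZ nrM nrR gtr0_norm // !exprMn.
  by rewrite (isometry_on UU rv0) nv0 expr1n mulr1 dotC nr_conj.
rewrite /Q; under eq_bigr => j _ do under eq_bigr => i _ do rewrite E.
have S (j : 'I_n) : \sum_(i < n) k ^+ 2 * nr (dot (U (f j)) (f i)) ^+ 2 = k ^+ 2.
  rewrite -mulr_sumr -(nr_sum_orth (fun i => dot (U (f j)) (f i)) of_).
  rewrite -[\sum_(i < n) _]/(expand n f (U (f j))) fE ?U1 //.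
  by rewrite (isometry_on UU) ?rf // nrf // mulr1.
under eq_bigr => j _ do rewrite S.
by rewrite sumr_const card_ord -mulr_natl expr2 mulrA dim_weight mul1r.
Qed.

Lemma sum_matrix_op_nsupport g : ~ support g -> Q g = 0.
Proof.
move=> ng; rewrite /Q big1 // => j _; rewrite big1 // => i _.
have [->|X0] := eqVneq (matrix_op g (f i) (f j)) 0; first by rewrite nr0 expr0n.
exfalso; apply: ng; exists (matrix_op g (f i) (f j)); split => //.
  exact: graded_matrix_op.
by apply: corner_matrix_op; exact: rf.
Qed.

Lemma has_sum_matrix_op : has_sum Q n%:R.
Proof.
have -> : n%:R = \sum_(j < n) \sum_(i < n) (nr (f i) ^+ 2 * weight (f j)).
  rewrite (eq_bigr (fun=> 1)) ?sumr_const ?card_ord // => j _.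
  rewrite (eq_bigr (fun=> k)) => [|i _]; first by rewrite sumr_const card_ord -mulr_natl dim_weight.
  by rewrite weightE ?rf // !nrf // mulr1 mul1r.
apply: (@has_sum_sum _ _ n (fun j g => \sum_(i < n) nr (matrix_op g (f i) (f j) v0) ^+ 2)
   (fun j => \sum_(i < n) (nr (f i) ^+ 2 * weight (f j)))) => [j g|j jn].
  by rewrite sumr_ge0 // => i _; rewrite exprn_ge0 ?nr_ge0.
apply: (@has_sum_sum _ _ n (fun i g => nr (matrix_op g (f i) (f j) v0) ^+ 2)
   (fun i => nr (f i) ^+ 2 * weight (f j))) => [i g|i lt].
  by rewrite exprn_ge0 ?nr_ge0.
exact: sum_nr_matrix_op.
Qed.

(** The numbers Q g are k = 1 / n on the support, 0 elsewhere, and add up to n; so the support has n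
    / k = n^2 elements. *)
Lemma support_card : exists2 B : {fset G}, (forall g, g \in B <-> support g) & #|` B| = (n ^ 2)%N.
Proof.
have k0 := weight_unit_gt0; have nk := dim_weight.
have QE (A : {fset G}) : (forall g, g \in A -> support g) -> \sum_(g <- A) Q g = #|` A|%:R * k.
  move=> h; rewrite big_seq (eq_bigr (fun=> k)) => [|g /h/sum_matrix_op_support //].
  by rewrite -big_seq big_const_seq count_predT iter_addr addr0 mulr_natl.
have n0 : 0 < n%:R :> R by rewrite ltr0n dim_gt0.
have ub (A : {fset G}) : (forall g, g \in A -> support g) -> (#|` A| <= n ^ 2)%N.
  move=> h; have := has_sum_matrix_op.1 A; rewrite QE // -(ler_pM2r n0).
  by rewrite -mulrA [k * _]mulrC nk mulr1 -natrM ler_nat mulnn.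
(* A partial sum within k / 2 of n cannot miss a degree of the support, which would contribute k. *)
have [A lt] := has_sum_matrix_op.2 (k / 2) ltac:(by rewrite divr_gt0).
pose B := [fset g in A | `[< support g >]]%fset.
have Bs g : g \in B -> support g by rewrite !inE => /andP[_ /asboolP].
have QB : \sum_(g <- A) Q g = \sum_(g <- B) Q g.
  have BA : (B `<=` A)%fset by apply/fsubsetP => g; rewrite !inE => /andP[].
  rewrite (fset_sum_split Q BA) [X in _ + X](_ : _ = 0) ?addr0 //.
  rewrite big_seq_cond big1 // => g /andP[gA].
  rewrite !inE gA /= => /asboolPn; exact: sum_matrix_op_nsupport.
have cB : #|` B| = (n ^ 2)%N.
  apply/eqP; rewrite eqn_leq ub //= leqNgt; apply/negP => cB.
  have kn : k * n%:R = 1 by rewrite mulrC.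
  move: lt; rewrite QB QE // -(ltr_pM2r n0) -[ltRHS]mulrA kn mulr1.
  have -> : (n%:R - k / 2) * n%:R = n%:R * n%:R - (k * n%:R) / 2 by ring.
  rewrite kn; have : (#|` B|.+1%:R : R) <= (n ^ 2)%:R by rewrite ler_nat.
  by rewrite -natr1 natrX expr2; lra.
exists B => // g; split; first exact: Bs.
move=> sg; apply/negPn/negP => gB.
have sub g' : g' \in (g |` B)%fset -> support g'.
  by rewrite in_fset1U => /predU1P[->//|]; exact: Bs.
by have := ub _ sub; rewrite cardfsU1 gB cB add1n ltnn.
Qed.

Lemma support1 : support 1%g.
Proof. by exists r; split=> //; case: rm. Qed.

Lemma support_div g h : support g -> support h -> support (g * h^-1)%g.
Proof.
move=> /supportP[U [gU cU UU1 UU2]] /supportP[V [gV cV VV1 VV2]].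
exists (adj V \ob U); split.
- by apply: (graded_comp ga) => //; exact: (graded_adj ga).
- by apply: corner_comp => //; exact: corner_adj.
apply/eqP => X0.
have : V ((adj V \ob U) v0) = U v0 by rewrite /= VV2; case: cU => ->.
rewrite X0 bop0 => /esym Uv; have := UU1 v0; rewrite Uv bop0 rv0 => v00.
by have := nv0; rewrite -v00 nr0 => /esym/eqP; rewrite oner_eq0.
Qed.

Lemma torsion_free_support (B : {fset G}) : torsion_free G -> (forall g, g \in B <-> support g) ->
  B = [fset 1%g]%fset.
Proof.
move=> tf Bs; apply/fsetP => g; rewrite !inE; apply/idP/eqP => [gB|->]; last first.
  exact/Bs/support1.
have gi i : (g ^+ i)%g \in B.
  apply/Bs; elim: i => [|i IH]; first by rewrite expg0; exact: support1.
  rewrite expgS -[(g ^+ i)%g]invgK; apply: support_div; first exact/Bs.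
  by rewrite -[((g ^+ i)^-1)%g]mul1g; apply: support_div => //; exact: support1.
(* One power more than B has elements, so two of them coincide. *)
pose s := [seq (g ^+ i)%g | i <- iota 0 #|` B|.+1].
have ns : ~~ uniq s.
  apply/negP => us.
  have sub : {subset s <= enum_fset B} by move=> x /mapP[i _ ->]; exact: gi.
  by have := uniq_leq_size us sub; rewrite size_map size_iota ltnn.
have [i [j [ij e]]] : exists i j, (i < j)%N /\ (g ^+ i)%g = (g ^+ j)%g.
  apply: contrapT => h; move/negP: ns; apply.
  rewrite map_inj_uniq ?iota_uniq // => i j e.
  by have [lt|lt|//] := ltngtP i j; exfalso; apply: h; [exists i, j | exists j, i].
apply: (tf g (j - i)%N); first by rewrite subn_gt0.
apply: (mulgI (g ^+ i)%g).
by rewrite -expgnDr subnKC ?(ltnW ij) // mulg1.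
Qed.

(** The range of r is the line of z, and z ** a stays in it, so z ** a = chi(a) z; associativity
    makes chi multiplicative, and eta = L_z^* z represents it. *)
Lemma character_of_dim1 : n = 1%N ->
  exists2 eta, nr eta = 1 & forall a, adj (L a) eta = dot eta a *: eta.
Proof.
move=> n1; have k1 : k = 1 by have := dim_weight; rewrite n1 mul1r.
have n0 : (0 < n)%N by rewrite n1.
pose z := f 0%N; have rz : r z = z by exact: rf.
have nz : nr z ^+ 2 = 1 by exact: nrf.
have zE v : r v = v -> v = dot v z *: z.
  by move=> /fE {1}<-; rewrite /expand n1 big_ord1.
pose eta := adj (L z) z; exists eta.
  apply/eqP; rewrite -(@eqrXn2 _ 2) ?nr_ge0 // expr1n; apply/eqP/(@complexI R).
  by rewrite -(dot_gram tP D z z) gram_weight // weightE // nz k1 mulr1 rz dotZl dotE nz mulr1.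
move=> a; have -> : adj (L a) eta = adj (L (z ** a)) z.
  by apply: dot_inj => c; rewrite !(adjE' (L _)) -[L z _]/(z ** (a ** c)) -(ga_assoc ga).
have -> : z ** a = dot a eta *: z + 0.
  rewrite addr0 [LHS]zE; last by rewrite -[z ** a]/(L z a) (graded1_lmulE ga) // rz.
  by rewrite -[z ** a]/(L z a) (adjE (L z)).
rewrite adj_lmul_linear -dotC [adj (L 0) z](_ : _ = 0) ?addr0 //.
by apply: dot_inj => c; rewrite (adjE' (L 0)) dot0l -[L 0 c]/(rmulD tP D c 0) bop0 dot0r.
Qed.

End Basis.
End Trace.
End Corner.

(** * Characters of the algebra *)

Section Grouplike.
Variables (R : realType) (K K2 : hilbertType R) (t : {bilinear K -> K -> K2}) (G : groupType).
Local Notation C := (Cplx R).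
Variables (tP : is_tensor t) (D : bop K K2) (rg : G -> bop K K).
Hypothesis ga : galois_algebra t D rg.
Local Notation L := (lmulD tP D).
Local Notation "a ** b" := (mulD t D a b) (at level 40, left associativity).

Lemma character_ex (xi : K) : xi != 0 -> torsion_free G \/ no_square_order_subgroup G ->
  exists2 eta, nr eta = 1 & forall a, adj (L a) eta = dot eta a *: eta.
Proof.
move=> xi0 hG.
have [r [l [xi' [rm l0 rxi gE]]]] := minimal_projection_ex tP ga xi0.
have [v0 [rv0 nv0]] := unit_vector rm.
have [n [f [of_ rf fE]]] := corner_basis ga rm l0 rxi gE rv0 nv0.
have [B Bs Bn] := support_card ga rm l0 rxi gE rv0 nv0 of_ rf fE.
have B1 : B = [fset 1%g]%fset.
  case: hG => [tf|ns]; first exact: (torsion_free_support ga rm l0 gE rv0 nv0 tf Bs).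
  apply: ns; last by exists n.
  split; first exact/Bs/(support1 rm).
  move=> g h /Bs sg /Bs sh; apply/Bs.
  exact: (support_div ga rm l0 gE rv0 nv0).
apply: (character_of_dim1 ga rm l0 gE rv0 nv0 of_ rf fE).
by apply/eqP; rewrite -(@eqn_exp2r _ _ 2) // exp1n -Bn B1 cardfs1.
Qed.

(** By the Frobenius law the part w of eta ** b orthogonal to eta satisfies the same equation as
    eta. Then L_w^* w = <eta, w> w = 0, so |w ** c|^2 = <c, L_w^* w ** c> = 0 for all c, and w =
    0. *)
Lemma character_mulD eta : nr eta = 1 -> (forall a, adj (L a) eta = dot eta a *: eta) ->
  forall b, eta ** b = dot b eta *: eta.
Proof.
move=> ne eE b.
have ee : adj (L eta) eta = eta by rewrite eE dotE ne expr1n rmorph1 scale1r.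
pose v := eta ** b; pose w := v - dot v eta *: eta.
have wE a : adj (L a) w = dot eta a *: w.
  rewrite /w bopB bopZ eE (adj_lmul_mulD tP ga) eE.
  have -> : (dot eta a *: eta) ** b = dot eta a *: v by exact: (bopZ (rmulD tP D b)).
  by rewrite scalerBr !scalerA mulrC.
have we : dot w eta = 0 by rewrite dotBl dotZl dotE ne expr1n rmorph1 mulr1 subrr.
have w0 : w = 0.
  apply: (mulD_eq0 tP ga) => c; apply: dot_eq0.
  rewrite -{1}[w ** c]/(L w c) adjE (adj_lmul_mulD tP ga) wE [dot eta w]dotC we conjC0 scale0r.
  by rewrite -[0 ** c]/(rmulD tP D c 0) bop0 dot0r.
have -> : eta ** b = dot v eta *: eta by apply: subr0_eq.
by rewrite /v -[eta ** b]/(L eta b) (adjE (L eta)) ee.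
Qed.

(** Completeness of the translates of eta, which will make v surjective. *)
Lemma sum_character_coef eta b : nr eta = 1 -> (forall b, eta ** b = dot b eta *: eta) ->
  has_sum (fun g => nr (dot b (rg g eta)) ^+ 2) (nr b ^+ 2).
Proof.
move=> ne eE; have := has_sum_reindex (@invgK G) (sum_nr_mulD tP ga eta b).
rewrite ne expr1n mul1r; apply: eq_has_sum => g /=.
by rewrite eE nrZ ne mulr1 (adjE (rg _)) (ga_rg_adj ga) invgK.
Qed.
End Grouplike.

(** * Galois co-objects for L(G) *)

Section DeltaBasis.
Variables (R : realType) (G : groupType).
Local Notation C := (Cplx R).
Local Notation H := (l2 R G).

Lemma delta_subproof (g : G) : (fun h : G => (h == g)%:R : C) \in @square_summable_family R G.
Proof.
rewrite inE; exists 1 => A.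
have [gA|gA] := boolP (g \in A).
  rewrite (big_fsetD1 g) //= eqxx normr1 expr1n big_seq big1 ?addr0 // => h.
  by rewrite !inE => /andP[/negbTE-> _]; rewrite normr0 expr0n.
rewrite big_seq big1 ?ler01 // => h hA.
have /negbTE-> : h != g by apply: contraNneq gA => <-.
by rewrite normr0 expr0n.
Qed.
Definition delta g : H := L2 (delta_subproof g).

Lemma dot_delta (f : H) g : dot f (delta g) = f g.
Proof.
apply: (@l2_dot_unique R G f (delta g)); have TF := @totally_filter G.
apply: cvg_nrP => e e0; exists [fset g]%fset => // B /= gB.
suff -> : partial_sum (fun i => f i * (delta g i)^*) B = f g by rewrite subrr nr0.
rewrite partial_sumE (big_fsetD1 g) /=; last by rewrite -fsub1set.
rewrite eqxx conjC1 mulr1 big_seq big1 ?addr0 // => h.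
by rewrite !inE => /andP[/negbTE-> _]; rewrite conjC0 mulr0.
Qed.

Lemma delta_dot g h : dot (delta g) (delta h) = (g == h)%:R.
Proof. by rewrite dot_delta /= eq_sym. Qed.

Lemma delta_total : total_set (range delta).
Proof.
move=> f h; apply/val_inj/funext => g; apply: etrans (esym (dot_delta f g)) _.
by rewrite dotC h ?conjC0 //; exists g.
Qed.

Lemma lambda_delta g h : lambda R g (delta h) = delta (g * h)%g.
Proof.
apply/val_inj/funext => x /=; congr (_%:R); congr nat_of_bool.
by apply/eqP/eqP => [<-|->]; rewrite mulgA ?mulgV ?mulVg mul1g.
Qed.

Lemma bop_delta_ext (L : hilbertType R) (x y : bop H L) :
  (forall g, x (delta g) = y (delta g)) -> x = y.
Proof.
by move=> h; apply: (bop_total_ext delta_total) => _ [g _ <-].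
Qed.

Lemma lambda1 : lambda R (1%g : G) = bid H.
Proof. by apply: bop_delta_ext => g; rewrite lambda_delta mul1g. Qed.

Local Notation M := (group_vN R G).

Lemma group_vN_lambda g : M (lambda R g).
Proof. by apply/sub_sw_closure/sub_lspan; exists g. Qed.

Lemma group_vN_subspace : lin_subspace M.
Proof. by apply: sw_closure_subspace; exact: lspan_subspace. Qed.

(** The common value is the canonical trace of z; on generators this is invariance under right
    translation. *)
Lemma group_vN_trace z g : M z -> dot (z (delta g)) (delta g) = dot (z (delta 1%g)) (delta 1%g).
Proof.
apply: sw_closure_dot => _ [h _ <-]; rewrite !lambda_delta !delta_dot mulg1.
by rewrite -{2}[g]mul1g (inj_eq (mulIg g)).
Qed.
End DeltaBasis.

Section TensorPowers.
Variables (R : realType) (H L : hilbertType R) (TH : tensor_powers H) (TL : tensor_powers L).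

Lemma tens2E x y u v : tens2 TH TL x y (t2 TH u v) = t2 TL (x u) (y v).
Proof. exact: btensE (t2P TH) (t2P TL) _ _ _ _. Qed.

Lemma tens21E (X : bop (tsq TH) (tsq TL)) y u v : tens21 X y (t21 TH u v) = t21 TL (X u) (y v).
Proof. exact: btensE (t21P TH) (t21P TL) _ _ _ _. Qed.

Lemma tens12E x (Y : bop (tsq TH) (tsq TL)) u v : tens12 x Y (t12 TH u v) = t12 TL (x u) (Y v).
Proof. exact: btensE (t12P TH) (t12P TL) _ _ _ _. Qed.

Lemma adj_tens2 x y : adj (tens2 TH TL x y) = tens2 TL TH (adj x) (adj y).
Proof. exact: adj_btens (t2P TH) (t2P TL). Qed.
End TensorPowers.

Arguments co_set {R H TH} c _.
Arguments co_map {R H TH} c _.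

(** * From a co-object to the algebra on K, and back to an isomorphism *)

Section CoobjectTrivial.
Variables (R : realType) (G : groupType) (T : tensor_powers (l2 R G)).
Variable DM : bop (l2 R G) (l2 R G) -> bop (tsq T) (tsq T).
Hypothesis hDM : is_group_comult DM.
Local Notation C := (Cplx R).
Local Notation H := (l2 R G).
Local Notation M := (group_vN R G).
Local Notation e := (delta R (1%g : G)).
Local Notation d := (@delta R G).

Lemma comult_lambda_delta g h k : DM (lambda R g) (t2 T (d h) (d k)) = t2 T (d (g * h)%g) (d (g * k)%g).
Proof. by rewrite (gc_lambda hDM) tens2E !lambda_delta. Qed.

(** The case g = 1 will make D isometric; the cases g <> 1 will make the ranges of the (1 (x) R_g) D
    orthogonal. *)
Lemma comult_dot z g : M z ->
  dot (DM z (t2 T e (d g))) (t2 T e e) = (g == 1%g)%:R * dot (z e) e.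
Proof.
move=> Mz; rewrite -dotZl -bopZ; move: z Mz.
apply: (normal_dot (gc_normal hDM)) => _ [h _ <-].
rewrite comult_lambda_delta (tensE (t2P T)) bopZ dotZl lambda_delta !delta_dot mulg1 mulrC.
have [->|h1] := eqVneq h 1%g; last by rewrite !mulr0.
by rewrite mul1g.
Qed.

(* The part of is_right_galois_coobject from which triviality is derived; it is
   what one has to check for the twist of M by a 2-cocycle. *)
Record coobject_conditions (X : coobject_data T) : Prop := {
  cc_subspace : lin_subspace (co_set X);
  cc_closed : sw_closure (co_set X) = co_set X;
  cc_linear : forall a x y, co_set X x -> co_set X y ->
    co_map X (a *: x + y) = a *: co_map X x + co_map X y;
  cc_map : forall x, co_set X x -> wtens T (co_tensor X) (co_set X) (co_map X x);
  cc_nondeg : total_set [set v | exists x u, co_set X x /\ v = x u];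
  cc_nondeg_op : total_set [set u | exists x v, co_set X x /\ u = adj x v];
  cc_module : forall x y, co_set X x -> M y -> co_set X (x \ob y);
  cc_inner : forall x y, co_set X x -> co_set X y -> M (adj x \ob y);
  cc_map_module : forall x y, co_set X x -> M y ->
    co_map X (x \ob y) = co_map X x \ob DM y;
  cc_map_inner : forall x y, co_set X x -> co_set X y ->
    adj (co_map X x) \ob co_map X y = DM (adj x \ob y);
  cc_coassoc : exists F F',
    [/\ is_map_tensor_id (co_set X) (co_map X) F,
        is_id_tensor_map (co_set X) (co_map X) F'
      & forall x, co_set X x -> F (co_map X x) = F' (co_map X x)];
  cc_dense : wtens T (co_tensor X) (co_set X) `<=`
    sw_closure (lspan [set z | exists x y1 y2,
      [/\ co_set X x, M y1, M y2 & z = co_map X x \ob tens2 T T y1 y2]]) }.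

Variable X : coobject_data T.
Hypothesis hX : coobject_conditions X.
Local Notation K := (co_space X).
Local Notation TK := (co_tensor X).
Local Notation N := (co_set X).
Local Notation DN := (co_map X).

Lemma co_lambda x g : N x -> N (x \ob lambda R g).
Proof. by move=> Nx; apply: (cc_module hX) => //; exact: group_vN_lambda. Qed.

Lemma co_vectors_total : total_set [set u | exists2 x, N x & u = x e].
Proof.
move=> w h; apply: (cc_nondeg hX) => _ [x [u [Nx ->]]].
rewrite adjE (_ : adj x w = 0) ?dot0r //; apply: delta_total => _ [g _ <-].
rewrite -adjE; apply: h; exists (x \ob lambda R g); first exact: co_lambda.
by rewrite -[RHS]/(x (lambda R g e)) lambda_delta mulg1.
Qed.

Lemma co_ext (L : hilbertType R) (A B : bop K L) : (forall x, N x -> A (x e) = B (x e)) -> A = B.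
Proof.
by move=> h; apply: (bop_total_ext co_vectors_total) => _ [x Nx ->]; exact: h.
Qed.

Lemma co_dot_ext (u v : K) : (forall x, N x -> dot (x e) u = dot (x e) v) -> u = v.
Proof.
move=> h; apply: subr0_eq; apply: co_vectors_total => _ [x Nx ->].
by rewrite dotBr h // subrr.
Qed.

Lemma co_dot (x y : bop H K) : dot (y e) (x e) = dot ((adj x \ob y) e) e.
Proof. by rewrite /= adjE'. Qed.

Lemma co_extension (L : hilbertType R) (f : bop H K -> L) :
  (forall a x y, N x -> N y -> f (a *: x + y) = a *: f x + f y) ->
  (forall x, N x -> nr (f x) = nr (x e)) ->
  exists A : bop K L, forall x, N x -> A (x e) = f x.
Proof.
move=> flin fn; have [N0 NP] := cc_subspace hX.
have f0 : f 0 = 0 by apply/eqP; rewrite -nr_eq0 fn //; apply/eqP; exact: nr0.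
have [] := @bop_extension R K L (fun u v => exists x, [/\ N x, u = x e & v = f x]) 1.
- exact: ler01.
- by exists 0.
- move=> a _ _ _ _ [x [Nx -> ->]] [y [Ny -> ->]]; exists (a *: x + y).
  by rewrite flin //; split => //; exact: NP.
- by move=> _ _ [x [Nx -> ->]]; rewrite fn // mul1r.
- move=> u; apply: total_adherent.
    split; first by exists (f 0), 0.
    move=> a _ _ [_ [x [Nx -> _]]] [_ [y [Ny -> _]]]; exists (f (a *: x + y)), (a *: x + y).
    by split => //; exact: NP.
  move=> w h; apply: co_vectors_total => _ [x Nx ->]; apply: h.
  by exists (f x), x.
by move=> A hA; exists A => x Nx; apply: hA; exists x.
Qed.

Lemma co_delta x g h : N x -> x (d (g * h)%g) = (x \ob lambda R g) (d h).
Proof. by rewrite -[RHS]/(x (lambda R g (d h))) lambda_delta. Qed.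

(** Translation is isometric on N e: |x delta_g|^2 is a diagonal coefficient of x^* x, an element of
    M, and does not depend on g. *)
Lemma co_translations : exists rg : G -> bop K K,
  forall g x h, N x -> rg g (x (d h)) = x (d (h * g)%g).
Proof.
suff /choice[rg hrg] g : exists A : bop K K, forall x, N x -> A (x e) = x (d g).
  exists rg => g x h Nx; rewrite -[h in LHS]mulg1 !co_delta //.
  by apply: hrg; exact: co_lambda.
apply: (co_extension (f := fun x => x (d g))) => [//|x Nx].
apply/eqP; rewrite -(@eqrXn2 _ 2) ?nr_ge0 //; apply/eqP/(@complexI R).
rewrite -!dotE -!(adjE' x); apply: (group_vN_trace (z := adj x \ob x)).
exact: (cc_inner hX).
Qed.

Lemma co_comult_dot x y g : N x -> N y ->
  dot (DN x (t2 T e (d g))) (DN y (t2 T e e)) = (g == 1%g)%:R * dot (x e) (y e).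
Proof.
move=> Nx Ny.
rewrite -(adjE' (DN y)) -[adj (DN y) _]/((adj (DN y) \ob DN x) _) (cc_map_inner hX) //.
by rewrite comult_dot ?co_dot //; exact: (cc_inner hX).
Qed.

Lemma co_comult : exists D : bop K (tsq TK), forall x, N x -> D (x e) = DN x (t2 T e e).
Proof.
apply: (co_extension (f := fun x => DN x (t2 T e e))) => [a x y Nx Ny|x Nx].
  by rewrite (cc_linear hX).
apply/eqP; rewrite -(@eqrXn2 _ 2) ?nr_ge0 //; apply/eqP/(@complexI R).
by rewrite -!dotE co_comult_dot // eqxx mul1r.
Qed.

Section Algebra.
Variables (rg : G -> bop K K) (D : bop K (tsq TK)).
Hypothesis rgE : forall g x h, N x -> rg g (x (d h)) = x (d (h * g)%g).
Hypothesis DE : forall x, N x -> D (x e) = DN x (t2 T e e).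
Local Notation "a ** b" := (mulD (t2 TK) D a b) (at level 40, left associativity).

Lemma co_rgM g h u : rg g (rg h u) = rg (h * g)%g u.
Proof.
suff -> : rg (h * g)%g = rg g \ob rg h by [].
by apply: co_ext => x Nx; rewrite -[RHS]/(rg g (rg h (x e))) !rgE // !mul1g.
Qed.

Lemma co_rg1 u : rg 1%g u = u.
Proof.
suff -> : rg 1%g = bid K by [].
by apply: co_ext => x Nx; rewrite rgE // mulg1.
Qed.

Lemma co_rg_adj g : adj (rg g) = rg g^-1%g.
Proof.
have iso u : adj (rg g) (rg g u) = u.
  suff : adj (rg g) \ob rg g = bid K by move=> h; rewrite -[LHS]/((adj (rg g) \ob rg g) u) h.
  apply: co_ext => x Nx; apply: co_dot_ext => y Ny.
  rewrite -[(_ \ob _) _]/(adj (rg g) (rg g (x e))) -adjE !rgE // mul1g.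
  rewrite -(adjE' x) [RHS]co_dot; apply: (group_vN_trace (z := adj x \ob y)).
  exact: (cc_inner hX).
apply: bop_ext => u; rewrite -{1}[u]co_rg1 -(mulVg g) -co_rgM.
by rewrite iso.
Qed.

(** The weak form of Z (delta_g (x) delta_h) = (R_g (x) R_h) Z (e (x) e), which is immediate on
    elementary tensors of N. *)
Lemma co_wtens_dot Z g h a b : wtens T TK N Z ->
  dot (Z (t2 T (d g) (d h))) (t2 TK a b) = dot (Z (t2 T e e)) (t2 TK (rg g^-1%g a) (rg h^-1%g b)).
Proof.
apply: sw_closure_dot => _ [x [y [Nx Ny ->]]].
rewrite !tens2E !(tensE (t2P TK)) -!co_rg_adj -!adjE !rgE // !mul1g.
by [].
Qed.

Lemma co_mulD_dot x a b : N x -> dot (x e) (a ** b) = dot (DN x (t2 T e e)) (t2 TK a b).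
Proof. by move=> Nx; rewrite /mulD -adjE DE. Qed.

(** Coefficients of F Z and F' Z at e (x) e (x) e amount to multiplying the first two, respectively
    the last two, of the vectors paired with them. Coassociativity is thus associativity. *)
Lemma co_assoc a b c : (a ** b) ** c = a ** (b ** c).
Proof.
have [F [F' [[Fn FE] [Fn' FE'] FF']]] := cc_coassoc hX.
have F1 Z : wtens T TK N Z -> dot (F Z (t21 T (t2 T e e) e)) (t21 TK (t2 TK a b) c)
    = dot (Z (t2 T e e)) (t2 TK (a ** b) c).
  apply: (normal_dot Fn) => _ [x [y [Nx Ny ->]]].
  by rewrite FE // tens21E (tensE (t21P TK)) tens2E (tensE (t2P TK)) co_mulD_dot.
have F2 Z : wtens T TK N Z -> dot (F' Z (t12 T e (t2 T e e))) (t12 TK a (t2 TK b c))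
    = dot (Z (t2 T e e)) (t2 TK a (b ** c)).
  apply: (normal_dot Fn') => _ [x [y [Nx Ny ->]]].
  by rewrite FE' // tens12E (tensE (t12P TK)) tens2E (tensE (t2P TK)) co_mulD_dot.
apply: co_dot_ext => x Nx; rewrite !co_mulD_dot //.
by rewrite -(F1 _ (cc_map hX Nx)) -(F2 _ (cc_map hX Nx)) FF' // !tassoc.
Qed.

Lemma co_map_lambda x g h k : N x ->
  DN (x \ob lambda R g) (t2 T (d h) (d k)) = DN x (t2 T (d (g * h)%g) (d (g * k)%g)).
Proof.
move=> Nx; rewrite (cc_map_module hX) //; last exact: group_vN_lambda.
by rewrite -[LHS]/(DN x (DM (lambda R g) _)) comult_lambda_delta.
Qed.

Lemma co_rg_mulD g a b : rg g (a ** b) = rg g a ** rg g b.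
Proof.
apply: co_dot_ext => x Nx.
have -> : dot (x e) (rg g (a ** b)) = dot ((x \ob lambda R g^-1%g) e) (a ** b).
  by rewrite -(adjE' (rg g)) co_rg_adj rgE // mul1g -co_delta // mulg1.
rewrite (co_mulD_dot _ _ (co_lambda _ Nx)) co_map_lambda // !mulg1 [RHS]co_mulD_dot //.
by rewrite [LHS](co_wtens_dot _ _ _ _ (cc_map hX Nx)) invgK.
Qed.

Lemma co_galois_iso x g : N x ->
  btens (t2 TK) (t2 TK) (bid K) (rg g) (D (x e)) = DN x (t2 T e (d g)).
Proof.
move=> Nx; apply: (tens_ext (t2P TK)) => a b.
rewrite (dot_btens _ _ _ _ _ (t2P TK) (t2P TK)) adj_bid co_rg_adj DE //.
by rewrite [RHS](co_wtens_dot _ _ _ _ (cc_map hX Nx)) invg1 co_rg1.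
Qed.

Lemma co_dot_ext2 (L : hilbertType R) (A B : bop K L) :
  (forall x y, N x -> N y -> dot (A (x e)) (B (y e)) = 0) -> forall u v, dot (A u) (B v) = 0.
Proof.
move=> h u v; rewrite -(adjE' B) -[adj B _]/((adj B \ob A) u).
suff -> : adj B \ob A = 0 by rewrite -[X in dot X _]/(0 : K) dot0l.
apply: co_ext => x Nx; apply: co_dot_ext => y Ny.
rewrite -[(0 : bop K K) _]/(0 : K) dot0r -[(_ \ob _) _]/(adj B (A (x e))) -adjE.
by rewrite dotC h // conjC0.
Qed.

Lemma co_galois_algebra : galois_algebra (t2 TK) D rg.
Proof.
split.
- suff h u : adj D (D u) = u by move=> u v; rewrite -(adjE' D) h.
  rewrite -[LHS]/((adj D \ob D) u); suff -> : adj D \ob D = bid K by [].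
  apply: co_ext => x Nx; apply: co_dot_ext => y Ny.
  rewrite -[(_ \ob _) _]/(adj D (D (x e))) -adjE !DE //.
  by rewrite co_comult_dot // eqxx mul1r.
- exact: co_assoc.
- exact: co_rg1.
- exact: co_rgM.
- exact: co_rg_adj.
- exact: co_rg_mulD.
- move=> g u v g1.
  apply: (@co_dot_ext2 _ (btens (t2 TK) (t2 TK) (bid K) (rg g) \ob D) D) => x y Nx Ny.
  rewrite -[(_ \ob _) _]/(btens (t2 TK) (t2 TK) (bid K) (rg g) (D (x e))).
  by rewrite co_galois_iso // DE // co_comult_dot // (negbTE g1) mul0r.
(* As delta_h (x) delta_g is the translate by h of e (x) delta_(h^-1 g), w is orthogonal to the
   ranges of all Delta_N(x). The density condition extends this to all Z (e (x) e) with Z in N (x)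
   N. *)
- move=> w hw.
  have h1 x g h : N x -> dot (DN x (t2 T (d h) (d g))) w = 0.
    move=> Nx; rewrite -[h]mulg1 -[g](mulVKg h) -co_map_lambda //.
    rewrite -co_galois_iso; last exact: co_lambda.
    by apply: hw; exists (h^-1 * g)%g, ((x \ob lambda R h) e).
  have h2 x u : N x -> dot (DN x u) w = 0.
    move=> Nx; rewrite adjE (_ : adj (DN x) w = 0) ?dot0r //.
    apply: (tens_total_of (t2P T) (@delta_total R G) (@delta_total R G)).
    by move=> _ [_ [_ [[h _ <-] [g _ <-] ->]]]; rewrite -adjE h1.
  have h3 Z : wtens T TK N Z -> dot (Z (t2 T e e)) w = 0.
    move=> /(cc_dense hX); rewrite -[RHS](dot0l w) -(bop0 Z).
    apply: sw_closure_dot => _ [x [y1 [y2 [Nx My1 My2 ->]]]].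
    by rewrite bop0 dot0l -[(_ \ob _) _]/(DN x (tens2 T T y1 y2 _)) h2.
  apply: (tens_total_of (t2P TK) co_vectors_total co_vectors_total).
  move=> _ [_ [_ [[x Nx ->] [y Ny ->] ->]]]; rewrite -(tens2E T); apply: h3.
  by apply/sub_sw_closure/sub_lspan; exists x, y.
Qed.

Let ga := co_galois_algebra.

Lemma co_space_neq0 : exists xi : K, xi != 0.
Proof.
apply: contrapT => /forallNP h.
have e0 : e = 0.
  apply: (cc_nondeg_op hX) => _ [x [v [Nx ->]]].
  by have /negP := h v; rewrite negbK => /eqP->; rewrite bop0 dot0l.
by have := delta_dot R (1%g : G) 1%g; rewrite e0 dot0l eqxx => /eqP; rewrite eq_sym oner_eq0.
Qed.

Section Character.
Variable eta : K.
Hypotheses (n_eta : nr eta = 1)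
  (charE : forall a, adj (lmulD (t2P TK) D a) eta = dot eta a *: eta).

Lemma D_character : D eta = t2 TK eta eta.
Proof.
apply: (tens_ext (t2P TK)) => a b; rewrite -(dot_mulDr _ _ eta) (tensE (t2P TK)).
by rewrite -[a ** b]/(lmulD (t2P TK) D a b) -(adjE' (lmulD (t2P TK) D a)) charE dotZl.
Qed.

(** Since D eta = eta (x) eta, [ga_orth] for the pair eta, eta reads <R_k eta, eta> = 0 for k <>
    1. *)
Lemma character_orth g h : dot (rg g eta) (rg h eta) = (g == h)%:R.
Proof.
rewrite -(adjE' (rg h)) co_rg_adj co_rgM.
have [->|gh] := eqVneq g h; first by rewrite mulgV co_rg1 dotE n_eta expr1n rmorph1.
have k1 : (g * h^-1)%g != 1%g.
  apply: contra gh => /eqP k; apply/eqP; by rewrite -[g](mulgVK h) k mul1g.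
have := ga_orth ga eta eta k1; rewrite D_character btensE; try exact: t2P.
by rewrite (tensE (t2P TK)) -[bid K eta]/eta dotE n_eta expr1n rmorph1 mul1r.
Qed.

(** The slice map omega (x) id for the functional omega(x) = <x e, eta>. *)
Definition slice (Z : bop (tsq T) (tsq TK)) : bop H K :=
  adj (tensl (t2P TK) eta) \ob Z \ob tensl (t2P T) e.

Lemma slice_tens2 (x y : bop H K) : slice (tens2 T TK x y) = dot (x e) eta *: y.
Proof.
apply: bop_ext => u; apply: dot_inj => c.
rewrite -[X in dot X c]/(adj (tensl (t2P TK) eta) (tens2 T TK x y (t2 T e u))).
by rewrite adjE' tens2E (tensE (t2P TK)) -dotZl.
Qed.

Lemma slice_wtens Z : wtens T TK N Z -> N (slice Z).
Proof.
move=> wZ; rewrite -(cc_closed hX).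
have cs : continuous (slice : sigma_weak _ _ -> sigma_weak _ _).
  exact: (@sw_continuous_comp R _ _ _ _ (tensl (t2P T) e) (adj (tensl (t2P TK) eta))).
apply: (sw_closure_map cs _ wZ).
move=> z zS; apply: sub_sw_closure.
apply: (@lspan_min R _ _ [set z | N (slice z)] _ _ z zS).
  have [N0 NP] := cc_subspace hX; split.
    rewrite /= (_ : slice 0 = 0) //; apply: bop_ext => u.
    by rewrite -[LHS]/(adj (tensl (t2P TK) eta) 0) bop0.
  move=> a y y' /= Ny Ny'; rewrite (_ : slice _ = a *: slice y + slice y'); first exact: NP.
  by apply: bop_ext => u; exact: (bop_linear (adj (tensl (t2P TK) eta))).
move=> _ [x [y [Nx Ny ->]]] /=; rewrite slice_tens2.
exact: lin_subspaceZ (cc_subspace hX) Ny.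
Qed.

Hypothesis charM : forall b, eta ** b = dot b eta *: eta.

(** Slicing Delta_N(x) yields y in N with <y e, b> = <x e, eta ** b>, and eta ** b is a multiple of
    eta. So y e is a multiple of eta, nonzero as soon as x e is not orthogonal to eta. *)
Lemma character_implemented : exists2 v, N v & forall g, v (d g) = rg g eta.
Proof.
have [x Nx xe] : exists2 x, N x & dot (x e) eta != 0.
  apply: contrapT => h; have eta0 : eta = 0.
    apply: co_vectors_total => _ [x Nx ->]; apply/eqP/negPn/negP => c; apply: h.
    by exists x.
  by move: n_eta => /eqP; rewrite eta0 nr0 eq_sym oner_eq0.
pose y := slice (DN x).
have ye : y e = dot (x e) eta *: eta.
  apply: dot_inj => b.
  rewrite -[y e]/(adj (tensl (t2P TK) eta) (DN x (t2 T e e))) (adjE' (tensl _ _)).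
  by rewrite -[tensl _ _ _]/(t2 TK eta b) -co_mulD_dot // charM dotZr -dotC dotZl mulrC.
have Ny : N y by apply: slice_wtens; exact: (cc_map hX).
exists ((dot (x e) eta)^-1 *: y); first exact: lin_subspaceZ (cc_subspace hX) Ny.
move=> g; rewrite -[LHS]/((dot (x e) eta)^-1 *: y (d g)) -[g in LHS]mul1g -rgE //.
by rewrite ye bopZ scalerA mulVf // scale1r.
Qed.

End Character.

Lemma co_trivial_of_galois : torsion_free G \/ no_square_order_subgroup G ->
  coobject_iso X (self_coobject M DM).
Proof.
move=> hG; have [xi xi0] := co_space_neq0.
have [eta n_eta charE] := character_ex (t2P TK) ga xi0 hG.
have charM := character_mulD ga n_eta charE.
have [v Nv vE] := character_implemented n_eta charM.
have orth := character_orth n_eta charE.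
have vv : adj v \ob v = bid H.
  apply: bop_delta_ext => g; apply: dot_inj => c.
  rewrite -[(_ \ob _) _]/(adj v (v (d g))) -[bid H _]/(d g).
  have tot := @delta_total R G; apply/eqP; rewrite -subr_eq0 -dotBl; apply/eqP.
  suff -> : adj v (v (d g)) - d g = 0 by rewrite dot0l.
  apply: tot => _ [h _ <-].
  by rewrite dotC dotBl (adjE' v) !vE orth delta_dot subrr conjC0.
have vvE u : adj v (v u) = u by rewrite -[LHS]/((adj v \ob v) u) vv.
(* The defect w is orthogonal to all translates of eta, which satisfy Parseval's identity. *)
have vv' : v \ob adj v = bid K.
  apply: bop_ext => b; apply: subr0_eq; set w := _ - _.
  have w0 g : dot w (rg g eta) = 0.
    rewrite -vE -(adjE' v) /w bopB -[(_ \ob _) b]/(v (adj v b)) vvE subrr.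
    exact: dot0l.
  have h0 : has_sum (fun g => nr (dot w (rg g eta)) ^+ 2) 0.
    by apply: eq_has_sum (has_sum0 R G) => g; rewrite w0 nr0 expr0n.
  have := has_sum_unique (sum_character_coef (t2P TK) ga w n_eta charM) h0.
  by move/eqP; rewrite sqrf_eq0 nr_eq0 => /eqP.
(* Both sides intertwine the translations, so only their values at e (x) e matter, where D eta = eta
   (x) eta. *)
have DNv : DN v = tens2 T TK v v.
  apply: (bop_total_ext (tens_total_of (t2P T) (@delta_total R G) (@delta_total R G))).
  move=> _ [_ [_ [[g _ <-] [h _ <-] ->]]].
  apply: (tens_ext (t2P TK)) => a b.
  rewrite (co_wtens_dot _ _ _ _ (cc_map hX Nv)) -DE // vE co_rg1 (D_character charE).
  by rewrite tens2E !(tensE (t2P TK)) !vE -!co_rg_adj -!adjE.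
exists (adj v); split.
- by rewrite /unitary adjK.
- apply/seteqP; split => [_ [x Nx <-]|m Mm]; first exact: (cc_inner hX).
  exists (v \ob m); first exact: (cc_module hX).
  by apply: bop_ext => u; exact: vvE.
- move=> x Nx; rewrite -[LHS]/(DM (adj v \ob x)) -(cc_map_inner hX) // DNv.
  by rewrite adj_tens2.
Qed.
End Algebra.

Lemma coobject_trivial : torsion_free G \/ no_square_order_subgroup G ->
  coobject_iso X (self_coobject M DM).
Proof.
have [rg rgE] := co_translations; have [D DE] := co_comult.
exact: co_trivial_of_galois rgE DE.
Qed.
End CoobjectTrivial.

(** * Triviality of unitary 2-cocycles *)

Section Cocycle.
Variables (R : realType) (G : groupType) (T : tensor_powers (l2 R G)).
Variable DM : bop (l2 R G) (l2 R G) -> bop (tsq T) (tsq T).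
Hypothesis hDM : is_group_comult DM.
Local Notation C := (Cplx R).
Local Notation H := (l2 R G).
Local Notation M := (group_vN R G).
Local Notation MM := (wtens T T M).

Lemma group_vN_closed : sw_closure M = M.
Proof. exact: sw_closure_idem. Qed.

Lemma group_vN_mul x y : M x -> M y -> M (x \ob y).
Proof.
apply: (sw_span_mul (@group_vN_subspace R G) group_vN_closed) => _ _ [g _ <-] [h _ <-].
rewrite (_ : _ \ob _ = lambda R (g * h)%g); first exact: group_vN_lambda.
by apply: bop_delta_ext => k; rewrite -[LHS]/(lambda R g (lambda R h (delta R k))) !lambda_delta mulgA.
Qed.

Lemma adj_lambda (g : G) : adj (lambda R g) = lambda R g^-1%g.
Proof.
apply: bop_delta_ext => h; apply: subr0_eq; apply: delta_total => _ [k _ <-].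
rewrite dotBr -(adjE (lambda R g)) !lambda_delta !delta_dot.
rewrite (_ : (g * k == h)%g = (k == g^-1 * h)%g) ?subrr //.
by apply/eqP/eqP => [<-|->]; rewrite mulgA ?mulVg ?mulgV mul1g.
Qed.

Lemma group_vN_adj x : M x -> M (adj x).
Proof.
apply: (sw_span_adj (@group_vN_subspace R G) group_vN_closed) => _ [g _ <-].
by rewrite adj_lambda; exact: group_vN_lambda.
Qed.

Lemma group_vN1 : M (bid H).
Proof. by rewrite -lambda1; exact: group_vN_lambda. Qed.

Lemma wtens_subspace : lin_subspace MM.
Proof. by apply: sw_closure_subspace; exact: lspan_subspace. Qed.

Lemma wtens_closed : sw_closure MM = MM.
Proof. exact: sw_closure_idem. Qed.

Lemma wtens_tens2 x y : M x -> M y -> MM (tens2 T T x y).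
Proof. by move=> Mx My; apply/sub_sw_closure/sub_lspan; exists x, y. Qed.

Lemma tens2_comp x y x' y' : tens2 T T (x \ob x') (y \ob y') = tens2 T T x y \ob tens2 T T x' y'.
Proof. by apply: btens_comp; exact: t2P. Qed.

Lemma wtens_mul X Y : MM X -> MM Y -> MM (X \ob Y).
Proof.
apply: (sw_span_mul wtens_subspace wtens_closed) => _ _ [x [y [Mx My ->]]] [x' [y' [Mx' My' ->]]].
by rewrite -tens2_comp; apply: wtens_tens2; exact: group_vN_mul.
Qed.

Lemma wtens_adj X : MM X -> MM (adj X).
Proof.
apply: (sw_span_adj wtens_subspace wtens_closed) => _ [x [y [Mx My ->]]].
by rewrite adj_tens2; apply: wtens_tens2; exact: group_vN_adj.
Qed.

Lemma comult1 : DM (bid H) = bid (tsq T).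
Proof. by rewrite -lambda1 (gc_lambda hDM) lambda1; exact: btens_bid (t2P T). Qed.

(** Normality extends the rule from elementary tensors, in the right factor and then in the left. It
    is needed to apply Delta (x) id and id (x) Delta to a product W Delta(x). *)
Lemma normal_multiplicative (L : hilbertType R) (F : bop (tsq T) (tsq T) -> bop L L) :
  normal_linear_on MM F ->
  (forall x y x' y', M x -> M y -> M x' -> M y' ->
    F (tens2 T T (x \ob x') (y \ob y')) = F (tens2 T T x y) \ob F (tens2 T T x' y')) ->
  forall X Y, MM X -> MM Y -> F (X \ob Y) = F X \ob F Y.
Proof.
move=> Fn FM.
have right Z : MM Z -> normal_linear_on MM (fun Y => F (Z \ob Y)).
  move=> MZ; apply: (normal_comp (normal_mull _ Z) Fn) => Y MY; exact: wtens_mul.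
have left Z : MM Z -> normal_linear_on MM (fun Y => F (Y \ob Z)).
  move=> MZ; apply: (normal_comp (normal_mulr _ Z) Fn) => Y MY; exact: wtens_mul.
have step x y Y : M x -> M y -> MM Y -> F (tens2 T T x y \ob Y) = F (tens2 T T x y) \ob F Y.
  move=> Mx My; move: Y; apply: normal_unique.
  - by apply: right; exact: wtens_tens2.
  - by apply: (normal_comp Fn (normal_mull setT _)).
  - by move=> _ [x' [y' [Mx' My' ->]]]; rewrite -tens2_comp FM.
move=> X Y + MY; move: X; apply: normal_unique.
- exact: left.
- by apply: (normal_comp Fn (normal_mulr setT (F Y))).
- by move=> _ [x [y [Mx My ->]]]; exact: step.
Qed.

Section Twist.
Variable W : bop (tsq T) (tsq T).
Hypothesis hW : unitary_2cocycle M DM W.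

Definition twisted_coobject : coobject_data T :=
  @CoobjectData R H T H T M (fun x => W \ob DM x).

Lemma comult_coassoc F F' : is_map_tensor_id M DM F -> is_id_tensor_map M DM F' ->
  forall x, M x -> F (DM x) = F' (DM x).
Proof.
move=> [Fn FE] [Fn' FE']; apply: normal_unique.
- exact: (normal_comp (gc_normal hDM) Fn (gc_map hDM)).
- exact: (normal_comp (gc_normal hDM) Fn' (gc_map hDM)).
move=> _ [g _ <-]; have Mg : M (lambda R g) by exact: group_vN_lambda.
rewrite (gc_lambda hDM) FE // FE' // (gc_lambda hDM).
apply: (bop_total_ext (tens_total_of (t21P T) (tens_total (t2P T)) (@total_setT _ H))).
move=> _ [_ [w [[u [v ->]] _ ->]]].
by rewrite tens21E tens2E !tassoc tens12E tens2E.
Qed.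

Lemma twisted_coobject_conditions : coobject_conditions DM twisted_coobject.
Proof.
have [MW [WW WW'] [F [F' [mF mF' cW]]]] := hW.
have [FL _] := gc_normal hDM.
have wMW := wtens_adj MW.
split => /=.
- exact: group_vN_subspace.
- exact: group_vN_closed.
- by move=> a x y Mx My; rewrite FL //; apply: bop_ext => u; exact: (bop_linear W).
- by move=> x Mx; apply: wtens_mul => //; exact: (gc_map hDM).
- by move=> w h; apply: dot_eq0; apply: h; exists (bid H), w; split=> //; exact: group_vN1.
- move=> w h; apply: dot_eq0; apply: h; exists (bid H), w; rewrite adj_bid; split=> //.
  exact: group_vN1.
- exact: group_vN_mul.
- by move=> x y Mx My; apply: group_vN_mul => //; exact: group_vN_adj.
- by move=> x y Mx My; rewrite (gc_mul hDM) // bcompA.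
- move=> x y Mx My; rewrite adj_comp -bcompA (bcompA (adj W)) WW bcomp1l.
  by rewrite (gc_mul hDM) ?(gc_adj hDM) //; exact: group_vN_adj.
- have FD := comult_coassoc mF mF'.
  have [Fn FE] := mF; have [Fn' FE'] := mF'.
  have Fm : forall X Y, MM X -> MM Y -> F (X \ob Y) = F X \ob F Y.
    apply: normal_multiplicative => // x y x' y' Mx My Mx' My'.
    rewrite !FE ?(gc_mul hDM) //; [|exact: group_vN_mul..].
    by apply: btens_comp; exact: t21P.
  have Fm' : forall X Y, MM X -> MM Y -> F' (X \ob Y) = F' X \ob F' Y.
    apply: normal_multiplicative => // x y x' y' Mx My Mx' My'.
    rewrite !FE' ?(gc_mul hDM) //; [|exact: group_vN_mul..].
    by apply: btens_comp; exact: t12P.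
  (* The maps (W Delta) (x) id and id (x) (W Delta); on W Delta(x) their equality is the cocycle
     identity times the coassociativity of Delta. *)
  exists (fun Z => tens21 W (bid H) \ob F Z), (fun Z => tens12 (bid H) W \ob F' Z); split.
  + split; first exact: (normal_comp Fn (normal_mull setT _)).
    move=> x y Mx My; rewrite FE // -[in RHS](bcomp1l y).
    by apply/esym/btens_comp; exact: t21P.
  + split; first exact: (normal_comp Fn' (normal_mull setT _)).
    move=> x y Mx My; rewrite FE' // -[in RHS](bcomp1l x).
    by apply/esym/btens_comp; exact: t12P.
  + move=> x Mx; have MD := gc_map hDM Mx.
    by rewrite Fm // Fm' // !bcompA cW FD.
(* Approximating W^* Z by sums of y1 (x) y2 suffices, because W (y1 (x) y2) is the twisted
   comultiplication of 1 times y1 (x) y2. *)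
- move=> Z MZ; have -> : Z = W \ob (adj W \ob Z) \ob bid _ by rewrite bcomp1 bcompA WW' bcomp1l.
  apply: (sw_closure_map (@sw_continuous_comp _ _ _ _ _ (bid (tsq T)) W) _ (wtens_mul wMW MZ)).
  move=> Y SY; apply: sub_sw_closure; rewrite bcomp1.
  set P := lspan _; have sP : lin_subspace P by exact: lspan_subspace.
  apply: (@lspan_min _ _ _ [set Y | P (W \ob Y)] _ _ Y SY).
    have [P0 PP] := sP; split=> [|a p q /= Pp Pq].
      by rewrite /= (_ : _ \ob _ = 0) //; apply: bop_ext => u; exact: (bop0 W).
    rewrite /= (_ : _ \ob _ = a *: (W \ob p) + (W \ob q)); first exact: PP.
    by apply: bop_ext => u; exact: (bop_linear W).
  move=> _ [y1 [y2 [M1 M2 ->]]]; apply: sub_lspan; exists (bid H), y1, y2; split=> //.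
    exact: group_vN1.
  by rewrite comult1 bcomp1.
Qed.

Lemma cocycle_trivial : torsion_free G \/ no_square_order_subgroup G ->
  unitary_2coboundary M DM W.
Proof.
move=> hG; have [u [uu uM uE]] := coobject_trivial hDM twisted_coobject_conditions hG.
(* At x = 1 the isomorphism reads Delta(u) = (u (x) u) W, and u M = M puts u itself in M. *)
have {uE} := uE (bid H) group_vN1; rewrite /= bcomp1 comult1 bcomp1 => uE.
have [u1 u2] := uu; exists u; split => //.
  by rewrite -[M]uM; exists (bid H); [exact: group_vN1 | exact: bcomp1].
by rewrite uE bcompA -tens2_comp u1 [tens2 _ _ _ _](btens_bid (t2P T)) bcomp1l.
Qed.
End Twist.
End Cocycle.

Lemma coobject_conditionsW (R : realType) (G : groupType) (T : tensor_powers (l2 R G))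
    (DM : bop (l2 R G) (l2 R G) -> bop (tsq T) (tsq T)) (X : coobject_data T) :
  is_right_galois_coobject (group_vN R G) DM X -> coobject_conditions DM X.
Proof.
by case=> _ ? ? ? ? [? _] /dense_total ? /dense_total ? *; split.
Qed.

Theorem corollary7p4 (R : realType) (G : groupType)
    (T : tensor_powers (l2 R G))
    (DeltaM : bop (l2 R G) (l2 R G) -> bop (tsq T) (tsq T)) :
  countable [set: G] ->
  torsion_free G \/ no_square_order_subgroup G ->
  is_group_comult DeltaM ->
  (forall X : coobject_data T,
     is_right_galois_coobject (group_vN R G) DeltaM X ->
     coobject_iso X (self_coobject (group_vN R G) DeltaM)) /\
  (forall W : bop (tsq T) (tsq T),
     unitary_2cocycle (group_vN R G) DeltaM W ->
     unitary_2coboundary (group_vN R G) DeltaM W).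
Proof.
move=> _ hG hD; split=> [X hX|W hW]; last exact: cocycle_trivial.
exact: coobject_trivial (coobject_conditionsW hX) hG.
Qed.
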